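(* Let $R$ be a noetherian ring and let $n>0$ be an integer. Then $({\rm dw}\widetilde{\mathcal{P}_n},({\rm dw}\widetilde{\mathcal{P}_n})^\perp)$ is a complete cotorsion pair in ${\rm Ch}(R\text{-}{\rm Mod})$, cogenerated by ${\rm dw}\widetilde{\mathcal{P}_n^{\aleph_0}}$.
   Context: Modules are left $R$-modules; noetherian means left and right noetherian. ${\rm Ch}(R\text{-}{\rm Mod})$ is the category of (unbounded) chain complexes of left $R$-modules. $\mathcal{P}_n$ is the class of modules of projective dimension at most $n$. $\mathcal{P}_n^{\aleph_0}$ is the class (a set up to isomorphism) of modules $M$ for which there is an exact sequence $0\to P_n\to\cdots\to P_0\to M\to 0$ with every $P_k$ a countably generated projective module. For a class $\mathcal{A}$ of modules, ${\rm dw}\widetilde{\mathcal{A}}$ is the class of complexes $X$ with $X_m\in\mathcal{A}$ for all $m\in\mathbb{Z}$. Orthogonals are with respect to ${\rm Ext}^1$ in ${\rm Ch}(R\text{-}{\rm Mod})$: $\mathcal{X}^\perp=\{Z:{\rm Ext}^1(X,Z)=0\ \forall X\in\mathcal{X}\}$ and ${}^\perp\mathcal{X}=\{Z:{\rm Ext}^1(Z,X)=0\ \forall X\in\mathcal{X}\}$. A pair $(\mathcal{X},\mathcal{Y})$ is a cotorsion pair if $\mathcal{X}={}^\perp\mathcal{Y}$ and $\mathcal{Y}=\mathcal{X}^\perp$. It is complete if for every object $Z$ there are short exact sequences $0\to B\to A\to Z\to 0$ and $0\to Z\to B'\to A'\to 0$ with $A,A'\in\mathcal{X}$ and $B,B'\in\mathcal{Y}$.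 It is cogenerated by a set $\mathcal{S}\subseteq\mathcal{X}$ if $\mathcal{Y}=\mathcal{S}^\perp$ (here a class with only a set of isomorphism classes is treated as a set). *)

(* Defs.v *)
From HB Require Import structures.
From mathcomp Require Import all_boot all_order all_algebra.

Set Implicit Arguments.
Unset Strict Implicit.
Unset Printing Implicit Defensive.

Import GRing.Theory.
Local Open Scope ring_scope.

(** * Noetherian rings *)

Definition left_ideal (R : pzRingType) (I : R -> Prop) : Prop :=
  [/\ I 0,
      forall x y : R, I x -> I y -> I (x + y)
    & forall a x : R, I x -> I (a * x)].

Definition left_noetherian (R : pzRingType) : Prop :=
  forall I : nat -> R -> Prop,
    (forall k, left_ideal (I k)) ->
    (forall k x, I k x -> I k.+1 x) ->
    exists N : nat, forall k, (N <= k)%N -> forall x, I k x -> I N x.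

(* Right ideals of R are the left ideals of the opposite ring R^c. *)
Definition noetherian (R : pzRingType) : Prop :=
  left_noetherian R /\ left_noetherian R^c.

(** * Modules *)

Section Modules.

Variable R : pzRingType.

Definition mod_class : Type := lmodType R -> Prop.

Definition surjective_fun (A B : Type) (f : A -> B) : Prop :=
  forall y, exists x, f x = y.

Definition projective (P : lmodType R) : Prop :=
  forall (M N : lmodType R) (g : {linear M -> N}) (f : {linear P -> N}),
    surjective_fun g -> exists h : {linear P -> M}, forall x, g (h x) = f x.

Definition countably_generated (M : lmodType R) : Prop :=
  exists g : nat -> M,
    forall x : M, exists (k : nat) (a : 'I_k -> R), x = \sum_(i < k) a i *: g i.

(* An exact sequence 0 -> P_n -> ... -> P_0 -> M -> 0 with all P_k in C; the
   sequence is prolonged by P_k = 0 for k > n, so that exactness at P_(n+1)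
   and P_n yields the injectivity of P_n -> P_(n-1) (of P_0 -> M if n = 0). *)
Definition has_resolution (C : mod_class) (n : nat) (M : lmodType R) : Prop :=
  exists (P : nat -> lmodType R) (d : forall k, {linear P k.+1 -> P k})
         (e : {linear P 0%N -> M}),
    [/\ forall k, (k <= n)%N -> C (P k),
        forall k, (n < k)%N -> forall x : P k, x = 0,
        surjective_fun e,
        forall x : P 0%N, e x = 0 <-> exists y, d 0%N y = x
      & forall k (x : P k.+1), d k x = 0 <-> exists y, d k.+1 y = x].

Definition proj_dim_le (n : nat) : mod_class :=
  fun M => has_resolution projective n M.

Definition proj_dim_le_countable (n : nat) : mod_class :=
  fun M => has_resolution (fun P => projective P /\ countably_generated P) n M.

End Modules.

(** * Chain complexes *)

Record chain_complex (R : pzRingType) : Type := ChainComplex {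
  chain_obj :> int -> lmodType R;
  chain_d : forall m : int, {linear chain_obj m -> chain_obj (m - 1)};
  chain_dd : forall (m : int) (x : chain_obj m),
    chain_d (m - 1) (chain_d m x) = 0
}.

Record chain_map (R : pzRingType) (X Y : chain_complex R) : Type := ChainMap {
  chain_fun :> forall m : int, {linear X m -> Y m};
  chain_funP : forall (m : int) (x : X m),
    chain_fun (m - 1) (chain_d X m x) = chain_d Y m (chain_fun m x)
}.

Section Complexes.

Variable R : pzRingType.
Implicit Types X Y Z : chain_complex R.

Definition chain_iso X Y : Prop :=
  exists (f : chain_map X Y) (g : chain_map Y X),
    (forall m x, g m (f m x) = x) /\ (forall m y, f m (g m y) = y).

(* 0 -> X -> Y -> Z -> 0 is exact in Ch(R-Mod), that is, in each degree. *)
Definition short_exact X Y Z (f : chain_map X Y) (g : chain_map Y Z) : Prop :=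
  forall m : int,
    [/\ injective (f m),
        surjective_fun (g m)
      & forall y : Y m, g m y = 0 <-> exists x, f m x = y].

Section DirectSum.

Variables X Y : chain_complex R.

Definition dsum_obj (m : int) : lmodType R := (X m * Y m)%type.

Definition dsum_dfun (m : int) (p : dsum_obj m) : dsum_obj (m - 1) :=
  (chain_d X m p.1, chain_d Y m p.2).

Fact dsum_d_linear m : linear (@dsum_dfun m).
Proof. by move=> a p q; rewrite /dsum_dfun /= !linearP. Qed.

HB.instance Definition _ m :=
  GRing.isLinear.Build R (dsum_obj m) (dsum_obj (m - 1)) *:%R (@dsum_dfun m)
    (@dsum_d_linear m).

Definition dsum_d (m : int) : {linear dsum_obj m -> dsum_obj (m - 1)} :=
  @dsum_dfun m.

Fact dsum_dd m (p : dsum_obj m) : dsum_d (m - 1) (dsum_d m p) = 0.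
Proof. by rewrite /dsum_d /= /dsum_dfun /= !chain_dd. Qed.

Definition dsum : chain_complex R := ChainComplex dsum_dd.

Definition dsum_inlfun (m : int) (x : X m) : dsum m := (x, 0).

Fact dsum_inl_linear m : linear (@dsum_inlfun m).
Proof.
by move=> a x y; congr pair; rewrite /= scaler0 addr0.
Qed.

HB.instance Definition _ m :=
  GRing.isLinear.Build R (X m) (dsum m) *:%R (@dsum_inlfun m)
    (@dsum_inl_linear m).

Fact dsum_inlP m (x : X m) :
  dsum_inlfun (chain_d X m x) = chain_d dsum m (dsum_inlfun x).
Proof. by rewrite /= /dsum_dfun /= linear0. Qed.

Definition dsum_inl : chain_map X dsum :=
  @ChainMap R X dsum (fun m => @dsum_inlfun m) dsum_inlP.

Definition dsum_prrfun (m : int) (p : dsum m) : Y m := p.2.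

Fact dsum_prr_linear m : linear (@dsum_prrfun m).
Proof. by []. Qed.

HB.instance Definition _ m :=
  GRing.isLinear.Build R (dsum m) (Y m) *:%R (@dsum_prrfun m)
    (@dsum_prr_linear m).

Fact dsum_prrP m (p : dsum m) :
  dsum_prrfun (chain_d dsum m p) = chain_d Y m (dsum_prrfun p).
Proof. by []. Qed.

Definition dsum_prr : chain_map dsum Y :=
  @ChainMap R dsum Y (fun m => @dsum_prrfun m) dsum_prrP.

Fact dsum_exact : short_exact dsum_inl dsum_prr.
Proof.
move=> m; split=> [x y [] // | y | [x y]]; first by exists (0, y).
by split=> /= [-> | [z [_ <-]]] //; exists x.
Qed.

End DirectSum.

(** * Vanishing of Yoneda Ext^1 *)

Record extension X Z : Type := Extension {
  ext_mid : chain_complex R;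
  ext_in : chain_map Z ext_mid;
  ext_out : chain_map ext_mid X;
  ext_exact : short_exact ext_in ext_out
}.

(* Such a phi is automatically an isomorphism (five lemma), so this is an
   equivalence relation; Ext^1(X, Z) is the set of its classes, and its zero
   is the class of the split extension. *)
Definition ext_equiv X Z (E F : extension X Z) : Prop :=
  exists phi : chain_map (ext_mid E) (ext_mid F),
    (forall m z, phi m (ext_in E m z) = ext_in F m z) /\
    (forall m y, ext_out F m (phi m y) = ext_out E m y).

Definition split_extension X Z : extension X Z :=
  Extension (@dsum_exact Z X).

Definition Ext1_eq0 X Z : Prop :=
  forall E : extension X Z, ext_equiv E (split_extension X Z).

(** * Cotorsion pairs *)

Definition cplx_class : Type := chain_complex R -> Prop.

Implicit Types A B S : cplx_class.

Definition right_orth A : cplx_class :=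
  fun Z => forall X, A X -> Ext1_eq0 X Z.

Definition left_orth B : cplx_class :=
  fun Z => forall X, B X -> Ext1_eq0 Z X.

Definition cotorsion_pair A B : Prop :=
  (forall X, A X <-> left_orth B X) /\ (forall Y, B Y <-> right_orth A Y).

Definition complete_pair A B : Prop :=
  forall Z,
    (exists (Y X : chain_complex R) (i : chain_map Y X) (p : chain_map X Z),
        [/\ A X, B Y & short_exact i p]) /\
    (exists (Y X : chain_complex R) (i : chain_map Z Y) (p : chain_map Y X),
        [/\ A X, B Y & short_exact i p]).

(* The index type ranges over the universe of the underlying types of modules:
   with an arbitrary large I (such as chain_complex R itself) every class of
   complexes would qualify. *)
Definition essentially_small S : Prop :=
  exists (I : Type@{GRing.Lmodule.axioms_.u0}) (F : I -> chain_complex R),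
    forall X, S X -> exists i, chain_iso X (F i).

Definition cogenerated_by A B S : Prop :=
  [/\ forall X, S X -> A X,
      essentially_small S
    & forall Y, B Y <-> right_orth S Y].

Definition dw (C : mod_class R) : cplx_class := fun X => forall m : int, C (X m).

End Complexes.

(* Main.v *)
From HB Require Import structures.
Require Import Defs.
From mathcomp Require Import all_boot all_order all_algebra.
From mathcomp Require Import boolp classical_sets functions.

(**
By Eklof's lemma and the small object argument it is enough to exhibit every
X in dw P_n as a filtered complex whose factors are countable complexes of
dw P_n, and to know that dw P_n is closed under filtrations (Auslander's lemma
in each degree) and under direct summands.

Filtrations are not indexed by ordinals.  A filtration of X is a family of
subcomplexes, indexed by a preorder in which every chain has an upper bound
that carries the union, such that each proper member has a strictly larger one
with a good quotient; Zorn's lemma replaces transfinite induction.  For X in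
dw P_n the members come from subsets of the bases of free resolutions that
span subresolutions (as in Hill's lemma).  Over a left noetherian ring a
submodule of a countably generated module is countably generated, so a member
can be enlarged by closing off countably many basis elements in countably many
steps.

The small object argument is not iterated transfinitely either.  All cells to
be attached to Z are named in advance by the elements of an inductive type: a
node records a subcomplex K of a fixed countable projective complex P, and a
map from K to Z plus finitely many P's of the children at each element of K.
One quotient of Z + (sum of P's over all legitimate nodes) identifies each K
with its image; well-foundedness of the nodes shows that Z embeds in it and
that the cokernel is filtered by the quotients P / K.
*)

(** The usual small object argument needs more stages than K has elements. Here a node lists
    finitely many children for each element of K, so a map from K into the finished complex refers
    only to cells already named and is itself the datum of a node: nothing is left to attach. The
    price is that attaching maps are bare functions, linear only modulo the cells below them.

    The pairs (P, K) arise because P, a sum of disks on countably many generators per degree, is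
    projective among complexes and covers every countable complex. Extending maps from K to P
    therefore forces Ext^1(P / K, -) to vanish.

    A single well-ordered filtration per module would not do. The filtration of M has to match one
    of its syzygy, and the filtration in degree m has to be carried by d into the one in degree m -
    1. In a Hill family any two comparable members have a good quotient, so two families can be
    enlarged alternately and the limit is still a legitimate step. The noetherian hypothesis keeps
    each such enlargement countable, by bounding the part of a syzygy lying over countably many
    basis elements. *)

Set Implicit Arguments.
Unset Strict Implicit.
Unset Printing Implicit Defensive.

Import GRing.Theory.
Local Open Scope ring_scope.

(** * Reflection for identities in abelian groups *)

Section ZmodReflection.

Inductive zexpr := ZVar of nat | ZAdd of zexpr & zexpr | ZOpp of zexpr | ZNil.

Fixpoint zeval (V : zmodType) (env : seq V) (e : zexpr) : V :=
  match e with
  | ZVar i => nth 0 env i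
  | ZAdd a b => zeval env a + zeval env b
  | ZOpp a => - zeval env a
  | ZNil => 0
  end.

Fixpoint zcoef (e : zexpr) (i : nat) : int :=
  match e with
  | ZVar j => (j == i)%:R
  | ZAdd a b => zcoef a i + zcoef b i
  | ZOpp a => - zcoef a i
  | ZNil => 0
  end.

Lemma zevalE (V : zmodType) (env : seq V) e :
  zeval env e = \sum_(i < size env) env`_i *~ zcoef e i.
Proof.
elim: e => [j|a IHa b IHb|a IHa|] /=; rewrite ?IHa ?IHb.
- have [ltj|lej] := ltnP j (size env).
    rewrite (bigD1 (Ordinal ltj)) //= eqxx big1 ?addr0 ?mulr1z // => i ne.
    by case: eqP => [e|_]; rewrite ?mulr0z //; case/eqP: ne; apply: val_inj.
  rewrite nth_default // big1 // => i _.
  by case: eqP => [e|_]; rewrite ?mulr0z //; move: (ltn_ord i); rewrite -e ltnNge lej.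
- by rewrite -big_split; apply: eq_bigr => i _; rewrite mulrzDr.
- by rewrite -sumrN; apply: eq_bigr => i _; rewrite mulrNz.
- by rewrite big1 // => i _; rewrite mulr0z.
Qed.

Lemma zeval_eq (V : zmodType) (env : seq V) a b :
  all (fun i => zcoef a i == zcoef b i) (iota 0 (size env)) ->
  zeval env a = zeval env b.
Proof.
move=> /allP h; rewrite !zevalE; apply: eq_bigr => i _.
by rewrite (eqP (h i _)) // mem_iota /= add0n ltn_ord.
Qed.

End ZmodReflection.

Ltac zindex x env :=
  lazymatch env with
  | cons x _ => constr:(0%N)
  | cons _ ?l => let n := zindex x l in constr:(S n)
  end.

Ltac zmember x env :=
  lazymatch env with
  | nil => constr:(false)
  | cons x _ => constr:(true)
  | cons _ ?l => zmember x l
  end.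

Ltac zatoms env t :=
  lazymatch t with
  | (?a + ?b) => let env1 := zatoms env a in zatoms env1 b
  | (- ?a) => zatoms env a
  | 0 => env
  | _ => lazymatch zmember t env with
         | true => env
         | false => constr:(cons t env)
         end
  end.

Ltac zreify env t :=
  lazymatch t with
  | (?a + ?b) => let x := zreify env a in let y := zreify env b in constr:(ZAdd x y)
  | (- ?a) => let x := zreify env a in constr:(ZOpp x)
  | 0 => constr:(ZNil)
  | _ => let n := zindex t env in constr:(ZVar n)
  end.

(* Decides equalities that hold in every abelian group. *)
Ltac zmod :=
  rewrite /= ?(scalerDr, scalerBr, scalerN, scaler0, scale1r);
  lazymatch goal with
  | |- @eq ?T ?a ?b =>
    let env := zatoms (@nil T) a in
    let env := zatoms env b in
    let x := zreify env a in
    let y := zreify env b in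
    exact: (@zeval_eq _ env x y isT)
  end.

(** * Submodules and subquotients *)

Section LinearRelations.

Variable R : pzRingType.
Implicit Types M N Q : lmodType R.

Definition submod M (A : M -> Prop) : Prop :=
  A 0 /\ forall (a : R) x y, A x -> A y -> A (a *: x + y).

Definition linrel M N (r : M -> N -> Prop) : Prop :=
  r 0 0 /\ forall (a : R) x y x' y',
    r x y -> r x' y' -> r (a *: x + x') (a *: y + y').

Lemma submod0 M (A : M -> Prop) : submod A -> A 0. Proof. by case. Qed.

Lemma submodD M (A : M -> Prop) x y : submod A -> A x -> A y -> A (x + y).
Proof. by case=> _ h hx hy; rewrite -[x]scale1r; apply: h. Qed.

Lemma submodZ M (A : M -> Prop) a x : submod A -> A x -> A (a *: x).
Proof. by case=> h0 h hx; rewrite -[_ *: _]addr0; apply: h. Qed.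

Lemma submodN M (A : M -> Prop) x : submod A -> A x -> A (- x).
Proof. by move=> hA hx; rewrite -scaleN1r; apply: submodZ. Qed.

Lemma submodB M (A : M -> Prop) x y : submod A -> A x -> A y -> A (x - y).
Proof. by move=> hA hx hy; apply: submodD => //; apply: submodN. Qed.

Lemma submod_sum M (A : M -> Prop) I (s : seq I) (P : pred I) (F : I -> M) :
  submod A -> (forall i, P i -> A (F i)) -> A (\sum_(i <- s | P i) F i).
Proof.
move=> hA h; elim/big_rec: _ => [|i x Pi Ax]; first exact: submod0.
by apply: submodD => //; apply: h.
Qed.

Lemma submodT M : submod (fun _ : M => True). Proof. by []. Qed.

Lemma submod_eq0 M : submod (fun x : M => x = 0).
Proof. by split=> // a x y -> ->; rewrite scaler0 addr0. Qed.

Lemma submod_preim M N (f : {linear M -> N}) (A : N -> Prop) :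
  submod A -> submod (fun x => A (f x)).
Proof. by move=> [h0 h]; split=> [|a x y ? ?]; rewrite ?linear0 ?linearP //; apply: h. Qed.

Lemma submod_im M N (f : {linear M -> N}) (A : M -> Prop) :
  submod A -> submod (fun y => exists2 x, A x & f x = y).
Proof.
move=> [h0 h]; split=> [|a _ _ [x hx <-] [y hy <-]]; first by exists 0; rewrite ?linear0.
by exists (a *: x + y); rewrite ?linearP //; apply: h.
Qed.

Lemma linrel0 M N (r : M -> N -> Prop) : linrel r -> r 0 0. Proof. by case. Qed.

Lemma linrelD M N (r : M -> N -> Prop) x y x' y' :
  linrel r -> r x y -> r x' y' -> r (x + x') (y + y').
Proof. by case=> _ h hx hy; rewrite -[x]scale1r -[y]scale1r; apply: h. Qed.

Lemma linrelZ M N (r : M -> N -> Prop) a x y :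
  linrel r -> r x y -> r (a *: x) (a *: y).
Proof.
by case=> h0 h hx; rewrite -[a *: x]addr0 -[a *: y]addr0; apply: h.
Qed.

Lemma linrelB M N (r : M -> N -> Prop) x y x' y' :
  linrel r -> r x y -> r x' y' -> r (x - x') (y - y').
Proof.
move=> lr h h'; apply: linrelD => //; rewrite -[- x']scaleN1r -[- y']scaleN1r.
exact: linrelZ.
Qed.

Lemma linrel_comp M N Q (r : M -> N -> Prop) (r' : N -> Q -> Prop) :
  linrel r -> linrel r' -> linrel (fun x z => exists y, r x y /\ r' y z).
Proof.
move=> lr lr'; split=> [|a x z x' z' [y [h1 h2]] [y' [h3 h4]]].
  by exists 0; split; apply: linrel0.
by exists (a *: y + y'); split; [apply: (lr.2) | apply: (lr'.2)].
Qed.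

Lemma linrel_inv M N (r : M -> N -> Prop) : linrel r -> linrel (fun y x => r x y).
Proof. by move=> lr; split=> [|a x y x' y' h h']; [apply: linrel0 | apply: (lr.2)]. Qed.

Lemma linrel_fun M N (f : {linear M -> N}) : linrel (fun x y => f x = y).
Proof. by split=> [|a x _ x' _ <- <-]; rewrite ?linear0 ?linearP. Qed.

Definition lin_pack M N (f : M -> N) (lf : linear f) : {linear M -> N} :=
  HB.pack f (GRing.isLinear.Build R M N *:%R f lf).

(** Differences of related pairs are related, so single-valuedness at 0 gives it everywhere. Maps
    into and out of subquotients are built this way: no representatives are chosen, and
    well-definedness is checked at 0 only. *)
Lemma lin_of_rel M N (r : M -> N -> Prop) :
    linrel r -> (forall x, exists y, r x y) -> (forall y, r 0 y -> y = 0) ->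
  {f : {linear M -> N} | forall x y, r x y <-> f x = y}.
Proof.
move=> lr tot fun0.
have rI x y y' : r x y -> r x y' -> y = y'.
  move=> h h'; apply/eqP; rewrite -subr_eq0; apply/eqP/fun0.
  by rewrite -(subrr x); apply: linrelB.
pose f x := sval (cid (tot x)).
have rf x : r x (f x) by rewrite /f; case: cid.
have lf : linear f by move=> a x y; apply: rI (rf _) _; apply: (lr.2).
exists (lin_pack lf) => x y; split=> [h | <-]; last exact: rf.
exact: rI (rf _) h.
Qed.

(* [r] induces an isomorphism B / A ~ Q. *)
Definition subquot M (A B : M -> Prop) Q (r : M -> Q -> Prop) : Prop :=
  [/\ linrel r,
      forall x, B x <-> exists q, r x q,
      forall q, exists x, r x q,
      forall x, r x 0 <-> A x
    & forall q, r 0 q -> q = 0].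

Lemma subquot_fun M (A B : M -> Prop) Q (r : M -> Q -> Prop) x q q' :
  subquot A B r -> r x q -> r x q' -> q = q'.
Proof.
case=> lr _ _ _ fun0 h h'; apply/eqP; rewrite -subr_eq0; apply/eqP/fun0.
by rewrite -(subrr x); apply: linrelB.
Qed.

Lemma subquot_dom M (A B : M -> Prop) Q (r : M -> Q -> Prop) x q :
  subquot A B r -> r x q -> B x.
Proof. by case=> _ h _ _ _ rxq; apply/h; exists q. Qed.

Lemma subquot_shift M (A B : M -> Prop) Q (r : M -> Q -> Prop) x y q :
  subquot A B r -> r x q -> A (y - x) -> r y q.
Proof.
case=> lr _ _ h0 _ rxq Ayx; rewrite -[y](subrK x) -[q]add0r.
by apply: linrelD => //; apply/h0.
Qed.

Lemma subquot_eq M (A B : M -> Prop) Q (r : M -> Q -> Prop) x y q :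
  subquot A B r -> r x q -> r y q -> A (x - y).
Proof.
by case=> lr _ _ h0 _ hx hy; apply/h0; rewrite -(subrr q); apply: linrelB.
Qed.

Record subquot_data M := SubquotData {
  sq_A : M -> Prop; sq_B : M -> Prop;
  sq_Aw : submod sq_A; sq_Bw : submod sq_B;
  sq_AB : forall x, sq_A x -> sq_B x
}.

Section SubquotType.

Variables (M : lmodType R) (D : subquot_data M).
Let A := sq_A D.
Let B := sq_B D.

Fact sq_rep_ex (x : M) : exists y : M, `[< A (x - y) >].
Proof. by exists x; apply/asboolP; rewrite subrr; apply: submod0 (sq_Aw D). Qed.

(** [xchoose] depends only on the extension of its predicate, so all elements of a coset of [A] get
    the same representative. The subquotient is then carried by the representatives that lie in
    [B]. *)
Definition sq_rep (x : M) : M := xchoose (sq_rep_ex x).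

Lemma sq_repP x : A (x - sq_rep x).
Proof. by apply/asboolP; apply: (xchooseP (sq_rep_ex x)). Qed.

Lemma sq_rep_eq x y : A (x - y) -> sq_rep x = sq_rep y.
Proof.
move=> h; apply: eq_xchoose => z; apply/asbool_equiv_eq; split=> hz.
  have -> : y - z = (x - z) - (x - y) by zmod.
  exact: submodB (sq_Aw D) hz h.
have -> : x - z = (x - y) + (y - z) by zmod.
exact: submodD (sq_Aw D) h hz.
Qed.

Lemma sq_rep_B x : B x -> B (sq_rep x).
Proof.
move=> hx; have -> : sq_rep x = x - (x - sq_rep x) by zmod.
by apply: submodB (sq_Bw D) hx _; apply: sq_AB; apply: sq_repP.
Qed.

Lemma sq_rep_id x : sq_rep (sq_rep x) = sq_rep x.
Proof.
apply: sq_rep_eq; have -> : sq_rep x - x = - (x - sq_rep x) by zmod.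
exact: submodN (sq_Aw D) (sq_repP x).
Qed.

Definition sq_pred : pred M := fun x => `[< B x /\ sq_rep x = x >].

Definition sq_type : Type := {x : M | sq_pred x}.

HB.instance Definition _ := [isSub of sq_type for @sval M sq_pred].
HB.instance Definition _ := [Choice of sq_type by <:].

Fact sq_mk_proof x : B x -> sq_pred (sq_rep x).
Proof. by move=> hx; apply/asboolP; split; [apply: sq_rep_B | apply: sq_rep_id]. Qed.

Definition sq_mk x (hx : B x) : sq_type := Sub (sq_rep x) (sq_mk_proof hx).

Lemma sq_valB (q : sq_type) : B (val q).
Proof. by case: q => x /= /asboolP []. Qed.

Lemma sq_valK (q : sq_type) : sq_rep (val q) = val q.
Proof. by case: q => x /= /asboolP []. Qed.

Lemma sq_mkE x y (hx : B x) (hy : B y) : A (x - y) -> sq_mk hx = sq_mk hy.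
Proof. by move=> h; apply: val_inj; apply: sq_rep_eq. Qed.

Lemma sq_mk_val (q : sq_type) (h : B (val q)) : sq_mk h = q.
Proof. by apply: val_inj; rewrite /= sq_valK. Qed.

Let Bd x y (hx : B x) (hy : B y) : B (x + y) := submodD (sq_Bw D) hx hy.

Definition sq_zero : sq_type := sq_mk (submod0 (sq_Bw D)).
Definition sq_add (p q : sq_type) : sq_type := sq_mk (Bd (sq_valB p) (sq_valB q)).
Definition sq_opp (p : sq_type) : sq_type := sq_mk (submodN (sq_Bw D) (sq_valB p)).
Definition sq_scale a (p : sq_type) : sq_type :=
  sq_mk (submodZ a (sq_Bw D) (sq_valB p)).

Let Arep x : A (sq_rep x - x).
Proof.
have -> : sq_rep x - x = - (x - sq_rep x) by zmod.
exact: submodN (sq_Aw D) (sq_repP x).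
Qed.

Let Aw := sq_Aw D.

Fact sq_addA : associative sq_add.
Proof.
move=> p q r; apply: sq_mkE => /=.
have -> : val p + sq_rep (val q + val r) - (sq_rep (val p + val q) + val r) =
  (sq_rep (val q + val r) - (val q + val r)) +
  ((val p + val q) - sq_rep (val p + val q)) by zmod.
exact: submodD Aw (Arep _) (sq_repP _).
Qed.

Fact sq_addC : commutative sq_add.
Proof. by move=> p q; apply: sq_mkE => /=; rewrite [val q + _]addrC subrr; apply: submod0 Aw. Qed.

Fact sq_add0 : left_id sq_zero sq_add.
Proof.
move=> p; rewrite -[RHS](sq_mk_val (sq_valB p)); apply: sq_mkE => /=.
have -> : sq_rep 0 + val p - val p = sq_rep 0 - 0 by zmod.
exact: Arep.
Qed.

Fact sq_addN : left_inverse sq_zero sq_opp sq_add.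
Proof.
move=> p; apply: sq_mkE => /=.
have -> : sq_rep (- val p) + val p - 0 = sq_rep (- val p) - - val p by zmod.
exact: Arep.
Qed.

HB.instance Definition _ := GRing.isZmodule.Build sq_type sq_addA sq_addC sq_add0 sq_addN.

Fact sq_scaleA a b (p : sq_type) : sq_scale a (sq_scale b p) = sq_scale (a * b) p.
Proof.
by apply: sq_mkE; rewrite /= -scalerA -scalerBr; apply: submodZ Aw (Arep _).
Qed.

Fact sq_scale1 : left_id 1 sq_scale.
Proof.
move=> p; rewrite -[RHS](sq_mk_val (sq_valB p)); apply: sq_mkE.
by rewrite scale1r subrr; apply: submod0 Aw.
Qed.

Fact sq_scaleDr : right_distributive sq_scale +%R.
Proof.
move=> a p q; apply: sq_mkE => /=.
have -> : a *: sq_rep (val p + val q) - (sq_rep (a *: val p) + sq_rep (a *: val q)) =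
  a *: (sq_rep (val p + val q) - (val p + val q)) + ((a *: val p - sq_rep (a *: val p))
   + (a *: val q - sq_rep (a *: val q))) by zmod.
apply: submodD => //; first exact: submodZ Aw (Arep _).
exact: submodD Aw (sq_repP _) (sq_repP _).
Qed.

Fact sq_scaleDl (p : sq_type) : {morph sq_scale^~ p : a b / a + b}.
Proof.
move=> a b; apply: sq_mkE => /=; rewrite scalerDl.
have -> : a *: val p + b *: val p - (sq_rep (a *: val p) + sq_rep (b *: val p)) =
  (a *: val p - sq_rep (a *: val p)) + (b *: val p - sq_rep (b *: val p)) by zmod.
exact: submodD Aw (sq_repP _) (sq_repP _).
Qed.

HB.instance Definition _ := GRing.Zmodule_isLmodule.Build R sq_type
  sq_scaleA sq_scale1 sq_scaleDr sq_scaleDl.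

Definition sq_rel (x : M) (q : sq_type) : Prop := exists h : B x, sq_mk h = q.

Lemma sq_relP : subquot A B sq_rel.
Proof.
have mkD x (q : sq_type) : sq_rel x q -> A (x - val q).
  by case=> h <-; apply: sq_repP.
have mkI x (q : sq_type) : A (x - val q) -> sq_rel x q.
  move=> h; have Bx : B x.
    by rewrite -[x](subrK (val q)); apply: Bd (sq_AB h) (sq_valB q).
  by exists Bx; rewrite -[RHS](sq_mk_val (sq_valB q)); apply: sq_mkE.
split.
- split=> [|a x p y q hx hy]; first by exists (submod0 (sq_Bw D)).
  apply: mkI => /=; have -> : a *: x + y - sq_rep (sq_rep (a *: val p) + val q) =
    (sq_rep (a *: val p) + val q - sq_rep (sq_rep (a *: val p) + val q)) +
     (a *: (x - val p) + ((y - val q) + (a *: val p - sq_rep (a *: val p)))) by zmod.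
  apply: submodD => //; first exact: sq_repP.
  apply: submodD => //; first exact: submodZ Aw (mkD _ _ hx).
  exact: submodD Aw (mkD _ _ hy) (sq_repP _).
- by move=> x; split=> [h | [q []]]; [exists (sq_mk h); exists h|].
- by move=> q; exists (val q); exists (sq_valB q); apply: sq_mk_val.
- move=> x; split=> [/mkD /= h | h].
    rewrite -[x](subrK (sq_rep 0)); apply: submodD => //.
    by rewrite -[sq_rep 0]subr0; apply: Arep.
  apply: mkI => /=; rewrite -[sq_rep 0]subr0; exact: submodB Aw h (Arep _).
- by move=> q [h <-]; apply: sq_mkE; rewrite subrr; apply: submod0 Aw.
Qed.

End SubquotType.

(** The sigma type lives in [Type], so quotients can be formed in all degrees of a complex at
    once. *)
Lemma subquot_exists M (A B : M -> Prop) :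
  submod A -> submod B -> (forall x, A x -> B x) ->
  {Q : lmodType R & {r : M -> Q -> Prop | subquot A B r}}.
Proof.
move=> hA hB hAB; exists (sq_type (SubquotData hA hB hAB)).
by exists (@sq_rel _ (SubquotData hA hB hAB)); apply: (sq_relP (SubquotData hA hB hAB)).
Qed.

End LinearRelations.

(** * Direct sums *)

Section DirectSums.

Variables (R : pzRingType) (T : choiceType) (V : lmodType R).
Implicit Types (t : T) (v : V) (N : lmodType R).

Let fsupp (f : T -> V) : Prop := exists s : seq T, forall t, f t != 0 -> t \in s.

Fact fsupp_submod : submod fsupp.
Proof.
split=> [|a f g [s hs] [s' hs']]; first by exists [::] => t; rewrite eqxx.
exists (s ++ s') => t; rewrite mem_cat => h; apply/orP.
have [f0|/hs] := eqVneq (f t) 0; last by left.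
by right; apply: hs'; apply: contraNneq h => g0; have -> : (a *: f + g) t = a *: f t + g t by []; rewrite f0 g0 scaler0 addr0.
Qed.

Let dsQ := subquot_exists (submod_eq0 (T -> V)) fsupp_submod
  (fun x (h : x = 0) => eq_ind_r fsupp (submod0 fsupp_submod) h).

Definition DS : lmodType R := projT1 dsQ.

Let dsr : (T -> V) -> DS -> Prop := sval (projT2 dsQ).
Let dsrP : subquot (fun f => f = 0) fsupp dsr.
Proof. exact: (svalP (projT2 dsQ)). Qed.

Fact DS_val_subproof : {f : {linear DS -> (T -> V)} | forall w f', dsr f' w <-> f w = f'}.
Proof.
case: dsrP => lr _ surj h0 hf; apply: (@lin_of_rel _ _ _ (fun q f => dsr f q)).
- by split=> [|a x y x' y' h h']; [apply: linrel0 | apply: (lr.2)].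
- by move=> q; have [f hq] := surj q; exists f.
- by move=> f; rewrite h0.
Qed.

Definition DS_val : {linear DS -> (T -> V)} := sval DS_val_subproof.
Definition coord t (w : DS) : V := DS_val w t.

Fact coord_linear t : linear (coord t).
Proof. by move=> a x y; rewrite /coord linearP. Qed.
HB.instance Definition _ t := GRing.isLinear.Build R DS V *:%R (coord t) (@coord_linear t).

Let DS_valP w f : dsr f w <-> DS_val w = f := svalP DS_val_subproof w f.

Lemma coord_inj w w' : (forall t, coord t w = coord t w') -> w = w'.
Proof.
move=> h; have e : DS_val w = DS_val w' by apply/funext => t; apply: h.
by apply: (subquot_fun dsrP); apply/DS_valP; first exact: e.
Qed.

Lemma coord_fin w : exists s : seq T, forall t, coord t w != 0 -> t \in s.
Proof.
have /DS_valP h := erefl (DS_val w).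
by apply: (subquot_dom dsrP h).
Qed.

Lemma DS_build (f : T -> V) (s : seq T) :
  (forall t, f t != 0 -> t \in s) -> exists w : DS, forall t, coord t w = f t.
Proof.
move=> h; have [_ hB _ _ _] := dsrP.
have /hB[w /DS_valP hw] : fsupp f by exists s.
by exists w => t; rewrite /coord hw.
Qed.

Let inj_ex t v : exists w : DS, forall t', coord t' w = if t' == t then v else 0.
Proof.
by apply: (@DS_build _ [:: t]) => t'; rewrite inE; case: (t' =P t) => //; rewrite eqxx.
Qed.

Definition inj t v : DS := sval (cid (inj_ex t v)).

Lemma coordE t t' v : coord t' (inj t v) = if t' == t then v else 0.
Proof. by rewrite /inj; case: cid. Qed.

Fact inj_linear t : linear (inj t).
Proof.
move=> a x y; apply: coord_inj => t'; rewrite linearP /= !coordE.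
by case: eqP => // _; rewrite scaler0 addr0.
Qed.
HB.instance Definition _ t := GRing.isLinear.Build R V DS *:%R (inj t) (@inj_linear t).

Lemma coord_id t v : coord t (inj t v) = v. Proof. by rewrite coordE eqxx. Qed.

Lemma DS_sum w (s : seq T) : uniq s -> (forall t, coord t w != 0 -> t \in s) ->
  w = \sum_(t <- s) inj t (coord t w).
Proof.
move=> us hs; apply: coord_inj => t; rewrite linear_sum /=.
have [ts|nts] := boolP (t \in s).
  rewrite (big_rem _ ts) /= coord_id big_seq big1 ?addr0 // => t' h.
  rewrite coordE; case: eqP h => // <-.
  by rewrite mem_rem_uniq // inE eqxx.
rewrite big_seq big1 => [|t' h]; last by rewrite coordE; case: eqP nts => // ->; rewrite h.
by apply/eqP; apply: contraNT nts; apply: hs.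
Qed.

Lemma coord_support w : exists2 s : seq T, uniq s & forall t, coord t w != 0 <-> t \in s.
Proof.
have [s hs] := coord_fin w; exists [seq t <- undup s | coord t w != 0].
  exact/filter_uniq/undup_uniq.
move=> t; rewrite mem_filter mem_undup; split=> [h | /andP[] //].
by rewrite h /= hs.
Qed.

Lemma DS_in (A : DS -> Prop) (w : DS) : submod A ->
  (forall t, coord t w != 0 -> A (inj t (coord t w))) -> A w.
Proof.
move=> hA h; have [s us hs] := coord_support w.
rewrite (DS_sum us (fun t => (hs t).1)) big_seq; apply: submod_sum => // t ts.
by apply: h; apply/hs.
Qed.

Lemma DS_lift N (h : T -> {linear V -> N}) :
  exists f : {linear DS -> N}, forall t v, f (inj t v) = h t v.
Proof.
pose S w s := \sum_(t <- s) h t (coord t w).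
pose r w y := exists s : seq T, [/\ uniq s, forall t, coord t w != 0 -> t \in s & y = S w s].
(* Enlarging the list adds only zero terms, so two elements can be summed over a common list; this
   makes [r] linear. *)
have ext w s s' : uniq s -> uniq s' -> (forall t, coord t w != 0 -> t \in s) ->
    {subset s <= s'} -> S w s = S w s'.
  move=> us us' hs ss'; rewrite /S [RHS](bigID (mem s)) /= [X in _ + X]big1 => [|t /negP nts].
    rewrite addr0 -[RHS]big_filter; apply: perm_big.
    apply: uniq_perm => // [|t]; first exact: filter_uniq.
    by rewrite mem_filter; case: (boolP (t \in s)) => // /ss' ->.
  have -> : coord t w = 0 by apply/eqP/negPn/negP => /hs.
  by rewrite linear0.
have [|||f hf] := @lin_of_rel _ _ _ r.
- split=> [|a w y w' y' [s [us hs ->]] [s' [us' hs' ->]]].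
    by exists [::]; split=> // [t|]; rewrite ?linear0 ?eqxx // /S big_nil.
  pose u := undup (s ++ s').
  have uu : uniq u by apply: undup_uniq.
  have su : {subset s <= u} by move=> t ts; rewrite mem_undup mem_cat ts.
  have su' : {subset s' <= u} by move=> t ts; rewrite mem_undup mem_cat ts orbT.
  exists u; split=> // [t|]; last first.
    rewrite (ext _ _ _ us uu hs su) (ext _ _ _ us' uu hs' su') /S scaler_sumr -big_split /=.
    by apply: eq_bigr => t _; rewrite !linearP.
  rewrite linearP /= => n0; have [w0|/hs/su //] := eqVneq (coord t w) 0.
  by apply/su'/hs'; apply: contraNneq n0 => w'0; rewrite w0 w'0 scaler0 addr0.
- by move=> w; have [s us hs] := coord_support w; exists (S w s), s; split=> // t /hs.
- by move=> _ [s [_ _ ->]]; rewrite /S big1 // => t _; rewrite linear0 linear0.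
exists f => t v; apply/hf; exists [:: t]; split=> // [t'|].
  by rewrite coordE inE; case: (t' =P t); rewrite ?eqxx.
by rewrite /S big_seq1 coord_id.
Qed.

Lemma DS_eq N (f g : {linear DS -> N}) :
  (forall t v, f (inj t v) = g (inj t v)) -> forall w, f w = g w.
Proof.
move=> h w; have [s us hs] := coord_support w.
rewrite (DS_sum us (fun t => (hs t).1)) !linear_sum.
by apply: eq_bigr => t _; apply: h.
Qed.

Definition supp (U : T -> Prop) (w : DS) : Prop := forall t, ~ U t -> coord t w = 0.

Lemma supp_submod U : submod (supp U).
Proof.
split=> [t _|a x y hx hy t nU]; first by rewrite linear0.
by rewrite linearP /= hx // hy // scaler0 addr0.
Qed.

Lemma supp_sub (U U' : T -> Prop) w : (forall t, U t -> U' t) -> supp U w -> supp U' w.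
Proof. by move=> h hw t nU; apply: hw => /h. Qed.

Lemma supp_inj (U : T -> Prop) t v : U t -> supp U (inj t v).
Proof. by move=> Ut t' nU; rewrite coordE; case: eqP => // e; case: nU; rewrite e. Qed.

Lemma supp_in (A : DS -> Prop) (U : T -> Prop) (w : DS) : submod A ->
  supp U w -> (forall t v, U t -> A (inj t v)) -> A w.
Proof.
move=> hA hw h; apply: DS_in => // t w0; apply: h.
by apply: contrapT => /hw /eqP e; rewrite e in w0.
Qed.

Lemma trunc_exists (U : T -> Prop) : exists f : {linear DS -> DS},
  forall t w, coord t (f w) = if `[< U t >] then coord t w else 0.
Proof.
pose h t : {linear V -> DS} := if `[< U t >] then [the {linear V -> DS} of inj t] else \0.
have [f hf] := DS_lift h; exists f => t w.
pose g := if `[< U t >] then [the {linear DS -> V} of coord t] else \0.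
have -> : (if `[< U t >] then coord t w else 0) = g w by rewrite /g; case: ifP.
apply: (@DS_eq _ [the {linear DS -> V} of coord t \o f]) => t' v /=.
rewrite hf /h /g; case: (asboolP (U t')) => h'; case: (asboolP (U t)) => //= h''.
  by rewrite coordE; case: eqP => // e; case: h''; rewrite e.
by rewrite linear0 coordE; case: eqP => // e; case: h'; rewrite -e.
by rewrite linear0.
Qed.

End DirectSums.

(** * Projective dimension *)

Section ProjectiveDimension.

Variable R : pzRingType.
Implicit Types K L M N P Q : lmodType R.

Definition ses K P M (i : {linear K -> P}) (e : {linear P -> M}) : Prop :=
  [/\ injective i, surjective_fun e & forall x, e x = 0 <-> exists y, i y = x].

Definition miso M N : Prop :=
  exists f : {linear M -> N}, injective f /\ surjective_fun f.

Lemma lin_inj M N (f : {linear M -> N}) : (forall x, f x = 0 -> x = 0) -> injective f.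
Proof.
by move=> h x y e; apply/eqP; rewrite -subr_eq0; apply/eqP/h; rewrite linearB e subrr.
Qed.

Lemma factor_inj K M N (i : {linear K -> M}) (f : {linear N -> M}) :
  injective i -> (forall x, exists y, i y = f x) ->
  exists g : {linear N -> K}, forall x, i (g x) = f x.
Proof.
move=> ii hf; have [|||g hg] := @lin_of_rel _ _ _ (fun x y => i y = f x).
- by split=> [|a x x' y y' h h']; rewrite ?linear0 // !linearP h h'.
- exact: hf.
- by move=> y; rewrite linear0 => h; apply: ii; rewrite h linear0.
by exists g => x; apply/hg.
Qed.

Lemma sub_exists M (B : M -> Prop) : submod B ->
  exists (K : lmodType R) (i : {linear K -> M}),
    injective i /\ forall x, B x <-> exists y, i y = x.
Proof.
move=> hB; have hAB x : x = 0 -> B x by move=> ->; apply: submod0.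
have [Q [r hr]] := subquot_exists (submod_eq0 M) hB hAB.
have [lr hdom surj h0 hf] := hr.
have [|||f hfr] := @lin_of_rel _ _ _ (fun q x => r x q).
- by split=> [|a x y x' y' h h']; [apply: linrel0 | apply: (lr.2)].
- by move=> q; have [x] := surj q; exists x.
- by move=> x; rewrite h0.
exists Q, f; split.
  by apply: lin_inj => q /hfr; apply: hf.
by move=> x; split=> [/hdom [q /hfr <-]|[q /hfr h]]; [exists q | apply/hdom; exists q].
Qed.

Lemma quot_exists M (A : M -> Prop) : submod A ->
  exists (Q : lmodType R) (p : {linear M -> Q}),
    surjective_fun p /\ forall x, p x = 0 <-> A x.
Proof.
move=> hA; have [Q [r hr]] := subquot_exists hA (submodT M) (fun _ _ => I).
have [lr hdom surj h0 hf] := hr.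
have [//|||p hp] := @lin_of_rel _ _ _ r.
- by move=> x; apply/hdom.
- exact: hf.
exists Q, p; split=> [q | x]; first by have [x /hp h] := surj q; exists x.
by rewrite -h0 -hp.
Qed.

Lemma ker_exists P M (e : {linear P -> M}) : surjective_fun e ->
  exists (K : lmodType R) (i : {linear K -> P}), ses i e.
Proof.
move=> se; have [K [i [ii hi]]] := sub_exists (submod_preim e (submod_eq0 M)).
by exists K, i.
Qed.

Lemma miso_sym M N : miso M N -> miso N M.
Proof.
case=> f [fi fs].
have [//|g hg] := @factor_inj _ _ _ f [the {linear N -> N} of idfun] fi.
exists g; split=> [x y e | x]; first by rewrite -[x]hg -[y]hg e.
by exists (f x); apply: fi; rewrite hg.
Qed.

Lemma subquot_iso M (A B : M -> Prop) Q (r : M -> Q -> Prop) Q' (r' : M -> Q' -> Prop) :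
  subquot A B r -> subquot A B r' -> miso Q Q'.
Proof.
move=> h h'; have [lr hd sr h0 hf] := h; have [lr' hd' sr' h0' hf'] := h'.
have [|||f hfr] := @lin_of_rel _ _ _ (fun q q' => exists x, r x q /\ r' x q').
- split=> [|a q1 q1' q2 q2' [x [rx rx']] [y [ry ry']]].
    by exists 0; split; apply: linrel0.
  by exists (a *: x + y); split; [apply: (lr.2) | apply: (lr'.2)].
- move=> q; have [x rx] := sr q; have /hd' [q' rx'] := subquot_dom h rx.
  by exists q', x.
- by move=> q' [x [/h0 /h0' hx hx']]; apply: (subquot_fun h' hx').
exists f; split.
  apply: lin_inj => q /hfr [x [rx /h0' /h0 rx0]]; exact: (subquot_fun h rx).
move=> q'; have [x rx'] := sr' q'; have /hd [q rx] := subquot_dom h' rx'.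
by exists q; apply/hfr; exists x.
Qed.

Lemma projective_retract P Q (i : {linear Q -> P}) (e : {linear P -> Q}) :
  projective P -> (forall x, e (i x) = x) -> projective Q.
Proof.
move=> hP ei M N g f sg.
have [h hh] := hP _ _ g [the {linear P -> N} of f \o e] sg.
by exists [the {linear Q -> M} of h \o i] => x; rewrite /= hh /= ei.
Qed.

Lemma projective_iso M N : miso M N -> projective M -> projective N.
Proof.
move=> [f [fi fs]] hM.
have [//|g hg] := @factor_inj _ _ _ f [the {linear N -> N} of idfun] fi.
exact: projective_retract hM hg.
Qed.

Lemma projective_DS (T : choiceType) (V : lmodType R) :
  projective V -> projective (DS T V).
Proof.
move=> hV M N g f sg.
have /choice [h hh] : forall t : T, exists h : {linear V -> M}, forall v, g (h v) = f (inj t v).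
  by move=> t; apply: (hV _ _ g [the {linear V -> N} of f \o inj t] sg).
have [H hH] := DS_lift h; exists H.
apply: (DS_eq (f := [the {linear DS T V -> N} of g \o H]) (g := f)) => t v /=.
by rewrite hH hh.
Qed.

Definition scale_at N (y : N) (a : R^o) : N := (a : R) *: y.
Fact scale_at_linear N (y : N) : linear (scale_at y).
Proof. by move=> a b c; rewrite /scale_at scalerDl scalerA. Qed.
HB.instance Definition _ N (y : N) := GRing.isLinear.Build R R^o N *:%R (scale_at y) (@scale_at_linear N y).



Lemma projective_ring : projective R^o.
Proof.
move=> M N g f sg; have [y hy] := sg (f 1); exists [the {linear R^o -> M} of scale_at y] => a.
by rewrite /= /scale_at linearZ /= hy -linearZ /= /GRing.scale /= mulr1.
Qed.

Definition pr1 M N (x : M * N) : M := x.1.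
Definition pr2 M N (x : M * N) : N := x.2.
Definition in1 M N (x : M) : M * N := (x, 0).
Definition in2 M N (x : N) : M * N := (0, x).
Fact pr1_linear M N : linear (@pr1 M N). Proof. by []. Qed.
Fact pr2_linear M N : linear (@pr2 M N). Proof. by []. Qed.
Fact in1_linear M N : linear (@in1 M N).
Proof. by move=> a x y; rewrite /in1; congr pair; rewrite /= scaler0 addr0. Qed.
Fact in2_linear M N : linear (@in2 M N).
Proof. by move=> a x y; rewrite /in2; congr pair; rewrite /= scaler0 addr0. Qed.
HB.instance Definition _ M N := GRing.isLinear.Build R (M * N)%type M *:%R (@pr1 M N) (@pr1_linear M N).
HB.instance Definition _ M N := GRing.isLinear.Build R (M * N)%type N *:%R (@pr2 M N) (@pr2_linear M N).
HB.instance Definition _ M N := GRing.isLinear.Build R M (M * N)%type *:%R (@in1 M N) (@in1_linear M N).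
HB.instance Definition _ M N := GRing.isLinear.Build R N (M * N)%type *:%R (@in2 M N) (@in2_linear M N).

Definition pair_map M N M' N' (f : {linear M -> M'}) (g : {linear N -> N'}) (x : M * N) : M' * N' :=
  (f x.1, g x.2).
Fact pair_map_linear M N M' N' (f : {linear M -> M'}) (g : {linear N -> N'}) :
  linear (pair_map f g).
Proof. by move=> a x y; rewrite /pair_map !linearP. Qed.
HB.instance Definition _ M N M' N' f g :=
  GRing.isLinear.Build R (M * N)%type (M' * N')%type *:%R (@pair_map M N M' N' f g)
    (@pair_map_linear M N M' N' f g).

Lemma projective_prod P Q : projective P -> projective Q -> projective (P * Q)%type.
Proof.
move=> hP hQ M N g f sg.
have [h hh] := hP _ _ g [the {linear P -> N} of f \o @in1 P Q] sg.
have [h' hh'] := hQ _ _ g [the {linear Q -> N} of f \o @in2 P Q] sg.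
have lH : linear (fun x : (P * Q)%type => h x.1 + h' x.2).
  by move=> a x y; rewrite /= !linearP; zmod.
exists (lin_pack lH) => x.
have -> : f x = f (in1 Q x.1) + f (in2 P x.2).
  by rewrite -linearD; congr (f _); case: x => x y; congr pair; rewrite /= ?addr0 ?add0r.
by rewrite /= linearD hh hh'.
Qed.

(** Recursive form of [has_resolution], splitting off one syzygy at a time, for inductions on [n];
    [has_resolutionP] compares the two. *)
Fixpoint res (C : mod_class R) (n : nat) M : Prop :=
  if n is n'.+1 then
    exists K P (i : {linear K -> P}) (e : {linear P -> M}), [/\ ses i e, C P & res C n' K]
  else C M.

Lemma res_iso (C : mod_class R) : (forall M N, miso M N -> C M -> C N) ->
  forall n M N, miso M N -> res C n M -> res C n N.
Proof.
move=> hC [|n] M N; first exact: hC.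
move=> [f [fi fs]] [K [P [i [e [[ii se hie] CP hK]]]]].
exists K, P, i, [the {linear P -> N} of f \o e]; split=> //; split=> //.
  by move=> y; have [x <-] := fs y; have [z <-] := se x; exists z.
move=> x; rewrite -hie /=; split=> [h | ->]; last by rewrite linear0.
by apply: fi; rewrite h linear0.
Qed.

Definition pd := res (@projective R).

Lemma pd_iso n M N : miso M N -> pd n M -> pd n N.
Proof. exact: (res_iso (@projective_iso)). Qed.

Lemma projective_pd n P : projective P -> pd n P.
Proof.
elim: n P => [//|n IH] P hP.
have [|K [i hi]] := @ker_exists P P [the {linear P -> P} of idfun].
  by move=> x; exists x.
exists K, P, i, [the {linear P -> P} of idfun]; split=> //; apply: IH.
apply: (@projective_retract _ _ i \0 hP) => x /=.
by have [ii _ h] := hi; apply: ii; rewrite linear0; apply/esym/h; exists x.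
Qed.

Lemma pd_prod n M N : pd n M -> pd n N -> pd n (M * N)%type.
Proof.
elim: n M N => [|n IH] M N; first exact: projective_prod.
move=> [K [P [i [e [[ii se hie] CP hK]]]]] [K' [P' [i' [e' [[ii' se' hie'] CP' hK']]]]].
exists (K * K')%type, (P * P')%type, [the {linear _ -> _} of pair_map i i'],
  [the {linear _ -> _} of pair_map e e']; split; [split|exact: projective_prod|exact: IH].
- by move=> [x y] [x' y'] [/ii -> /ii' ->].
- move=> [x y]; have [p hp] := se x; have [p' hp'] := se' y; exists (p, p').
  by rewrite /= /pair_map /= hp hp'.
- move=> [x y]; split=> [[/hie[k <-] /hie'[k' <-]] | [[k k'] [<- <-]]].
    by exists (k, k').
  congr pair; [apply/hie; by exists k | apply/hie'; by exists k'].
Qed.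

(** Both sides are the pullback of P and P' over M: (k, p') gives its element (p, p') with p = i k +
    h' p', and the K'-component is then p' - h p, where h and h' lift e and e' through each
    other. *)
Lemma schanuel K P M (i : {linear K -> P}) (e : {linear P -> M})
    K' P' (i' : {linear K' -> P'}) (e' : {linear P' -> M}) :
  ses i e -> ses i' e' -> projective P -> projective P' ->
  miso (K * P')%type (K' * P)%type.
Proof.
move=> [ii se hie] [ii' se' hie'] hP hP'.
have [h hh] := hP _ _ e' e se'; have [h' hh'] := hP' _ _ e e' se.
have [|||f hf] := @lin_of_rel _ (K * P')%type (K' * P)%type
  (fun x y => y.2 = i x.1 + h' x.2 /\ i' y.1 = x.2 - h y.2).
- split=> [|a [k p'] [k' p] [l q'] [l' q] /= [h1 h2] [h3 h4]].
    by rewrite /= !linear0; split; zmod.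
  by rewrite !linearP h2 h4; split; [rewrite h1 h3; zmod | zmod].
- move=> [k p'] /=; pose p := i k + h' p'.
  have [|k' hk'] := (hie' (p' - h p)).1; last by exists (k', p).
  rewrite linearB hh linearD hh'; have -> : e (i k) = 0 by apply/hie; exists k.
  by rewrite add0r subrr.
- move=> [k' p] /= []; rewrite !linear0 addr0 => ->.
  rewrite linear0 subrr => h0; congr pair; apply: ii'; by rewrite h0 linear0.
exists f; split.
  apply: lin_inj => -[k p'] /hf /= []; rewrite !linear0 ?subr0 ?addr0 => h1 h2.
  by congr pair => //; apply: ii; move: h1; rewrite -h2 linear0 addr0 => <-; rewrite linear0.
move=> [k' p]; pose p' := i' k' + h p.
have [|k hk] := (hie (p - h' p')).1.
  rewrite linearB hh' linearD hh; have -> : e' (i' k') = 0 by apply/hie'; exists k'.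
  by rewrite add0r subrr.
exists (k, p'); apply/hf => /=; rewrite hk /p'; split; by zmod.
Qed.

Lemma free_cover M : exists (T : choiceType) (e : {linear DS T R^o -> M}), surjective_fun e.
Proof.
have [e he] := DS_lift (fun x : M => [the {linear R^o -> M} of scale_at x]).
by exists M, e => x; exists (@inj R M R^o x 1); rewrite he /= /scale_at scale1r.
Qed.

Lemma projective_cover M : exists K P (i : {linear K -> P}) (e : {linear P -> M}),
  ses i e /\ projective P.
Proof.
have [T [e se]] := free_cover M; have [K [i hi]] := ker_exists se.
by exists K, (DS T R^o), i, e; split=> //; apply/projective_DS/projective_ring.
Qed.

(** The two halves alternate. Closure under summands in dimension n gives, by Schanuel, that any
    syzygy is as good as the given one. This, applied to the product of two projective covers,
    reduces summands in dimension n + 1 to summands of a syzygy in dimension n. *)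
Lemma pd_summand_syzygy n :
  (forall M N, pd n (M * N)%type -> pd n M) /\
  (forall K P M (i : {linear K -> P}) (e : {linear P -> M}),
    ses i e -> projective P -> pd n.+1 M -> pd n K).
Proof.
have synth m : (forall M N, pd m (M * N)%type -> pd m M) ->
    (forall K P M (i : {linear K -> P}) (e : {linear P -> M}),
      ses i e -> projective P -> pd m.+1 M -> pd m K).
  move=> hm K P M i e hs hP [K' [P' [i' [e' [hs' hP' hK']]]]].
  apply: (hm _ P'); apply: (pd_iso (schanuel hs' hs hP' hP)).
  by apply: pd_prod => //; apply: projective_pd.
elim: n => [|n [IH1 IH2]].
  have h0 M N : projective (M * N)%type -> projective M.
    move=> h; apply: (@projective_retract _ _ [the {linear M -> _} of @in1 M N]
      [the {linear _ -> M} of @pr1 M N]) => //.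
  by split=> //; apply: (synth 0%N).
have h1 M N : pd n.+1 (M * N)%type -> pd n.+1 M.
  move=> hMN; have [K [P [i [e [hs hP]]]]] := projective_cover M.
  have [K' [P' [i' [e' [hs' hP']]]]] := projective_cover N.
  exists K, P, i, e; split=> //; apply: (IH1 _ K').
  apply: (IH2 _ (P * P')%type _ [the {linear _ -> _} of pair_map i i']
    [the {linear _ -> _} of pair_map e e']) => //; last exact: projective_prod.
  have [ii se hie] := hs; have [ii' se' hie'] := hs'; split.
  - by move=> [x y] [x' y'] [/ii -> /ii' ->].
  - move=> [x y]; have [p hp] := se x; have [p' hp'] := se' y; exists (p, p').
    by rewrite /= /pair_map /= hp hp'.
  - move=> [x y]; split=> [[/hie[k <-] /hie'[k' <-]] | [[k k'] [<- <-]]].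
      by exists (k, k').
    congr pair; [apply/hie; by exists k | apply/hie'; by exists k'].
by split=> //; apply: synth.
Qed.

Lemma pd_syzygy n K P M (i : {linear K -> P}) (e : {linear P -> M}) :
  ses i e -> projective P -> pd n.+1 M -> pd n K.
Proof. exact: (pd_summand_syzygy n).2. Qed.

Lemma pd_retract n M Q (i : {linear Q -> M}) (e : {linear M -> Q}) :
  pd n M -> (forall x, e (i x) = x) -> pd n Q.
Proof.
move=> hM ei; have [K [j [ji hj]]] := sub_exists (submod_preim e (submod_eq0 Q)).
apply: ((pd_summand_syzygy n).1 _ K); apply: pd_iso hM; apply: miso_sym.
have l : linear (fun x : (Q * K)%type => i x.1 + j x.2).
  by move=> a x y; rewrite /= !linearP; zmod.
have ej k : e (j k) = 0 by apply/hj; exists k.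
exists (lin_pack l); split.
  apply: lin_inj => -[x k] /= h.
  have x0 : x = 0.
    by move: (congr1 e h); rewrite linearD ei ej addr0 linear0.
  by move: h; rewrite x0 linear0 add0r => h; congr pair; apply: ji; rewrite h linear0.
move=> y; have [|k hk] := (hj (y - i (e y))).1; first by rewrite linearB ei subrr.
by exists (e y, k); rewrite /= hk; zmod.
Qed.

End ProjectiveDimension.

(** * Filtrations *)

(** The case [s = [::]] stands apart because the chain [A] may be empty. The lemma makes finite
    supports fit into one member of a chain. *)
Lemma chain_list (J : Type) (T : eqType) (le : J -> J -> Prop) (A : J -> Prop)
    (G : J -> T -> Prop) (s : seq T) :
  (forall a b, A a -> A b -> le a b \/ le b a) ->
  (forall a b t, le a b -> G a t -> G b t) ->
  (forall t, t \in s -> exists2 a, A a & G a t) ->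
  s = [::] \/ exists2 a, A a & forall t, t \in s -> G a t.
Proof.
move=> tot mono; elim: s => [|t s IH] h; first by left.
right; have [a Aa Ga] := h t (mem_head _ _).
have [|->|[b Ab Gb]] := IH; first by move=> t' ts; apply: h; rewrite inE ts orbT.
  by exists a => // t'; rewrite inE => /eqP ->.
have [ab|ba] := tot a b Aa Ab.
  by exists b => // t'; rewrite inE => /orP [/eqP ->|/Gb //]; apply: mono ab Ga.
by exists a => // t'; rewrite inE => /orP [/eqP -> //|/Gb h']; apply: mono ba h'.
Qed.

Section Filtrations.

Variable R : pzRingType.

(* Upper bounds of chains carry the union of the chain; for the empty chain
   this is a member equal to 0. *)
Definition cont_family (J : Type) (le : J -> J -> Prop) (I : Type) (X : I -> lmodType R)
    (F : J -> forall i, X i -> Prop) : Prop :=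
  [/\ forall j, le j j,
      forall j k l, le j k -> le k l -> le j l,
      forall j k, le j k -> forall i x, F j i x -> F k i x,
      forall j i, submod (F j i)
    & forall A : J -> Prop, (forall a b, A a -> A b -> le a b \/ le b a) ->
        exists b, (forall a, A a -> le a b) /\
          forall i x, F b i x -> x = 0 \/ exists2 a, A a & F a i x].

(** * Extending partial sections along a continuous family *)

Section Zorn.

Variables (J : Type) (le : J -> J -> Prop) (I : Type) (X E : I -> lmodType R).
Variables (F : J -> forall i, X i -> Prop) (pi : forall i, {linear E i -> X i}).
Variables (delta : I -> I) (dE : forall i, E i -> E (delta i)).
Arguments F : clear implicits.
Arguments pi : clear implicits.

(** A partial section of [pi] over the member [j], recorded by its image [L]: [pi] maps [L]
    bijectively onto [F j]. The pair [delta], [dE] is trivial for modules and the differential for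
    complexes, so one Zorn argument serves both. *)
Definition complement (j : J) (L : forall i, E i -> Prop) : Prop :=
  [/\ forall i, submod (L i),
      forall i e, L i e -> L (delta i) (dE e),
      forall i e, L i e -> pi i e = 0 -> e = 0
    & forall i x, F j i x <-> exists2 e, L i e & pi i e = x].

(** Zorn's lemma for pairs of a member and a partial section over it: along a chain the union of the
    sections lies over the union of the members. As [le] is only a preorder, strictness of a step
    has to be asked for by [~ le j' j]. *)
Lemma complement_exists : cont_family le F -> (forall i, dE (0 : E i) = 0) ->
  (forall j L, complement j L -> (exists i x, ~ F j i x) ->
    exists j' (L' : forall i, E i -> Prop),
      [/\ le j j', ~ le j' j, forall i e, L i e -> L' i e & complement j' L']) ->
  exists j L, complement j L /\ forall i x, F j i x.
Proof.
move=> [lerr letr lemono Fsub chain] dE0 step.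
pose T := {p : J * (forall i, E i -> Prop) | complement p.1 p.2}.
have tP (p : T) : complement (sval p).1 (sval p).2 by exact: (svalP p).
pose leT (p q : T) := le (sval p).1 (sval q).1 /\
  forall i e, (sval p).2 i e -> (sval q).2 i e.
(* The clause [e = 0] keeps the union a submodule when the chain is empty. *)
pose LA (A : set T) i e := e = 0 \/ exists2 p, A p & (sval p).2 i e.
have ub (A : set T) : (forall p q, A p -> A q -> leT p q \/ leT q p) ->
    exists t, forall s, A s -> leT s t.
  move=> tot; have [|b [hb hF]] := chain (fun j => exists2 p, A p & (sval p).1 = j).
    by move=> _ _ [p Ap <-] [q Aq <-]; have [[? _]|[? _]] := tot p q Ap Aq; [left|right].
  have hc : complement b (LA A).
    split.
    - move=> i; split=> [|a x y]; first by left.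
      have sw (p : T) : submod ((sval p).2 i) by have [] := tP p.
      move=> [-> | [p Ap hx]] [-> | [q Aq hy]].
      + by left; rewrite scaler0 addr0.
      + by right; exists q => //; rewrite scaler0 add0r.
      + by right; exists p => //; rewrite addr0; apply: submodZ.
      + have [[_ h]|[_ h]] := tot p q Ap Aq.
          by right; exists q => //; apply: (sw q).2 => //; apply: h.
        by right; exists p => //; apply: (sw p).2 => //; apply: h.
    - move=> i e [-> | [p Ap hp]]; first by left; rewrite dE0.
      by right; exists p => //; have [_ h _ _] := tP p; apply: h.
    - by move=> i e [-> // | [p _ hp]]; have [_ _ h _] := tP p; apply: h.
    - move=> i x; split=> [/hF [->|[_ [p Ap <-] hx]] | [e [->|[p Ap hp]] <-]].
      + by exists 0; [left | rewrite linear0].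
      + have [_ _ _ /(_ i x) h] := tP p; have [e he <-] := h.1 hx.
        by exists e => //; right; exists p.
      + by rewrite linear0; apply: submod0 (Fsub _ _).
      + apply: (@lemono (sval p).1); first by apply: hb; exists p.
        by have [_ _ _ h] := tP p; apply/h; exists e.
  exists (exist (fun p => complement p.1 p.2) (b, LA A) hc) => s As; split=> /=.
    by apply: hb; exists s.
  by move=> i e he; right; exists s.
(* The bound of the empty chain is the starting point that [ZL_preorder] asks for. *)
have [|t0 _] := ub set0; first by [].
have [| | |t ht] := @ZL_preorder T t0 (fun p q => `[< leT p q >]).
- by move=> t; apply/asboolP; split.
- move=> r s t /asboolP [h1 h2] /asboolP [h3 h4]; apply/asboolP; split.
    exact: letr h1 h3.
  by move=> i e /h2 /h4.
- move=> A tot; have [|t ht] := ub A.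
    by move=> p q Ap Aq; have := tot p q Ap Aq; case=> /asboolP; [left | right].
  by exists t => s /ht /asboolP.
exists (sval t).1, (sval t).2; split; first exact: tP.
apply: contrapT => nF.
have [|j' [L' [h1 h2 h3 h4]]] := step _ _ (tP t).
  apply: contrapT => h; apply: nF => i x; apply: contrapT => n; apply: h.
  by exists i, x.
pose s : T := exist (fun p => complement p.1 p.2) (j', L') h4.
have /asboolP [] : `[< leT s t >] by apply: ht; apply/asboolP; split.
by move=> /h2.
Qed.

End Zorn.

Definition mod_family (J : Type) (le : J -> J -> Prop) (M : lmodType R)
  (F : J -> M -> Prop) : Prop := cont_family le (I := unit) (X := fun _ => M) (fun j _ => F j).

Definition step_in (C : mod_class R) (J : Type) (le : J -> J -> Prop) (M : lmodType R)
    (F : J -> M -> Prop) : Prop :=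
  forall j, (exists x, ~ F j x) -> exists j' (Q : lmodType R) (r : M -> Q -> Prop),
    [/\ le j j', ~ le j' j, subquot (F j) (F j') r & C Q].

(** A free cover [e] of M is split by extending partial sections. Given [L] over [F j], the quotient
    of the preimage of [F j'] by [L] maps onto [Q]; [Q] being projective, this map has a section,
    and the new [L] is the preimage of the image of that section. *)
Lemma filtered_projective (J : Type) (le : J -> J -> Prop) (M : lmodType R)
    (F : J -> M -> Prop) :
  mod_family le F -> step_in (@projective R) le F -> projective M.
Proof.
move=> cF step; have [_ _ lemono Fsub _] := cF.
have [T [e se]] := free_cover M; set E := DS T R^o in e se.
have [//| |j [L [[Lsub _ L0 LF] Fall]]] := @complement_exists J le unit (fun _ => M) (fun _ => E)
  (fun j _ => F j) (fun _ => e) id (fun _ => id) cF.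
  move=> j L [Lsub _ L0 /(_ tt) LF] [_ [x0 nx0]].
  rewrite -/(forall x, F j x <-> exists2 y, L tt y & e y = x) in LF.
  have [|j' [Q [r [jj' nj'j hr hQ]]]] := step j; first by exists x0.
  have Fj' : submod (F j') := Fsub j' tt.
  have LB y : L tt y -> F j' (e y).
    by move=> Ly; apply: (lemono _ _ jj' tt); apply/LF; exists y.
  have [QE [rE hE]] := subquot_exists (Lsub tt) (submod_preim e Fj') LB.
  have [lr hdom sr h0 hf] := hr; have [lE hdomE sE hE0 hfE] := hE.
  have [|||g hg] := @lin_of_rel _ _ _ (fun u q => exists y, rE y u /\ r (e y) q).
  - apply: (linrel_comp (linrel_inv lE)).
    split=> [|a x y x' y' h h']; first by rewrite linear0; apply: linrel0.
    by rewrite linearP; apply: (lr.2).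
  - move=> u; have [y hy] := sE u.
    have /hdom [q hq] := subquot_dom hE hy.
    by exists q, y.
  - move=> q [y [/hE0 Ly rq]]; apply: (subquot_fun hr rq).
    by apply/h0/LF; exists y.
  have sg : surjective_fun g.
    move=> q; have [x hx] := sr q.
    have [y ey] := se x.
    have /hdomE [u hu] : F j' (e y) by rewrite ey; apply: subquot_dom hr hx.
    by exists u; apply/hg; exists y; rewrite ey.
  have [s hs] := hQ _ _ g [the {linear Q -> Q} of idfun] sg.
  have rs y q : rE y (s q) -> r (e y) q.
    move=> hy; have /hg [y' [hy' rq]] := hs q.
    apply: (subquot_shift hr rq); rewrite -linearB.
    by apply/LF; exists (y - y') => //; apply: (subquot_eq hE hy hy').
  exists j', (fun i y => exists q, rE y (s q)); split=> //.
    by move=> [] y Ly; exists 0; rewrite linear0; apply/hE0.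
  split=> //.
  - move=> _; split=> [|a x y [q hq] [q' hq']]; first by exists 0; rewrite linear0; apply: linrel0.
    by exists (a *: q + q'); rewrite linearP; apply: (lE.2).
  - move=> [] y [q hq] ey0; apply: (L0 tt) => //; apply/hE0.
    have q0 : q = 0 by apply: hf; rewrite -ey0; apply: rs.
    by move: hq; rewrite q0 linear0.
  - move=> [] x; split=> [Fx | [y [q hq] <-]]; last exact: (subquot_dom hE hq).
    have /hdom [q hq] := Fx; have [y hy] := sE (s q).
    have /LF [l Ll el] := subquot_eq hr hq (rs _ _ hy).
    exists (l + y); last by rewrite linearD el subrK.
    by exists q; apply: (subquot_shift hE hy); rewrite addrK.
have [|||s hs] := @lin_of_rel _ M E (fun x y => L tt y /\ e y = x).
- split=> [|a x y x' y' [h1 h2] [h3 h4]].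
    by split; [apply: submod0 | rewrite linear0].
  by split; [apply: (Lsub tt).2 | rewrite linearP h2 h4].
- by move=> x; have [y hy ey] := (LF tt x).1 (Fall tt x); exists y.
- by move=> y [Ly ey]; apply: (L0 tt).
apply: (@projective_retract _ _ _ s e); first exact/projective_DS/projective_ring.
by move=> x; have [] := (hs x (s x)).2 erefl.
Qed.

(** Truncation to the coordinates in [U'] outside [U] kills [supp U] and is the identity on
    [supp U'] modulo [supp U], so it exhibits [Q] as a retract of the whole direct sum. *)
Lemma subquot_supp_projective (T : choiceType) (V : lmodType R) (U U' : T -> Prop)
    (Q : lmodType R) (r : DS T V -> Q -> Prop) :
  projective V -> subquot (supp U) (supp U') r -> projective Q.
Proof.
move=> hV hr; have [lr hdom sr h0 hf] := hr.
have [f hfc] := trunc_exists V (fun t => U' t /\ ~ U t).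
have fU w : supp U w -> f w = 0.
  move=> hw; apply: coord_inj => t; rewrite hfc linear0.
  by case: asboolP => // -[_ nU]; apply: hw.
have fU' w : supp U' (f w).
  by move=> t nU'; rewrite hfc; case: asboolP => // -[].
have fd w : supp U' w -> supp U (f w - w).
  move=> hw t nU; rewrite linearB /= hfc; case: asboolP => [_|n]; first by rewrite subrr.
  by rewrite hw ?subr0 // => u'; apply: n.
have [|||i hi] := @lin_of_rel _ Q (DS T V) (fun q w => exists w', r w' q /\ f w' = w).
- exact: (linrel_comp (linrel_inv lr) (linrel_fun f)).
- by move=> q; have [w hw] := sr q; exists (f w), w.
- by move=> _ [w [/h0 /fU -> <-]].
have [|||e he] := @lin_of_rel _ (DS T V) Q (fun w q => exists w', f w = w' /\ r w' q).
- exact: (linrel_comp (linrel_fun f) lr).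
- by move=> w; have /hdom [q hq] := fU' w; exists q, (f w).
- by move=> q [w' [<-]]; rewrite linear0; apply: hf.
apply: (@projective_retract _ _ _ i e); first exact: projective_DS.
move=> q; apply/he; exists (f (i q)); split=> //.
have /hi [w [rw <-]] := erefl (i q).
have h w' : supp U' w' -> r w' q -> r (f w') q.
  by move=> h1 h2; apply: (subquot_shift hr h2); apply: fd.
by apply: (h _ _) => //; apply: (h _ _) => //; apply: subquot_dom hr rw.
Qed.

(** The 3x3 lemma for A inside B in the middle, with their preimages on the left and their images on
    the right. *)
Lemma ses_subquot (K E M : lmodType R) (i : {linear K -> E}) (e : {linear E -> M})
    (A B : E -> Prop) (A' B' : M -> Prop) (QK QE Q : lmodType R) (rK : K -> QK -> Prop)
    (rE : E -> QE -> Prop) (r : M -> Q -> Prop) :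
  ses i e -> submod A -> submod B -> (forall x, A x -> B x) ->
  (forall x, A' x <-> exists2 w, A w & e w = x) ->
  (forall x, B' x <-> exists2 w, B w & e w = x) ->
  subquot (fun k => A (i k)) (fun k => B (i k)) rK -> subquot A B rE -> subquot A' B' r ->
  exists (iq : {linear QK -> QE}) (eq : {linear QE -> Q}), ses iq eq.
Proof.
move=> [ii se hie] sA sB AB hA' hB' hrK hrE hr.
have [lr hdom sr h0 hf] := hr; have [lrK hdomK srK h0K hfK] := hrK.
have [lrE hdomE srE h0E hfE] := hrE.
have [|||iq hiq] := @lin_of_rel _ QK QE (fun q u => exists k, rK k q /\ rE (i k) u).
- apply: (linrel_comp (linrel_inv lrK)).
  split=> [|a x y x' y' h h']; first by rewrite linear0; apply: linrel0.
  by rewrite linearP; apply: (lrE.2).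
- move=> q; have [k hk] := srK q; have /hdomE [u hu] := subquot_dom hrK hk.
  by exists u, k.
- by move=> u [k [/h0K /h0E h1 h2]]; apply: (subquot_fun hrE h2).
have [|||eq heq] := @lin_of_rel _ QE Q (fun u q => exists w, rE w u /\ r (e w) q).
- apply: (linrel_comp (linrel_inv lrE)).
  split=> [|a x y x' y' h h']; first by rewrite linear0; apply: linrel0.
  by rewrite linearP; apply: (lr.2).
- move=> u; have [w hw] := srE u.
  have /hdom [q hq] : B' (e w) by apply/hB'; exists w => //; apply: subquot_dom hrE hw.
  by exists q, w.
- move=> q [w [/h0E Aw h2]]; apply: (subquot_fun hr h2); apply/h0/hA'; by exists w.
exists iq, eq; split.
- apply: lin_inj => q /hiq [k [hk /h0E ik0]].
  by apply: (subquot_fun hrK hk); apply/h0K.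
- move=> q; have [x hx] := sr q; have /hB' [w hw ew] := subquot_dom hr hx.
  by have /hdomE [u hu] := hw; exists u; apply/heq; exists w; rewrite ew.
- move=> u; split=> [/heq [w [hw /h0 /hA' [w' hw' ew']]] | [q /hiq [k [hk hu]]]]; last first.
    apply/heq; exists (i k); split=> //.
    have -> : e (i k) = 0 by apply/hie; exists k.
    exact: linrel0.
  have [k hk] : exists k, i k = w - w' by apply/hie; rewrite linearB ew' subrr.
  have Bk : B (i k).
    by rewrite hk; apply: (submodB sB); [apply: subquot_dom hrE hw | apply: AB].
  have /hdomK [q hq] := Bk; exists q; apply/hiq; exists k; split=> //.
  apply: (subquot_shift hrE hw); rewrite hk.
  have -> : w - w' - w = - w' by zmod.
  exact: submodN.
Qed.

Lemma filtered_pd n (J : Type) (le : J -> J -> Prop) (M : lmodType R) (F : J -> M -> Prop) :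
  mod_family le F -> step_in (@pd R n) le F -> pd n M.
Proof.
elim: n M F => [|n IH] M F; first exact: filtered_projective.
(* The family [F] induces one on the kernel of the presentation of [M] by the
   free module on its nonzero elements, with syzygies of the old quotients as
   quotients.  The element 0 is left out so that [F j = 0] has syzygy 0. *)
move=> [lerr letr lemono Fsub chain] step.
pose T : choiceType := {x : M | x != 0}.
have [e he] := DS_lift (fun x : T => [the {linear R^o -> M} of scale_at (val x)]).
set E := DS T R^o in e he.
have he1 (x : T) : e (@inj R T R^o x 1) = val x by rewrite he /= /scale_at scale1r.
have se : surjective_fun e.
  move=> x; have [->|x0] := eqVneq x 0; first by exists 0; rewrite linear0.
  by exists (@inj R T R^o (Sub x x0 : T) 1); rewrite he1.
pose U j (t : T) := F j (val t).
have eU j w : supp (U j) w -> F j (e w).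
  move=> hw; apply: (supp_in (submod_preim e (Fsub j tt)) hw) => t v ht.
  by rewrite he /= /scale_at; apply: (submodZ _ (Fsub j tt)).
have eS j x : F j x -> exists2 w, supp (U j) w & e w = x.
  have [->|x0] := eqVneq x 0; first by exists 0; [apply: (submod0 (@supp_submod R T R^o (U j))) | rewrite linear0].
  move=> Fx; exists (@inj R T R^o (Sub x x0 : T) 1); rewrite ?he1 //.
  exact: supp_inj.
have eF j x : F j x <-> exists2 w, supp (U j) w & e w = x.
  by split=> [/eS // | [w /eU h <-]].
have [K [i hs]] := ker_exists se; have [ii _ hie] := hs.
exists K, E, i, e; split=> //; first exact/projective_DS/projective_ring.
pose G j (k : K) := supp (U j) (i k).
have Gsub j : submod (G j) by apply/submod_preim/supp_submod.
have Umono j k : le j k -> forall t, U j t -> U k t.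
  by move=> jk t; apply: (lemono _ _ jk tt).
apply: (IH K G).
  split=> //.
    by move=> j k /Umono jk _ x; apply: supp_sub.
  move=> A tot; have [b [hb hF]] := chain A tot; exists b; split=> //= _ k Gk.
  have [s us hsup] := coord_support (i k).
  have [| |s0|[a Aa ha]] := @chain_list J T le A U s tot.
  - by move=> a b' t /Umono h; apply: h.
  - move=> t /hsup kt; have Ubt : U b t.
      by apply: contrapT => /Gk /eqP e0; rewrite e0 in kt.
    have [t0|//] := hF tt (val t) Ubt.
    by move: (valP t); rewrite t0 eqxx.
  - left; apply: ii; rewrite linear0; apply: coord_inj => t; rewrite linear0.
    by apply/eqP/negPn/negP => /hsup; rewrite s0.
  - right; exists a => // t nU; apply/eqP/negPn/negP => /hsup /ha; exact: nU.
move=> j [k0 nk0]; have [|j' [Q [r [jj' nj'j hr hQ]]]] := step j.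
  apply: contrapT => h; apply: nk0 => t nU; exfalso; apply: h.
  by exists (val t) => h'; apply: nU.
have GG k : G j k -> G j' k by apply: supp_sub; apply: Umono.
have [Q2 [r2 hr2]] := subquot_exists (Gsub j) (Gsub j') GG.
exists j', Q2, r2; split=> //.
have [QF [rF hrF]] := subquot_exists (supp_submod R^o (U j)) (supp_submod R^o (U j'))
  (fun w => supp_sub (Umono _ _ jj')).
have pF : projective QF by apply: subquot_supp_projective hrF; apply: projective_ring.
have [iq [eq hq]] := ses_subquot hs (supp_submod _ (U j)) (supp_submod _ (U j'))
  (fun w => supp_sub (Umono _ _ jj')) (eF j) (eF j') hr2 hrF hr.
exact: pd_syzygy hq pF hQ.
Qed.

End Filtrations.

(** * Complexes and Eklof's lemma *)

Section Complexes.

Variable R : pzRingType.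
Implicit Types X Y Z Q : chain_complex R.

Definition subcx X (A : forall m, X m -> Prop) : Prop :=
  (forall m, submod (A m)) /\ forall m x, A m x -> A (m - 1) (chain_d X m x).

Definition subquot_cx X (A B : forall m, X m -> Prop) Q (r : forall m, X m -> Q m -> Prop) : Prop :=
  (forall m, subquot (A m) (B m) (r m)) /\
  forall m x q, r m x q -> r (m - 1) (chain_d X m x) (chain_d Q m q).

Lemma chain_of_rel X Y (r : forall m, X m -> Y m -> Prop) :
    (forall m, linrel (r m)) -> (forall m x, exists y, r m x y) ->
    (forall m y, r m 0 y -> y = 0) ->
    (forall m x y, r m x y -> r (m - 1) (chain_d X m x) (chain_d Y m y)) ->
  exists f : chain_map X Y, forall m x y, r m x y <-> f m x = y.
Proof.
move=> lr tot f0 dr.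
pose F m := lin_of_rel (lr m) (tot m) (f0 m).
pose f m := sval (F m); have hf m x y : r m x y <-> f m x = y := svalP (F m) x y.
have fd m x : f (m - 1) (chain_d X m x) = chain_d Y m (f m x).
  by apply/hf/dr/hf.
by exists (ChainMap fd).
Qed.

Lemma subquot_cx_exists X (A B : forall m, X m -> Prop) :
  subcx A -> subcx B -> (forall m x, A m x -> B m x) ->
  exists Q (r : forall m, X m -> Q m -> Prop), subquot_cx A B r.
Proof.
move=> [hA dA] [hB dB] hAB.
pose S m := subquot_exists (hA m) (hB m) (hAB m).
pose Q m : lmodType R := projT1 (S m).
pose r m : X m -> Q m -> Prop := sval (projT2 (S m)).
have hr m : subquot (A m) (B m) (@r m) := svalP (projT2 (S m)).
have D m : {f : {linear Q m -> Q (m - 1)} |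
    forall q q', (exists x, r m x q /\ r (m - 1) (chain_d X m x) q') <-> f q = q'}.
  have [lr hdom sr h0 hf] := hr m; have [lr' hdom' sr' h0' hf'] := hr (m - 1).
  apply: lin_of_rel.
  - apply: (linrel_comp (linrel_inv lr)); split=> [|a x y x' y' h h'].
      by rewrite linear0; apply: linrel0.
    by rewrite linearP; apply: (lr'.2).
  - move=> q; have [x hx] := sr q.
    have /hdom' [q' hq'] : B (m - 1) (chain_d X m x) by apply/dB/hdom; exists q.
    by exists q', x.
  - by move=> q' [x [/h0 /dA /h0' h1 h2]]; apply: (subquot_fun (hr (m - 1)) h2).
pose d m := sval (D m).
have hd m x q : r m x q -> r (m - 1) (chain_d X m x) (d m q).
  move=> hx; have /(svalP (D m)) [x' [hx' h]] := erefl (d m q).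
  apply: (subquot_shift (hr (m - 1)) h); rewrite -linearB; apply/dA.
  exact: subquot_eq (hr m) hx hx'.
have dd m (q : Q m) : d (m - 1) (d m q) = 0.
  have [lr hdom sr h0 hf] := hr m; have [x /hd /hd h] := sr q.
  have [_ _ _ _ hf'] := hr (m - 1 - 1).
  by apply: hf'; rewrite chain_dd in h.
exists (ChainComplex dd), r; split=> //.
Qed.

(** Such an [L] is the image of a section that commutes with d. The component of [e] in Y is the y
    for which [e - ext_in E m y] lies in [L]. *)
Lemma split_of_complement X Y (E : extension X Y) (L : forall m, ext_mid E m -> Prop) :
  subcx L -> (forall m e, L m e -> ext_out E m e = 0 -> e = 0) ->
  (forall m x, exists2 e, L m e & ext_out E m e = x) -> ext_equiv E (split_extension X Y).
Proof.
move=> [Lsub dL] L0 Ls; have ex := ext_exact E.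
have [||||f hf] := @chain_of_rel (ext_mid E) (dsum Y X)
  (fun m e p => L m (e - ext_in E m p.1) /\ p.2 = ext_out E m e).
- move=> m; split=> [|a x y x' y' [h1 h2] [h3 h4]].
    by rewrite /= !linear0 ?addr0; split=> //; apply: submod0.
  split; last by rewrite !linearP /= h2 h4.
  have -> : a *: x + x' - ext_in E m (a *: y + y').1 =
     a *: (x - ext_in E m y.1) + (x' - ext_in E m y'.1).
    by rewrite /= linearP; zmod.
  exact: (Lsub m).2.
- move=> m e; have [l Ll el] := Ls m (ext_out E m e).
  have [ii se hie] := ex m; have [|y hy] := (hie (e - l)).1; first by rewrite linearB el subrr.
  by exists (y, ext_out E m e); rewrite /= hy; split=> //; rewrite opprB addrC subrK.
- move=> m [y x] /=; rewrite sub0r linear0 => -[Ly ->].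
  have [ii se hie] := ex m; congr pair.
  have /(submodN (Lsub m)) := Ly; rewrite opprK => {}Ly.
  by apply: ii; rewrite linear0; apply: L0 Ly _; apply/hie; exists y.
- move=> m e [y x] /= [Le ->]; split; last by rewrite /= chain_funP.
  by move: (dL _ _ Le); rewrite linearB chain_funP.
exists f; split=> [m y | m e].
  apply/hf; split=> /=; first by rewrite subrr; apply: submod0.
  by have [_ _ hie] := ex m; apply/esym/hie; exists y.
by have [_ h] := (hf m e (f m e)).2 erefl; rewrite /= /dsum_prrfun h.
Qed.

(** Given a section [L] over [F j], restrict the extension to [F j'] and divide by [L]: the result
    is an extension of [Q] by Y, which splits. The preimage of the kernel of the retraction onto Y
    is a section over [F j'] that contains [L]. *)
Lemma eklof X Y (J : Type) (le : J -> J -> Prop) (F : J -> forall m, X m -> Prop) :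
  cont_family le F -> (forall j, subcx (F j)) ->
  (forall j, (exists m x, ~ F j m x) -> exists j' Q (r : forall m, X m -> Q m -> Prop),
    [/\ le j j', ~ le j' j, subquot_cx (F j) (F j') r & Ext1_eq0 Q Y]) ->
  Ext1_eq0 X Y.
Proof.
move=> cF Fcx step E; have [_ _ lemono _ _] := cF.
set W := ext_mid E; set out := ext_out E; set inn := ext_in E.
have ex : short_exact inn out := ext_exact E.
have [m||j [L [[Lsub dL L0 LF] Fall]]] := @complement_exists R J le int X W F
  (fun m => out m) (fun m => m - 1) (fun m => chain_d W m) cF; first by rewrite linear0.
  move=> j L [Lsub dL L0 LF] nF.
  have [j' [Q [r [jj' nj'j [hr dr] hQ]]]] := step j nF.
  have [Fs' dF'] := Fcx j'.
  have LB m e : L m e -> F j' m (out m e).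
    by move=> Le; apply: (lemono _ _ jj'); apply/LF; exists e.
  have [|QE [rE [hE dE]]] := subquot_cx_exists (conj Lsub dL) _ LB.
    split=> m; first exact: submod_preim.
    by move=> e; rewrite chain_funP; apply: dF'.
  have [||||i hi] := @chain_of_rel Y QE (fun m y u => rE m (inn m y) u).
  - move=> m; have [lE _ _ _ _] := hE m; split=> [|a x y x' y' h h'].
      by rewrite linear0; apply: linrel0.
    by rewrite linearP; apply: (lE.2).
  - move=> m y; have [_ h _ _ _] := hE m; apply/h.
    have -> : out m (inn m y) = 0 by have [_ _ hio] := ex m; apply/hio; exists y.
    exact: submod0.
  - by move=> m u; rewrite linear0; have [_ _ _ _] := hE m; apply.
  - by move=> m y u /dE; rewrite -chain_funP.
  have [||||o ho] := @chain_of_rel QE Q (fun m u q => exists e, rE m e u /\ r m (out m e) q).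
  - move=> m; have [lE _ _ _ _] := hE m; have [lr _ _ _ _] := hr m.
    apply: (linrel_comp (linrel_inv lE)); split=> [|a x y x' y' h h'].
      by rewrite linear0; apply: linrel0.
    by rewrite linearP; apply: (lr.2).
  - move=> m u; have [_ _ sE _ _] := hE m; have [e he] := sE u.
    have [_ hdom _ _ _] := hr m.
    by have /hdom [q hq] := subquot_dom (hE m) he; exists q, e.
  - move=> m q [e [h h']]; have [_ _ _ hE0 _] := hE m; have [_ _ _ h0 _] := hr m.
    apply: (subquot_fun (hr m) h'); apply/h0/LF; exists e => //; exact/hE0.
  - by move=> m u q [e [/dE h /dr h']]; exists (chain_d W m e); rewrite chain_funP.
  have exE : short_exact i o.
    move=> m; have [ii so hio] := ex m; have [lE hdomE sE hE0 hfE] := hE m.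
    have [lr hdom sr h0 hf] := hr m; split.
    - apply: lin_inj => y /hi /hE0 Ly; apply: ii; rewrite linear0.
      by apply: L0 Ly _; apply/hio; exists y.
    - move=> q; have [x hx] := sr q; have [e ex'] := so x.
      have /hdomE [u hu] : F j' m (out m e) by rewrite ex'; apply: (subquot_dom (hr m) hx).
      by exists u; apply/ho; exists e; rewrite ex'.
    - move=> u; split=> [/ho [e [he /h0 /LF [l Ll el]]] | [y /hi hy]].
        have [|y hy] := (hio (e - l)).1; first by rewrite linearB el subrr.
        exists y; apply/hi; rewrite hy; apply: (subquot_shift (hE m) he).
        have -> : e - l - e = - l by zmod.
        exact: submodN.
      apply/ho; exists (inn m y); split=> //.
      have -> : out m (inn m y) = 0 by apply/hio; exists y.
      exact: linrel0.
  have [phi [phi1 phi2]] := hQ (Extension exE); rewrite /= in phi phi1 phi2.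
  have phiP m u : phi m u = ((phi m u).1, o m u).
    by rewrite -(phi2 m u) /= /dsum_prrfun; case: (phi m u).
  exists j', (fun m e => exists2 u, rE m e u & (phi m u).1 = 0); split=> //.
    move=> m e Le; exists 0; last by rewrite linear0.
    by have [_ _ _ h _] := hE m; apply/h.
  split.
  - move=> m; have [lE _ _ _ _] := hE m; split=> [|a x y [u hu hu0] [v hv hv0]].
      by exists 0; [exact: linrel0 | rewrite linear0].
    exists (a *: u + v); first exact: (lE.2).
    by rewrite linearP /= hu0 hv0 scaler0 addr0.
  - move=> m e [u hu hu0]; exists (chain_d QE m u); first exact: dE.
    by rewrite chain_funP /= hu0 linear0.
  - move=> m e [u hu hu0] oe; have [_ _ hio] := ex m.
    have /hio [y hy] := oe; rewrite -hy in hu; move/hi: hu => hu.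
    by move: hu0; rewrite -hu phi1 /= => y0; rewrite -hy y0 linear0.
  - move=> m x; have [_ so hio] := ex m; split=> [Fx | [e [u hu _] <-]]; last first.
      exact: (subquot_dom (hE m) hu).
    have [e he] := so x; have [lE hdomE _ _ _] := hE m.
    have /hdomE [u hu] : F j' m (out m e) by rewrite he.
    exists (e - inn m (phi m u).1); last first.
      rewrite linearB he; have -> : out m (inn m (phi m u).1) = 0.
        by apply/hio; exists (phi m u).1.
      by rewrite subr0.
    exists (u - i m (phi m u).1); first by apply: linrelB => //; apply/hi.
    by rewrite linearB phi1 /= subrr.
apply: (@split_of_complement _ _ E L) => // m x.
by apply/LF; apply: Fall.
Qed.

End Complexes.

(** * Disk complexes *)

Section Disks.

Variable R : pzRingType.
Implicit Types X Y Z : chain_complex R.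

(** In degree m the first coordinate is the coefficient of the boundary of the generator of degree m
    + 1, the second that of the generator of degree m. All degrees thus share one module and one
    differential. *)
Definition disk_mod : lmodType R := (R^o * R^o)%type.
Definition disk_shift (x : disk_mod) : disk_mod := (x.2, 0).
Fact disk_shift_linear : linear disk_shift.
Proof. by move=> a x y; congr pair; rewrite /= scaler0 addr0. Qed.
HB.instance Definition _ :=
  GRing.isLinear.Build R disk_mod disk_mod *:%R disk_shift disk_shift_linear.

Lemma projective_disk_mod : projective disk_mod.
Proof. by apply: projective_prod; apply: projective_ring. Qed.

Lemma DS_map_exists (T : choiceType) (V W : lmodType R) (h : {linear V -> W}) :
  {f : {linear DS T V -> DS T W} | forall t w, coord t (f w) = h (coord t w)}.
Proof.
apply: cid; have [f hf] := DS_lift (fun t : T => [the {linear V -> DS T W} of @inj R T W t \o h]).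
exists f => t; apply: (DS_eq (f := [the {linear DS T V -> W} of coord t \o f])
  (g := [the {linear DS T V -> W} of h \o coord t])) => t' v.
by rewrite /= hf /= !coordE; case: (t == t'); rewrite ?linear0.
Qed.

Definition DS_map (T : choiceType) (V W : lmodType R) (h : {linear V -> W}) :
  {linear DS T V -> DS T W} := sval (DS_map_exists T h).

Lemma coord_map (T : choiceType) (V W : lmodType R) (h : {linear V -> W}) (t : T) w :
  coord t (DS_map T h w) = h (coord t w).
Proof. exact: (svalP (DS_map_exists T h)). Qed.

Lemma DS_map_inj (T : choiceType) (V W : lmodType R) (h : {linear V -> W}) (t : T) v :
  DS_map T h (inj t v) = inj t (h v).
Proof.
by apply: coord_inj => t'; rewrite coord_map !coordE; case: eqP; rewrite ?linear0.
Qed.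

Definition disk_obj (T : choiceType) : lmodType R := DS T disk_mod.
Definition disk_d (T : choiceType) : {linear disk_obj T -> disk_obj T} :=
  DS_map T [the {linear disk_mod -> disk_mod} of disk_shift].

Lemma disk_dd (T : choiceType) x : disk_d T (disk_d T x) = 0.
Proof. by apply: coord_inj => t; rewrite /disk_d !coord_map linear0. Qed.

(* The sum over m of the disks on degrees m and m - 1 with base R^(T). *)
Definition disk (T : choiceType) : chain_complex R :=
  @ChainComplex R (fun _ => disk_obj T) (fun _ => disk_d T) (fun _ => @disk_dd T).

Definition gen (T : choiceType) (t : T) : disk_obj T := inj t ((0, 1) : disk_mod).

Lemma projective_disk (T : choiceType) m : projective (disk T m).
Proof. exact: projective_DS projective_disk_mod. Qed.

Lemma disk_decomp (T : choiceType) (t : T) (v : disk_mod) :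
  inj t v = (v.1 : R) *: disk_d T (gen t) + (v.2 : R) *: gen t.
Proof.
rewrite /disk_d /gen DS_map_inj -!linearZ -linearD; congr (inj t _); case: v => a b.
by congr pair; rewrite /= /GRing.scale /= ?mulr1 ?mulr0 ?addr0 ?add0r.
Qed.

Lemma disk_map_eq (T : choiceType) X (f g : chain_map (disk T) X) :
  (forall m t, f m (gen t) = g m (gen t)) -> forall m w, f m w = g m w.
Proof.
move=> h m; apply: DS_eq => t v; rewrite disk_decomp !linearP /= !linearZ h; congr (_ + _).
suff -> : f m (disk_d T (gen t)) = g m (disk_d T (gen t)) by [].
(* Boundaries in degree k - 1 come from generators of degree k, where [chain_funP] applies; every m
   has this form up to transport. *)
pose P m := f m (disk_d T (gen t)) = g m (disk_d T (gen t)).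
have hP k : P (k - 1).
  by rewrite /P; have := chain_funP f (gen t : disk T k); have := chain_funP g (gen t : disk T k);
    rewrite /= h => -> ->.
by rewrite -/(P m) -[m](addrK 1).
Qed.

(* The differential into degree [m], with [m + 1 - 1] transported to [m]. *)
Definition d_above X (m : int) (x : X (m + 1)) : X m :=
  eq_rect (m + 1 - 1) (fun k => X k : Type) (chain_d X (m + 1) x) m (addrK 1 m).

Lemma d_d_above X m (x : X (m + 1)) : chain_d X m (d_above x) = 0.
Proof.
rewrite /d_above; move: (addrK 1 m) x; move: (m + 1) => k e; case: m / e => x /=.
exact: chain_dd.
Qed.

(** A family over all degrees lets the degrees m - 1 + 1 and m be identified by elimination of the
    equality, without transporting the element itself. *)
Lemma d_aboveE X (x : forall m, X m) m : d_above (x (m - 1 + 1)) = chain_d X m (x m).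
Proof.
rewrite /d_above; move: (addrK 1 (m - 1)) (subrK 1 m).
move: (m - 1 + 1) => k e h; case: m / h e => e.
by rewrite (eq_irrelevance e erefl).
Qed.

(** Universal property of the sum of disks: generators may go anywhere, since the boundary of a
    generator then goes to the boundary [y] of its value, and boundaries are cycles. *)
Lemma disk_map (T : choiceType) X (x : forall m, T -> X m) :
  exists f : chain_map (disk T) X, forall m t, f m (gen t) = x m t.
Proof.
pose y m t : X m := d_above (x (m + 1) t).
have dy m t : chain_d X m (y m t) = 0 by apply: d_d_above.
have yd m t : y (m - 1) t = chain_d X m (x m t) by apply: (d_aboveE (fun k => x k t)).
have hl m (t : T) : linear (fun v : disk_mod => scale_at (y m t) v.1 + scale_at (x m t) v.2).
  by move=> a v v'; rewrite /= !linearP; zmod.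
have F m : {f : {linear disk_obj T -> X m} |
    forall t v, f (inj t v) = (v.1 : R) *: y m t + (v.2 : R) *: x m t}.
  apply: cid; have [f hf] := DS_lift (fun t => lin_pack (hl m t)).
  by exists f => t v; rewrite hf.
pose f m := sval (F m); have hf m t v := svalP (F m) t v; rewrite -/(f _) in hf.
have fd m (w : disk T m) : f (m - 1) (chain_d (disk T) m w) = chain_d X m (f m w).
  apply: (DS_eq (f := [the {linear _ -> _} of f (m - 1) \o disk_d T])
    (g := [the {linear _ -> _} of chain_d X m \o f m])) => t v.
  rewrite /= /disk_d DS_map_inj !hf /= linearD !linearZ /= dy yd scaler0 add0r scale0r.
  by rewrite addr0.
exists (ChainMap fd) => m t.
by rewrite /= /gen hf /= scale0r scale1r add0r.
Qed.

Lemma disk_lift (T : choiceType) X Y (o : chain_map Y X) (f : chain_map (disk T) X) :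
  (forall m, surjective_fun (o m)) ->
  exists u : chain_map (disk T) Y, forall m w, o m (u m w) = f m w.
Proof.
move=> so; pose e m (t : T) := sval (cid (so m (f m (gen t)))).
have he m t : o m (e m t) = f m (gen t) by rewrite /e; case: cid.
have [u hu] := disk_map e; exists u.
have cP m (w : disk T m) :
    o (m - 1) (u (m - 1) (chain_d (disk T) m w)) = chain_d X m (o m (u m w)).
  by rewrite !chain_funP.
apply: (@disk_map_eq _ _ (@ChainMap R (disk T) X
  (fun m => [the {linear _ -> _} of o m \o u m]) cP) f) => m t /=.
by rewrite hu he.
Qed.

Lemma disk_map_surj (T : choiceType) X (x : forall m, T -> X m) :
  (forall m (A : X m -> Prop), submod A -> (forall t, A (x m t)) -> forall z, A z) ->
  exists f : chain_map (disk T) X, forall m, surjective_fun (f m).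
Proof.
move=> h; have [f hf] := disk_map x; exists f => m.
apply: (h m (fun z => exists w, f m w = z)) => [|t]; last by exists (gen t).
split=> [|a _ _ [w <-] [w' <-]]; first by exists 0; rewrite linear0.
by exists (a *: w + w'); rewrite linearP.
Qed.

Lemma disk_cover X : exists (T : choiceType) (f : chain_map (disk T) X),
  forall m, surjective_fun (f m).
Proof.
pose T : choiceType := {classic (forall m, X m)}.
have [|f hf] := @disk_map_surj T X (fun m t => t m); last by exists T, f.
move=> m A hA h z.
(* Labels are families over all degrees; the one concentrated in degree m with value [z] makes the
   cover hit [z]. *)
pose t m' : X m' := if m =P m' is ReflectT e then eq_rect m (fun k => X k : Type) z m' e else 0.
have := h t; rewrite /t; case: eqP => // e.
by rewrite (eq_irrelevance e erefl).
Qed.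

Lemma disk_cover_countable X : (forall m, countably_generated (X m)) ->
  exists f : chain_map (disk nat) X, forall m, surjective_fun (f m).
Proof.
move=> cg; pose g m := sval (cid (cg m)).
have hg m : forall x, exists (k : nat) (a : 'I_k -> R), x = \sum_(i < k) a i *: g m i.
  by rewrite /g; case: cid.
apply: (@disk_map_surj nat X g) => m A hA h z.
have [k [a ->]] := hg m z; apply: submod_sum => // i _; exact: submodZ.
Qed.

End Disks.

(** * The small object argument *)

Section Attaching.

Variables (R : pzRingType) (n : nat) (Z : chain_complex R) (T : choiceType).
Notation P := (disk R nat).
Notation PP := (disk_obj R nat).
Notation dP := (disk_d R nat).

Definition attach_cx : chain_complex R :=
  @ChainComplex R (fun _ => DS T PP) (fun _ => DS_map T dP)
    (fun _ w => coord_inj (fun t => etrans (coord_map _ t _)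
      (etrans (congr1 _ (coord_map _ t w)) (etrans (disk_dd _) (esym (linear0 _)))))).

Definition attach_all : chain_complex R := dsum Z attach_cx.
Notation G := attach_all.

Definition cell (m : int) (t : T) (p : PP) : G m := (0, inj t p).
Fact cell_linear m t : linear (@cell m t).
Proof. by move=> a x y; rewrite /cell linearP; congr pair; rewrite /= scaler0 addr0. Qed.
HB.instance Definition _ m t :=
  GRing.isLinear.Build R PP (G m) *:%R (@cell m t) (@cell_linear m t).

Definition cell_coord (m : int) (t : T) (g : G m) : PP := coord t g.2.
Fact cell_coord_linear m t : linear (@cell_coord m t).
Proof. by move=> a x y; rewrite /cell_coord linearP. Qed.
HB.instance Definition _ m t :=
  GRing.isLinear.Build R (G m) PP *:%R (@cell_coord m t) (@cell_coord_linear m t).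

Lemma chain_d_cell m t p : chain_d G m (cell m t p) = cell (m - 1) t (dP p).
Proof. by rewrite /= /dsum_dfun /= linear0 DS_map_inj. Qed.

Definition within (D : T -> Prop) m (g : G m) : Prop := supp D g.2.

Lemma within_submod D m : submod (@within D m).
Proof.
have [h0 h] := supp_submod PP D.
by split=> [|a x y hx hy]; [exact: h0 | apply: h].
Qed.

Lemma within_cx D : subcx (@within D).
Proof.
split=> [m|m g hg t nD]; first exact: within_submod.
by rewrite /= /dsum_dfun coord_map hg // linear0.
Qed.

Lemma within_sub (D D' : T -> Prop) m (g : G m) :
  (forall t, D t -> D' t) -> within D g -> within D' g.
Proof. exact: supp_sub. Qed.

Lemma within_cell (D : T -> Prop) m t p : D t -> within D (cell m t p).
Proof. exact: supp_inj. Qed.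

Variables (ch : T -> T -> Prop) (K : T -> forall m : int, PP -> Prop).
Variable (f : T -> forall m, PP -> G m).

(** The span of the relators of the cells in [D], each identifying an element of [K t] inside the
    cell [t] with its attaching value. The inductive form gives induction on the number of
    relators. *)
Inductive glue (D : T -> Prop) m : G m -> Prop :=
| glue0 : glue D 0
| glueS a t k g : D t -> K t m k -> glue D g ->
    glue D (a *: (cell m t k - f t m k) + g).

Definition ch_closed (D : T -> Prop) : Prop := forall t, D t -> forall s, ch s t -> D s.

(* The attaching map [f t] need not be additive or commute with [d] on the
   nose, only modulo the cells attached before [t]. *)
Definition attachable (t : T) : Prop :=
  [/\ @subcx R P (K t),
      forall m, exists (Q : lmodType R) (r : PP -> Q -> Prop),
        subquot (K t m) (fun _ => True) r /\ pd n Q,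
      forall m k, within (fun s => ch s t) (f t m k)
    & forall D, ch_closed D -> (forall s, ch s t -> D s) -> forall m,
        (forall a k k', K t m k -> K t m k' ->
          glue D (f t m (a *: k + k') - (a *: f t m k + f t m k'))) /\
        forall k, K t m k -> glue D (f t (m - 1) (dP k) - chain_d G m (f t m k))].

Lemma glue_submod D m : submod (@glue D m).
Proof.
split=> [|a x y hx hy]; first exact: glue0.
elim: hx => [|b t k g Dt Kk _ IH]; first by rewrite scaler0 add0r.
have -> : a *: (b *: (cell m t k - f t m k) + g) + y =
  (a * b) *: (cell m t k - f t m k) + (a *: g + y) by rewrite scalerDr scalerA addrA.
exact: glueS.
Qed.

Lemma glue_sub (D D' : T -> Prop) m (g : G m) :
  (forall t, D t -> D' t) -> glue D g -> glue D' g.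
Proof.
by move=> h; elim=> [|a t k g' Dt Kk _ IH]; [exact: glue0 | apply: glueS => //; apply: h].
Qed.

Lemma glue_gen (D : T -> Prop) m t k : D t -> K t m k -> glue D (cell m t k - f t m k).
Proof.
by move=> Dt Kk; rewrite -[_ - _]addr0 -[_ - _]scale1r; apply: glueS => //; exact: glue0.
Qed.

Variable V : T -> Prop.
Hypothesis ch_wf : well_founded ch.
Hypothesis V_closed : ch_closed V.
Hypothesis V_att : forall t, V t -> attachable t.

Lemma glue_within D m (g : G m) : ch_closed D -> (forall t, D t -> V t) ->
  glue D g -> within D g.
Proof.
move=> cD DV; elim=> [|a t k g' Dt Kk _ IH]; first exact: submod0 (within_submod _ _).
apply: (within_submod _ _).2 => //; apply: submodB (within_submod _ _) _ _.
  exact: within_cell.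
by have [_ _ h _] := V_att (DV _ Dt); apply: within_sub (h _ _); apply: cD.
Qed.

Lemma glue_cx D : ch_closed D -> (forall t, D t -> V t) -> subcx (@glue D).
Proof.
move=> cD DV; split=> [m | m g]; first exact: glue_submod.
elim=> [|a t k g' Dt Kk _ IH]; first by rewrite linear0; exact: glue0.
have [[_ dK] _ _ /(_ _ cD (cD _ Dt) m) [_ fd]] := V_att (DV _ Dt).
rewrite linearP; apply: (glue_submod _ _).2 => //; rewrite linearB chain_d_cell.
have -> : cell (m - 1) t (dP k) - chain_d G m (f t m k) =
  (cell (m - 1) t (dP k) - f t (m - 1) (dP k)) +
  (f t (m - 1) (dP k) - chain_d G m (f t m k)) by zmod.
apply: submodD (glue_submod _ _) _ (fd _ Kk).
by apply: glue_gen => //; apply: (dK m).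
Qed.

Lemma glue_f0 D m t : ch_closed D -> (forall s, ch s t -> D s) -> V t -> glue D (f t m 0).
Proof.
move=> cD Dt Vt; have [[sK _] _ _ /(_ _ cD Dt m) [fl _]] := V_att Vt.
have K0 := submod0 (sK m).
have := fl 1 0 0 K0 K0; rewrite scaler0 addr0 scale1r => /(submodN (glue_submod _ _)).
by have -> : - (f t m 0 - (f t m 0 + f t m 0)) = f t m 0 by zmod.
Qed.

(** As [f t] is linear modulo [glue D], all relators of the new cell merge into one. Even [f t m 0]
    is 0 only modulo [glue D], whence the witness for g = 0. *)
Lemma glue_step D t m (g : G m) : ch_closed D -> (forall s, ch s t -> D s) -> V t ->
  glue (fun s => D s \/ s = t) g ->
  exists r k, [/\ glue D r, K t m k & g = r + (cell m t k - f t m k)].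
Proof.
move=> cD Dt Vt; have [[sK _] _ _ /(_ _ cD Dt m) [fl _]] := V_att Vt.
elim=> [|a s k0 g1 Ds Kk0 _ IH]; last have [r [k [hr Kk eg]]] := IH.
  exists (f t m 0), 0; split; [exact: glue_f0 | exact: submod0 (sK m) |].
  by rewrite linear0; zmod.
case: Ds => [Ds | e].
  exists (a *: (cell m s k0 - f s m k0) + r), k; split; [exact: glueS | by [] | by rewrite eg addrA].
subst s; rewrite eg; exists (r + (f t m (a *: k0 + k) - (a *: f t m k0 + f t m k))), (a *: k0 + k); split.
- by apply: submodD (glue_submod _ _) hr _; apply: fl.
- exact: (sK m).2.
- by rewrite [cell m _ (_ + _)]linearP; zmod.
Qed.

Lemma minimal_in (D' D : T -> Prop) : ch_closed D' -> (exists2 t, D' t & ~ D t) ->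
  exists t, [/\ D' t, ~ D t & forall s, ch s t -> D s].
Proof.
move=> cD' [t]; elim/(well_founded_ind ch_wf): t => t IH D't nD.
have [[s [st ns]]|h] := pselect (exists s, ch s t /\ ~ D s).
  by apply: (IH s) => //; apply: cD' st.
exists t; split=> // s st; apply: contrapT => ns; apply: h; by exists s.
Qed.

Lemma step_closed D t : ch_closed D -> (forall s, ch s t -> D s) ->
  ch_closed (fun s => D s \/ s = t).
Proof. by move=> cD Dt u [Du|->] s su; left; [apply: cD su | apply: Dt]. Qed.

(* Attaching further cells does not create relations among the old ones. *)
Lemma glue_inter D D' m (g : G m) : ch_closed D -> ch_closed D' ->
  (forall t, D t -> D' t) -> (forall t, D' t -> V t) ->
  glue D' g -> within D g -> glue D g.
Proof.
move=> cD cD' DD' D'V.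
(* Zorn's lemma is applied to the closed sets between [D] and [D'] that create no relation in [D]; a
   maximal one is [D'], since otherwise a minimal missing cell could be added. *)
pose ok (S : T -> Prop) := [/\ ch_closed S, forall t, D t -> S t, forall t, S t -> D' t
  & forall m (g : G m), glue S g -> within D g -> glue D g].
have okD : ok D by split.
pose J := {S : T -> Prop | ok S}.
pose le (S S' : J) := `[< forall t, sval S t -> sval S' t >].
have [| | |S hS] := @ZL_preorder J (exist _ D okD) le.
- by move=> S; apply/asboolP.
- by move=> S1 S2 S3 /asboolP h1 /asboolP h2; apply/asboolP => t /h1 /h2.
- move=> A tot; pose S t := D t \/ exists2 X : J, A X & sval X t.
  have okS : ok S.
    split=> [t [Dt|[X AX Xt]] s st | t | t | m' g' hg wg].
    + by left; apply: cD st.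
    + right; exists X => //; have [cX _ _ _] := svalP X; exact: cX st.
    + by left.
    + by case=> [/DD' // | [X _ Xt]]; have [_ _ h _] := svalP X; apply: h.
    (* Only finitely many relators occur in [g'], so one member of the chain, or [D] itself,
       contains all their cells. *)
    have [W [QW hW]] : exists W : T -> Prop, (W = D \/ exists2 X : J, A X & W = sval X) /\ glue W g'.
      elim: hg {wg} => [|a t k g1 St Kk _ [W [QW hW]]].
        by exists D; split; [left | exact: glue0].
      have [W' [QW' W't]] : exists W' : T -> Prop,
          (W' = D \/ exists2 X : J, A X & W' = sval X) /\ W' t.
        case: St => [Dt|[X AX Xt]]; first by exists D; split; [left|].
        by exists (sval X); split=> //; right; exists X.
      have [s1|s1] : (forall t, W t -> W' t) \/ (forall t, W' t -> W t).
      - case: QW QW' => [->|[X AX ->]] [->|[X' AX' ->]]; try by left.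
        + by left; have [_ h _ _] := svalP X'.
        + by right; have [_ h _ _] := svalP X.
        + by have := tot _ _ AX AX'; case=> /asboolP; [left | right].
      - by exists W'; split=> //; apply: glueS => //; apply: glue_sub s1 hW.
      - by exists W; split=> //; apply: glueS => //; apply: s1.
    case: QW hW => [-> //|[X AX ->]].
    by have [_ _ _ h] := svalP X => hW; apply: h.
  exists (exist _ S okS) => X AX; apply/asboolP => t Xt; right; by exists X.
have [cS DS SD' hSg] := svalP S.
have SV t : sval S t -> V t by move=> /SD'/D'V.
have all t : D' t -> sval S t.
  move=> D't; apply: contrapT => nS.
  have [|t0 [D't0 nt0 ht0]] := @minimal_in D' (sval S) cD'; first by exists t.
  have Vt0 := D'V _ D't0.
  have okS' : ok (fun s => sval S s \/ s = t0).
    split=> [|s Ds|s [/SD' //|->]//|m' g' hg wg]; first exact: step_closed.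
      by left; apply: DS.
    have [r [k [hr Kk eg]]] := glue_step cS ht0 Vt0 hg.
    have [_ _ hw _] := V_att Vt0.
    (* The coordinate of [g'] at [t0] is [k]: [r] lives on [S], and the attaching value lives on
       children of [t0], which are in [S]. But [g'] lives on [D], which omits [t0]. *)
    have k0 : k = 0.
      have := wg t0 (fun h => nt0 (DS _ h)); rewrite eg -/(cell_coord _ _) linearD linearB /=.
      rewrite /cell_coord coord_id (glue_within cS SV hr nt0).
      by rewrite (within_sub (ht0) (hw _ k) nt0) subr0 add0r.
    apply: hSg wg; rewrite eg k0 linear0 sub0r.
    by apply: submodB (glue_submod _ _) hr _; apply: glue_f0.
  have /asboolP h : le (exist _ _ okS') S.
    by apply: hS; apply/asboolP => s Ss; left.
  by apply: nt0; apply: h; right.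
by move=> hg; apply: hSg; apply: glue_sub all hg.
Qed.

Lemma glue_none m (g : G m) : glue (fun _ => False) g -> g = 0.
Proof. by elim. Qed.

(** This is the sum of [glue V] and Z inside G, so dividing by it gives the cokernel of the map from
    Z to the glued complex. *)
Definition glue_rel (m : int) (g : G m) : Prop := exists z, glue V ((z, g.2) : G m).

Lemma glue_rel_cx : subcx glue_rel.
Proof.
have [sV dV] := glue_cx V_closed (fun _ h => h).
split=> [m | m g [z hz]]; last by exists (chain_d Z m z); apply: dV hz.
split=> [|a g g' [z hz] [z' hz']]; first by exists 0; apply: submod0 (sV m).
by exists (a *: z + z'); apply: (sV m).2 a _ _ hz hz'.
Qed.

Lemma attach_filtered_pd m (C : lmodType R) (r : G m -> C -> Prop) :
  subquot (@glue_rel m) (@within V m) r -> pd n C.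
Proof.
move=> hr; have [lr hdom sr h0 hf] := hr.
pose J := {D : T -> Prop | ch_closed D /\ forall t, D t -> V t}.
pose le (D D' : J) := forall t, sval D t -> sval D' t.
pose F (D : J) (c : C) := exists2 g, within (sval D) g & r g c.
have wV (D : J) g : within (sval D) g -> within V g.
  by apply: within_sub; apply: (svalP D).2.
have cell_coord0 (D : T -> Prop) t (g : G m) : ~ D t -> within D g -> cell_coord t g = 0.
  by move=> nD; apply.
apply: (@filtered_pd R n J le C F).
  split.
  - by move=> D t.
  - by move=> D1 D2 D3 h1 h2 t /h1 /h2.
  - by move=> D D' h _ c [g hg rg]; exists g => //; apply: within_sub hg.
  - move=> D _; have sw := within_submod (sval D) m.
    split=> [|a c c' [g hg rg] [g' hg' rg']]; first by exists 0; [exact: submod0|exact: linrel0].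
    by exists (a *: g + g'); [apply: sw.2 | apply: lr.2].
  - move=> A tot; pose S t := exists2 D : J, A D & sval D t.
    have hS : ch_closed S /\ forall t, S t -> V t.
      split=> [t [D AD Dt] s st | t [D _ Dt]]; last exact: (svalP D).2.
      by exists D => //; apply: (svalP D).1 st.
    exists (exist _ S hS); split=> [D AD t Dt | _ c [g hg rg]]; first by exists D.
    have [s us hs] := coord_support g.2.
    have [| |s0|[D AD hD]] := @chain_list J T le A (fun D t => sval D t) s tot.
    + by move=> D D' t h /h.
    + move=> t /hs nz; have [D AD Dt] : S t.
        by apply: contrapT => nS; move/eqP: nz; apply; apply: hg.
      by exists D.
    + left; apply: (subquot_fun hr rg); apply/h0; exists 0.
      have -> : g.2 = 0.
        apply: coord_inj => t; rewrite linear0; apply/eqP/negPn/negP => /hs.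
        by rewrite s0.
      exact: submod0 (glue_submod _ _).
    + right; exists D => //; exists g => // t nD.
      by apply/eqP/negPn/negP => /hs /hD.
move=> D [c0 nc0].
have [|t [Vt nDt hch]] := @minimal_in V (sval D) V_closed.
  apply: contrapT => h; apply: nc0; have [g rg] := sr c0; exists g => //.
  move=> t nD; apply: (subquot_dom hr rg) => Vt; apply: h; by exists t.
have [cD DV] := svalP D.
have hD' : ch_closed (fun s => sval D s \/ s = t) /\ forall s, sval D s \/ s = t -> V s.
  by split=> [|s [/DV|->]] //; apply: step_closed.
pose D' : J := exist _ _ hD'.
have [_ hq wf _] := V_att Vt; have [Q [rq [hrq pQ]]] := hq m.
have [lq hdq sq hq0 hqf] := hrq.
have wD' (g : G m) p : within (sval D) g -> within (sval D') (g + cell m t p).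
  move=> hg; apply: submodD (within_submod _ _) _ _.
    by apply: within_sub hg => s; left.
  by apply: within_cell; right.
have coordD (g : G m) p : within (sval D) g -> cell_coord t (g + cell m t p) = p.
  move=> hg; rewrite linearD /= (cell_coord0 _ _ _ nDt hg) add0r.
  by rewrite /cell_coord coord_id.
(* Adding the minimal missing cell [t] contributes the quotient of [PP] by [K t m]: a class over
   [D'] is represented by [g + cell m t p], and [p] is read modulo [K t m]. *)
exists D', Q, (fun c q => exists g p, [/\ within (sval D) g, r (g + cell m t p) c & rq p q]).
split=> //.
- by move=> s Ds; left.
- by move=> h; apply: nDt; apply: h; right.
split.
- split=> [|a c q c' q' [g [p [hg rg hp]]] [g' [p' [hg' rg' hp']]]].
    exists 0, 0; split; [exact: submod0 (within_submod _ _)| | exact: linrel0].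
    by rewrite linear0 addr0; apply: linrel0.
  exists (a *: g + g'), (a *: p + p'); split; last exact: lq.2.
    exact: (within_submod _ _).2.
  have -> : a *: g + g' + cell m t (a *: p + p') =
    a *: (g + cell m t p) + (g' + cell m t p') by rewrite [cell m t _]linearP; zmod.
  exact: lr.2.
- move=> c; split=> [[g hg rg] | [q [g [p [hg rg hp]]]]].
    pose p := cell_coord t g.
    have [q hp] := (hdq p).1 I.
    exists q, (g - cell m t p), p; split=> //; last by rewrite subrK.
    move=> s nDs; have [-> | /eqP st] := eqVneq s t.
      by rewrite -/(cell_coord t _) linearB /= /cell_coord coord_id subrr.
    rewrite /= linearB /= coordE (negbTE (introN eqP st)) subr0.
    by apply: hg => -[].
  by exists (g + cell m t p) => //; apply: wD'.
- move=> q; have [p hp] := sq q.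
  have /hdom [c hc] : within V (cell m t p) by apply: within_cell.
  exists c, 0, p; rewrite add0r; split=> //; exact: submod0 (within_submod _ _).
- move=> c; split=> [[g [p [hg rg /hq0 Kp]]] | [g hg rg]]; last first.
    by exists g, 0; split=> //; [rewrite linear0 addr0 | exact: linrel0].
  exists (g + f t m p).
    apply: submodD (within_submod _ _) hg _.
    exact: within_sub hch (wf m p).
  apply: (subquot_shift hr rg); exists (g + f t m p - (g + cell m t p)).1.
  have -> : ((g + f t m p - (g + cell m t p)).1, (g + f t m p - (g + cell m t p)).2) =
      - (cell m t p - f t m p) :> G m.
    by rewrite -surjective_pairing; zmod.
  exact: submodN (glue_submod _ _) (glue_gen Vt Kp).
(* If the class vanishes, [glue_inter] brings the relation down to the cells of [D'], and
   [glue_step] shows its coordinate [p] at [t] to lie in [K t m]. *)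
- move=> q [g [p [hg /h0 [z hz] hp]]]; apply: (subquot_fun hrq hp); apply/hq0.
  have cV' := V_closed.
  have := @glue_inter (sval D') V m _ hD'.1 cV' hD'.2 (fun _ h => h) hz (wD' _ _ hg).
  move=> /(glue_step cD hch Vt) [r' [k [hr' Kk eg]]].
  suff <- : k = p by [].
  have <- : cell_coord t (r' + (cell m t k - f t m k)) = k.
    rewrite linearD linearB /= (cell_coord0 _ _ _ nDt (glue_within cD DV hr')).
    rewrite (cell_coord0 _ _ _ nDt (within_sub hch (wf m k))) subr0 add0r.
    by rewrite /cell_coord coord_id.
  by rewrite -eg; apply: coordD.
Qed.

Lemma attach_exact : exists (B C : chain_complex R) (i : chain_map Z B) (p : chain_map B C)
    (rB : forall m, G m -> B m -> Prop),
  [/\ subquot_cx (@glue V) (@within V) rB, short_exact i p & forall m, pd n (C m)].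
Proof.
have cV : subcx (@glue V) := glue_cx V_closed (fun _ h => h).
have gw m (g : G m) : glue V g -> within V g by apply: glue_within.
have [B [rB [hB dB]]] := subquot_cx_exists cV (within_cx V) gw.
have gw' m (g : G m) : glue_rel g -> within V g by case=> z /gw.
have [C [rC [hC dC]]] := subquot_cx_exists glue_rel_cx (within_cx V) gw'.
have w0 m z : within V ((z, 0) : G m) by move=> t _; rewrite linear0.
have [||||i hi] := @chain_of_rel R Z B (fun m z b => rB m (z, 0) b).
- move=> m; have [lr _ _ _ _] := hB m; split=> [|a x y x' y' h h']; first exact: (linrel0 lr).
  have -> : (a *: x + x', 0) = a *: (x, 0) + (x', 0) :> G m.
    by congr pair; rewrite /= scaler0 addr0.
  exact: lr.2.
- by move=> m z; have [_ h _ _ _] := hB m; apply/h.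
- by move=> m b; have [_ _ _ _] := hB m; apply.
- by move=> m z b /dB; rewrite /= /dsum_dfun /= linear0.
have [||||p hp] := @chain_of_rel R B C (fun m b c => exists g, rB m g b /\ rC m g c).
- move=> m; have [lr _ _ _ _] := hB m; have [lr' _ _ _ _] := hC m.
  exact: linrel_comp (linrel_inv lr) lr'.
- move=> m b; have [_ _ sB _ _] := hB m; have [g hg] := sB b.
  have [_ hd _ _ _] := hC m.
  by have /hd [c hc] := subquot_dom (hB m) hg; exists c, g.
- move=> m c [g [hb hc]]; have [_ _ _ h0 _] := hB m; have [_ _ _ h0' _] := hC m.
  apply: (subquot_fun (hC m) hc); apply/h0'; exists g.1.
  by rewrite -surjective_pairing; apply/h0.
- by move=> m b c [g [/dB h /dC h']]; exists (chain_d G m g).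
exists B, C, i, p, rB; split=> //; last by move=> m; apply: attach_filtered_pd (hC m).
move=> m; have [lB hdB sB h0B hfB] := hB m; have [lC hdC sC h0C hfC] := hC m; split.
- apply: lin_inj => z /hi /h0B hz.
  (* Injectivity on Z is [glue_inter] for the empty set of cells. *)
  have hg : glue (fun _ => False) ((z, 0) : G m).
    by apply: (@glue_inter (fun _ => False) V m) hz _ => // t _; rewrite linear0.
  by have [] : ((z, 0) : G m) = (0, 0) := glue_none hg.
- move=> c; have [g hg] := sC c; have /hdB [b hb] := subquot_dom (hC m) hg.
  by exists b; apply/hp; exists g.
- move=> b; split=> [/hp [g [hb /h0C [z hz]]] | [z /hi hz]].
    exists (g.1 - z); apply/hi; apply: (subquot_shift (hB m) hb).
    have -> : (g.1 - z, 0) - g = - (z, g.2) :> G m.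
      by congr pair; rewrite /=; zmod.
    exact: submodN (glue_submod _ _) hz.
  apply/hp; exists (z, 0); split=> //; apply/h0C; exists 0.
  exact: submod0 (glue_submod _ _).
Qed.

End Attaching.

(** * Cells named by well-founded trees *)

Section SmallObject.

Variables (R : pzRingType) (Z : chain_complex R).
Notation P := (disk R nat).
Notation PP := (disk_obj R nat).
Notation dP := (disk_d R nat).

(** A node stores an attaching map as raw data: at p in degree m its value has Z-component [z m p]
    and, for each j below [l m p], the summand [q m p j] in the cell [c m p j]. The subterm order
    replaces the stages of a transfinite construction. *)
Inductive cell_tree : Type :=
| cell_leaf
| cell_node (K : int -> PP -> Prop) (z : forall m : int, PP -> Z m)
    (l : int -> PP -> nat) (c : int -> PP -> nat -> cell_tree) (q : int -> PP -> nat -> PP).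

HB.instance Definition _ := gen_eqMixin cell_tree.
HB.instance Definition _ := gen_choiceMixin cell_tree.

Notation G := (attach_all Z cell_tree).

Definition tree_child (s t : cell_tree) : Prop :=
  if t is cell_node _ _ _ c _ then exists m p j, s = c m p j else False.

Lemma tree_child_wf : well_founded tree_child.
Proof.
elim=> [|K z l c IH q]; first by split=> s.
by split=> s /= [m [p [j ->]]]; apply: IH.
Qed.

Definition tree_rel (t : cell_tree) : int -> PP -> Prop :=
  if t is cell_node K _ _ _ _ then K else fun _ p => p = 0.

Definition tree_map (t : cell_tree) (m : int) (p : PP) : G m :=
  if t is cell_node _ z l c q then
    (z m p, \sum_(j < l m p) @inj R cell_tree PP (c m p j) (q m p j))
  else 0.

(** These are the kernels of the maps from P onto complexes of countably generated modules of
    projective dimension at most n. *)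
Definition relators n (K : int -> PP -> Prop) : Prop :=
  @subcx R P K /\ forall m, exists (Q : lmodType R) (r : PP -> Q -> Prop),
    subquot (K m) (fun _ => True) r /\ pd n Q.

(** Given [phi] from K to B, choose arbitrary lifts of its values to G. Their finite supports
    consist of legitimate cells, so together they form a node [t]. It is legitimate because [phi] is
    linear and commutes with d; hence its cell was glued from the outset, and its inclusion into B
    extends [phi]. *)
Lemma small_object n : exists (B C : chain_complex R) (i : chain_map Z B) (p : chain_map B C),
  [/\ short_exact i p, forall m, pd n (C m)
    & forall (K : int -> PP -> Prop) (phi : forall m, PP -> B m), relators n K ->
      (forall m a k k', K m k -> K m k' -> phi m (a *: k + k') = a *: phi m k + phi m k') ->
      (forall m k, K m k -> phi (m - 1) (dP k) = chain_d B m (phi m k)) ->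
      exists psi : chain_map P B, forall m k, K m k -> psi m k = phi m k].
Proof.
pose closed := ch_closed tree_child.
pose att := attachable n tree_child tree_rel tree_map.
(* The largest closed set of attachable trees. *)
pose V t := exists D, [/\ closed D, D t & forall s, D s -> att s].
have cV : closed V.
  move=> t [D [cD Dt hD]] s st; exists D; split=> //; exact: cD st.
have aV t : V t -> att t by case=> D [_ Dt]; apply.
have Vnew t : (forall s, tree_child s t -> V s) -> att t -> V t.
  move=> ht at_; exists (fun s => V s \/ s = t); split; [|by right|].
    by move=> u [Vu|->] s su; left; [apply: cV su | apply: ht].
  by move=> s [/aV|->].
(* Children are indexed by all of [nat], and those beyond the support of a value default to the
   leaf; so the leaf must be legitimate too. It attaches P along 0. *)
have Vleaf : V cell_leaf.
  apply: Vnew => //; split=> //.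
  - by split=> [m|m p /= ->]; [exact: submod_eq0 | rewrite linear0].
  - move=> m; have [Q [q [sq hq]]] := quot_exists (submod_eq0 PP).
    exists Q, (fun x y => q x = y); split.
      split; [exact: linrel_fun | by move=> x; split=> // _; exists (q x) | exact: sq | exact: hq |].
      by move=> y; rewrite linear0.
    apply: (@pd_iso _ n PP); last exact/projective_pd/projective_DS/projective_disk_mod.
    exists q; split=> //; apply: lin_inj => x; exact: (hq x).1.
  - by move=> m k t _; rewrite linear0.
  - move=> D _ _ m; split=> [a k k' _ _ | k _] /=; last by rewrite linear0 subrr; apply: glue0.
    by rewrite scaler0 addr0 subrr; apply: glue0.
have [B [C [i [p [rB [[hB dB] ex pC]]]]]] := attach_exact tree_child_wf cV aV.
exists B, C, i, p; split=> // K phi [Kcx Kpd] phil phid.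
have gex m k : exists g : G m, within V g /\ rB m g (phi m k).
  have [_ _ sB _ _] := hB m; have [g hg] := sB (phi m k).
  exists g; split=> //; exact: subquot_dom (hB m) hg.
pose g m k := sval (cid (gex m k)).
have gV m k : within V (g m k) by rewrite /g; case: cid => ? [].
have gB m k : rB m (g m k) (phi m k) by rewrite /g; case: cid => ? [].
pose s m k : seq cell_tree := s2val (cid2 (coord_support (g m k).2)).
have us m k : uniq (s m k) by rewrite /s; case: cid2.
have hs m k t : coord t (g m k).2 != 0 <-> t \in s m k by rewrite /s; case: cid2.
pose t := cell_node K (fun m k => (g m k).1) (fun m k => size (s m k))
  (fun m k j => nth cell_leaf (s m k) j)
  (fun m k j => coord (nth cell_leaf (s m k) j) (g m k).2).
have tE m k : tree_map t m k = g m k.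
  rewrite /= [RHS]surjective_pairing; congr pair.
  rewrite [RHS](DS_sum (us m k) (fun t => (hs m k t).1)).
  by rewrite (big_nth cell_leaf) big_mkord.
have chV u : tree_child u t -> V u.
  move=> [m [k [j ->]]]; have [jl|jl] := ltnP j (size (s m k)); last by rewrite nth_default.
  have /hs nz := mem_nth cell_leaf jl.
  by apply: contrapT => nV; move/eqP: nz; apply; apply: gV.
have gch m k : within (fun u => tree_child u t) (g m k).
  move=> u nu; apply/eqP/negPn/negP => /hs us'; apply: nu.
  by exists m, k, (index u (s m k)); rewrite nth_index.
(* A relation in B among the children of [t] uses relators from all of V; [glue_inter] brings it
   down to the cells in both [D] and [V]. This is how identities for [phi] become the conditions in
   [attachable]. *)
have gD D m (e : G m) : closed D -> (forall u, tree_child u t -> D u) ->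
    within (fun u => tree_child u t) e -> rB m e 0 -> glue tree_rel tree_map D e.
  move=> cD tD we; have [_ _ _ h0 _] := hB m => /h0 ge.
  apply: (@glue_sub _ _ _ _ _ (fun u => D u /\ V u)); first by move=> u [].
  apply: (glue_inter tree_child_wf aV _ cV _ _ ge) => // [u [Du Vu] v vu|u []//|].
    by split; [apply: cD vu | apply: cV vu].
  by apply: within_sub we => u ut; split; [apply: tD | apply: chV].
have at_ : att t.
  split=> //; first by move=> m k; rewrite tE.
  move=> D cD tD m; have ws := within_submod Z (fun u => tree_child u t).
  have [lB _ _ _ _] := hB m; split=> [a k k' Kk Kk' | k Kk]; rewrite !tE; apply: gD => //.
  - by apply: submodB (ws m) _ _ => //; apply: (ws m).2.
  - rewrite -(subrr (phi m (a *: k + k'))); apply: linrelB => //.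
    by rewrite phil //; apply: lB.2.
  - apply: submodB (ws _) _ _ => //.
    exact: (within_cx Z (fun u => tree_child u t)).2.
  - rewrite -(subrr (phi (m - 1) (dP k))); apply: linrelB => //; first by have [] := hB (m - 1).
    by rewrite phid //; apply: dB.
have Vt : V t by apply: Vnew.
have [||||psi hpsi] := @chain_of_rel R P B (fun m k b => rB m (cell Z m t k) b).
- move=> m; have [lB _ _ _ _] := hB m; split=> [|a x y x' y' h h'].
    by rewrite linear0; apply: linrel0.
  by rewrite linearP; apply: lB.2.
- by move=> m k; have [_ hd _ _ _] := hB m; apply/hd; apply: within_cell.
- by move=> m b; rewrite linear0; have [_ _ _ _] := hB m; apply.
- by move=> m k b /dB; rewrite chain_d_cell.
exists psi => m k Kk; apply/hpsi; apply: (subquot_shift (hB m) (gB m k)).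
by rewrite -tE; apply: glue_gen.
Qed.

End SmallObject.

(** * Countably generated extensions *)

Section Countable.

Variable R : pzRingType.
Implicit Types M N Q : lmodType R.

(** Countable generation of B / A as an induction principle for B, with neither quotients nor finite
    sums. *)
Definition cg_over M (A B : M -> Prop) : Prop :=
  exists g : nat -> M, (forall i, B (g i)) /\
    forall N : M -> Prop, submod N -> (forall x, A x -> N x) -> (forall i, N (g i)) ->
      forall x, B x -> N x.

Lemma cg_over_family M (A B : M -> Prop) (I : countType) (s : I -> seq M) : B 0 ->
  (forall i y, y \in s i -> B y) ->
  (forall N : M -> Prop, submod N -> (forall x, A x -> N x) ->
    (forall i y, y \in s i -> N y) -> forall x, B x -> N x) -> cg_over A B.
Proof.
move=> B0 sB h; exists (fun k => if @unpickle (I * nat)%type k is Some p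
  then nth 0 (s p.1) p.2 else 0); split=> [k | N sN AN gN].
  case: (unpickle k) => // -[i j] /=; have [jl|jl] := ltnP j (size (s i)).
    by apply: (sB i); apply: mem_nth.
  by rewrite nth_default.
apply: h => // i y ys; have := gN (pickle (i, index y (s i))).
by rewrite pickleK /= nth_index.
Qed.

Lemma cg_over_refl M (A : M -> Prop) : A 0 -> cg_over A A.
Proof. by move=> A0; exists (fun _ => 0); split=> // N _ h _. Qed.

Lemma cg_over_trans M (A B C : M -> Prop) : submod C -> (forall x, B x -> C x) ->
  cg_over A B -> cg_over B C -> cg_over A C.
Proof.
move=> sC BC [g [gB h]] [g' [gC h']].
apply: (@cg_over_family _ _ _ (bool * nat)%type
  (fun p => [:: if p.1 then g p.2 else g' p.2])) => [|p y|N sN AN gN x Cx].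
- exact: submod0.
- by rewrite inE => /eqP ->; case: p.1 => //; apply: BC.
apply: h' => // [z Bz|k]; last by apply: (gN (false, k)); rewrite inE.
by apply: h => // k; apply: (gN (true, k)); rewrite inE.
Qed.

Lemma cg_over_union M (A B : M -> Prop) (Bk : nat -> M -> Prop) : submod B ->
  (forall k x, Bk k x -> B x) -> (forall x, B x -> x = 0 \/ exists k, Bk k x) ->
  (forall k, cg_over A (Bk k)) -> cg_over A B.
Proof.
move=> sB BkB BBk cg; pose g k := sval (cid (cg k)).
have hg k := svalP (cid (cg k)); rewrite -/(g _) in hg.
apply: (@cg_over_family _ _ _ (nat * nat)%type (fun p => [:: g p.1 p.2])) => [|p y|N sN AN gN x].
- exact: submod0.
- by rewrite inE => /eqP ->; apply: (BkB p.1); apply: (hg p.1).1.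
move=> /BBk [->|[k Bx]]; first exact: submod0.
by apply: (hg k).2 Bx => // l; apply: (gN (k, l)); rewrite inE.
Qed.

Lemma cg_over_quot M (A B : M -> Prop) Q (r : M -> Q -> Prop) :
  subquot A B r -> cg_over A B -> cg_over (fun q : Q => q = 0) (fun _ => True).
Proof.
move=> hr [g [gB h]]; have [lr hdom sr h0 hf] := hr.
pose q k := sval (cid ((hdom _).1 (gB k))).
have hq k : r (g k) (q k) by rewrite /q; case: cid.
exists q; split=> // N sN N0 gN x _; have [y hy] := sr x.
have [x' rx' Nx'] : exists2 x', r y x' & N x'.
  apply: (h (fun y => exists2 x', r y x' & N x')) (subquot_dom hr hy) => [|z Az|k].
  - split=> [|a u v [u' ru Nu] [v' rv Nv]]; first by exists 0; [exact: linrel0 | exact: submod0].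
    by exists (a *: u' + v'); [apply: lr.2 | apply: sN.2].
  - by exists 0; [apply/h0 | exact: submod0].
  - by exists (q k).
by rewrite (subquot_fun hr hy rx').
Qed.

Lemma countably_generatedP M :
  countably_generated M <-> cg_over (fun x : M => x = 0) (fun _ => True).
Proof.
split=> [[g hg] | [g [_ h]]]; exists g.
  split=> // N sN _ gN x _; have [k [a ->]] := hg x.
  by apply: submod_sum => // i _; apply: submodZ.
have [f hf] := DS_lift (fun i : nat => [the {linear R^o -> M} of scale_at (g i)]).
move=> x; have [w <-] : exists w, f w = x.
  apply: (h (fun x => exists w, f w = x)) => // [|y -> |i].
  - split=> [|a _ _ [w <-] [w' <-]]; first by exists 0; rewrite linear0.
    by exists (a *: w + w'); rewrite linearP.
  - by exists 0; rewrite linear0.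
  - by exists (@inj R nat R^o i 1); rewrite hf /= /scale_at scale1r.
have [s hs] := coord_fin w; pose k := (\max_(i <- s) i).+1.
exists k, (fun i => coord (val i) w).
have sk t : coord t w != 0 -> t \in iota 0 k.
  by move=> /hs ts; rewrite mem_iota /= add0n ltnS; apply: leq_bigmax_seq.
rewrite [w in LHS](DS_sum (iota_uniq 0 k) sk) linear_sum.
have -> : iota 0 k = index_iota 0 k by rewrite /index_iota subn0.
by rewrite big_mkord; apply: eq_bigr => i _; rewrite /= hf.
Qed.

(** The ideal is even finitely generated: otherwise elements outside the ideal generated so far
    could be adjoined forever. The finite list is padded with zeros to a sequence, the form used for
    [cg_over]. *)
Lemma left_ideal_countably_generated (I : R -> Prop) : left_noetherian R -> left_ideal I ->
  exists r : nat -> R, (forall k, I (r k)) /\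
    forall J, left_ideal J -> (forall k, J (r k)) -> forall x, I x -> J x.
Proof.
move=> noeth [I0 ID IM].
pose idl (s : seq R) x := forall J, left_ideal J -> (forall y, y \in s -> J y) -> J x.
have idlw s : left_ideal (idl s).
  split=> [J [h _ _] _ //|x y hx hy J wJ sJ|a x hx J wJ sJ].
    by have [_ h _] := wJ; apply: h; [apply: hx | apply: hy].
  by have [_ _ h] := wJ; apply: h; apply: hx.
have [[s [sI hs]]|h] := pselect (exists s : seq R, (forall y, y \in s -> I y) /\
    forall x, I x -> idl s x).
  exists (nth 0 s); split=> [k | J wJ sJ x /hs h].
    by have [ks|ks] := ltnP k (size s); [apply/sI/mem_nth | rewrite nth_default].
  by apply: h => // y ys; rewrite -(nth_index 0 ys).
pose St := {s : seq R | forall y, y \in s -> I y}.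
have /choice [g hg] : forall s : St, exists s' : St,
    (forall y, y \in sval s -> y \in sval s') /\
    exists2 x, x \in sval s' & ~ idl (sval s) x.
  move=> s; have [x Ix nx] : exists2 x, I x & ~ idl (sval s) x.
    apply: contrapT => h'; apply: h; exists (sval s); split; first exact: (svalP s).
    by move=> x Ix; apply: contrapT => nx; apply: h'; exists x.
  have hx y : y \in x :: sval s -> I y by rewrite inE => /orP [/eqP -> // | /(svalP s)].
  exists (exist _ (x :: sval s) hx); split=> [y ys|] /=; first by rewrite inE ys orbT.
  by exists x => //; apply: mem_head.
have s0 : forall y, y \in ([::] : seq R) -> I y by [].
pose f k := iter k g (exist _ [::] s0 : St).
have [||N hN] := noeth (fun k => idl (sval (f k))) => //.
  by move=> k x hx J wJ sJ; apply: hx => // y ys; apply: sJ; apply: (hg (f k)).1.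
have [_ [x xs nx]] := hg (f N); case: nx; apply: (hN N.+1) => //.
by move=> J _; apply.
Qed.

(** Let [Bk k] be A plus the span of the first k generators. The leading coefficients, at [g k], of
    the elements of K in [Bk k.+1] form a left ideal [I k]. Elements [y k l] of K realising its
    generators suffice: subtracting a combination of them moves an element of K from [Bk k.+1] to
    [Bk k]. *)
Lemma cg_over_inter M (A B K : M -> Prop) : left_noetherian R -> submod A -> submod B ->
  submod K -> (forall x, A x -> B x) -> cg_over A B ->
  cg_over (fun x => A x /\ K x) (fun x => B x /\ K x).
Proof.
move=> noeth sA sB sK AB [g [gB h]].
pose fix Bk k : M -> Prop :=
  if k is k'.+1 then fun x => exists a, Bk k' (x - a *: g k') else A.
have BkE k x : Bk k.+1 x = exists a, Bk k (x - a *: g k) by [].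
have sBk k : submod (Bk k).
  elim: k => [//|k IH]; split=> [|a x y [b hb] [c hc]].
    by exists 0; rewrite scale0r subrr; apply: submod0.
  exists (a * b + c).
  have -> : a *: x + y - (a * b + c) *: g k = a *: (x - b *: g k) + (y - c *: g k).
    by rewrite scalerDl -scalerA; zmod.
  exact: IH.2.
have BkS k x : Bk k x -> Bk k.+1 x by exists 0; rewrite scale0r subr0.
have Bkle k l x : (k <= l)%N -> Bk k x -> Bk l x.
  move=> kl hx; elim: l kl => [|l IH]; first by rewrite leqn0 => /eqP <-.
  by rewrite leq_eqVlt => /orP [/eqP <- // | /IH /BkS].
have BkB k x : Bk k x -> B x.
  elim: k x => [|k IH] x; first exact: AB.
  case=> a /IH hx; rewrite -[x](subrK (a *: g k)); apply: submodD => //.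
  exact: submodZ.
have Bex x : B x -> exists k, Bk k x.
  apply: (h (fun x => exists k, Bk k x)) => [|y Ay|k].
  - split=> [|a y z [k hk] [l hl]]; first by exists 0%N; apply: submod0.
    exists (maxn k l); apply: (sBk _).2; [apply: Bkle hk | apply: Bkle hl].
      exact: leq_maxl.
    exact: leq_maxr.
  - by exists 0%N.
  - by exists k.+1; exists 1; rewrite scale1r subrr; apply: submod0.
pose I k a := exists2 y, K y & Bk k (y - a *: g k).
have Iw k : left_ideal (I k).
  split=> [|a b [y Ky hy] [z Kz hz]|a b [y Ky hy]].
  - by exists 0; [exact: submod0 | rewrite scale0r subrr; apply: submod0].
  - exists (y + z); first exact: submodD.
    have -> : y + z - (a + b) *: g k = (y - a *: g k) + (z - b *: g k).
      by rewrite scalerDl; zmod.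
    exact: submodD.
  - exists (a *: y); first exact: submodZ.
    by rewrite -scalerA -scalerBr; apply: submodZ.
have rex k := left_ideal_countably_generated noeth (Iw k).
pose r k := sval (cid (rex k)); have hr k := svalP (cid (rex k)); rewrite -/(r _) in hr.
pose y k l := s2val (cid2 ((hr k).1 l)).
have Ky k l : K (y k l) by rewrite /y; case: cid2.
have hy k l : Bk k (y k l - r k l *: g k) by rewrite /y; case: cid2.
have yB k l : B (y k l) by apply: (BkB k.+1); exists (r k l).
apply: (@cg_over_family _ _ _ (nat * nat)%type (fun p => [:: y p.1 p.2])) => [|p z|N sN AN yN x [Bx Kx]].
- by split; apply: submod0.
- by rewrite inE => /eqP ->.
have [k hk] := Bex x Bx; elim: k x {Bx} Kx hk => [|k IH] x Kx; first by move=> Ax; apply: AN.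
case=> a ha.
have [z [Nz Kz hz]] : exists z, [/\ N z, K z & Bk k (z - a *: g k)].
  apply: ((hr k).2 (fun a => exists z, [/\ N z, K z & Bk k (z - a *: g k)])) => [|l|].
  - split=> [|b c [u [h1 h2 h3]] [v [h4 h5 h6]]|b c [u [h1 h2 h3]]].
    + exists 0; split; try exact: submod0.
      by rewrite scale0r subrr; apply: submod0.
    + exists (u + v); split; try exact: submodD.
      have -> : u + v - (b + c) *: g k = (u - b *: g k) + (v - c *: g k).
        by rewrite scalerDl; zmod.
      exact: submodD.
    + exists (b *: u); split; try exact: submodZ.
      by rewrite -scalerA -scalerBr; apply: submodZ.
  - by exists (y k l); split=> //; apply: (yN (k, l)); rewrite inE.
  - by exists x.
rewrite -[x](subrK z); apply: submodD => //; apply: IH; first exact: submodB.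
have -> : x - z = (x - a *: g k) - (z - a *: g k) by zmod.
exact: submodB.
Qed.

Lemma res_countable n M : left_noetherian R -> countably_generated M -> pd n M ->
  res (fun P => projective P /\ countably_generated P) n M.
Proof.
move=> noeth; elim: n M => [|n IH] M cM pM; first by split.
have [g hg] := cM.
have [e he] := DS_lift (fun i : nat => [the {linear R^o -> M} of scale_at (g i)]).
have se : surjective_fun e.
  move=> x; have [k [a ->]] := hg x.
  exists (\sum_(i < k) @inj R nat R^o i (a i)); rewrite linear_sum.
  by apply: eq_bigr => i _; rewrite he.
have [K [i hs]] := ker_exists se; have [ii _ hie] := hs.
have pE : projective (DS nat R^o) by apply/projective_DS/projective_ring.
have cE : cg_over (fun w : DS nat R^o => w = 0) (fun _ => True).
  exists (fun k => @inj R nat R^o k 1); split=> // N sN _ gN w _.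
  apply: DS_in => // t _.
  have -> : coord t w = coord t w *: (1 : R^o) by rewrite /GRing.scale /= mulr1.
  rewrite linearZ /=; exact: (submodZ _ sN (gN t)).
exists K, (DS nat R^o), i, e; split=> //; first by split=> //; apply/countably_generatedP.
apply: IH; last exact: pd_syzygy hs pE pM.
apply/countably_generatedP.
have [|g' [gB h]] := cg_over_inter noeth (submod_eq0 _) (submodT _)
  (submod_preim e (submod_eq0 M)) _ cE => //.
pose k l := sval (cid ((hie _).1 (gB l).2)).
have hk l : i (k l) = g' l by rewrite /k; case: cid.
exists k; split=> // N sN N0 kN x _.
have [y Ny /ii <- //] : exists2 y, N y & i y = i x.
  apply: (h (fun w => exists2 y, N y & i y = w)).
  - exact: submod_im.
  - by move=> w [-> _]; exists 0; [exact: submod0 | rewrite linear0].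
  - by move=> l; exists (k l).
  - by split=> //; apply/hie; exists x.
Qed.

End Countable.

(** * Hill's lemma *)

Section Hill.

Variable R : pzRingType.
Implicit Types K M N Q : lmodType R.

Lemma omega_le (J : Type) (le : J -> J -> Prop) (f : nat -> J) :
  (forall j, le j j) -> (forall j k l, le j k -> le k l -> le j l) ->
  (forall k, le (f k) (f k.+1)) -> forall k l, (k <= l)%N -> le (f k) (f l).
Proof.
move=> lerr letr h k; elim=> [|l IH]; first by rewrite leqn0 => /eqP ->.
by rewrite leq_eqVlt => /orP [/eqP -> // | /IH kl]; apply: letr kl (h l).
Qed.

Lemma omega_ub (J : Type) (le : J -> J -> Prop) I (X : I -> lmodType R)
    (F : J -> forall i, X i -> Prop) (f : nat -> J) :
  cont_family le F -> (forall k, le (f k) (f k.+1)) ->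
  exists b, (forall k, le (f k) b) /\
    forall i x, F b i x -> x = 0 \/ exists k, F (f k) i x.
Proof.
move=> [lerr letr _ _ chain] h; have fle := omega_le lerr letr h.
have [_ _ [k _ <-] [l _ <-]|b [hb hF]] := chain (fun j => exists2 k, True & f k = j).
  by case/orP: (leq_total k l) => /fle; [left | right].
exists b; split=> [k | i x /hF [->|[_ [k _ <-] hx]]]; first by apply: hb; exists k.
  by left.
by right; exists k.
Qed.

Definition basis (T : choiceType) (t : T) : DS T R^o := @inj R T R^o t 1.

Lemma supp_span (T : choiceType) (U : T -> Prop) (A : DS T R^o -> Prop) w :
  submod A -> (forall t, U t -> A (basis t)) -> supp U w -> A w.
Proof.
move=> sA h hw; apply: (supp_in sA hw) => t v /h ht.
have -> : v = (v : R) *: (1 : R^o) by rewrite /GRing.scale /= mulr1.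
by rewrite linearZ /=; apply: submodZ.
Qed.

Lemma supp_seq (T : choiceType) (V : lmodType R) (w : DS T V) :
  {s : seq T | supp (fun t => t \in s) w /\ forall t, t \in s -> coord t w != 0}.
Proof.
apply: cid; have [s us hs] := coord_support w; exists s; split=> t.
  by move=> nts; apply/eqP/negPn/negP => /hs.
by move=> /hs.
Qed.

Definition suppl (T : choiceType) (V : lmodType R) (w : DS T V) : seq T := sval (supp_seq w).

Lemma supplP (T : choiceType) (V : lmodType R) (w : DS T V) : supp (fun t => t \in suppl w) w.
Proof. exact: (svalP (supp_seq w)).1. Qed.

Lemma suppl_sub (T : choiceType) (V : lmodType R) (w : DS T V) (U : T -> Prop) t :
  supp U w -> t \in suppl w -> U t.
Proof.
move=> hw /(svalP (supp_seq w)).2 nz; apply: contrapT => nU; move/eqP: nz; apply.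
exact: hw.
Qed.

Lemma supp_chain (J : Type) (T : choiceType) (V : lmodType R) (le : J -> J -> Prop)
    (A : J -> Prop) (U : J -> T -> Prop) (w : DS T V) :
  (forall a b, A a -> A b -> le a b \/ le b a) ->
  (forall a b t, le a b -> U a t -> U b t) ->
  supp (fun t => exists2 a, A a & U a t) w -> w = 0 \/ exists2 a, A a & supp (U a) w.
Proof.
move=> tot mono hw; have [t ts|s0|[a Aa ha]] := @chain_list J T le A U (suppl w) tot mono.
- exact: (suppl_sub hw ts).
- left; apply: coord_inj => t; rewrite linear0; apply: (supplP (w := w)).
  by rewrite s0.
- by right; exists a => //; apply: supp_sub (supplP (w := w)) => t /ha.
Qed.

(** More than a filtration: every pair of comparable members has a good quotient, and any member can
    absorb countably many elements at countable cost. Limits of alternating enlargements, over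
    syzygies or over degrees, rely on both. *)
Definition hill n M : Prop :=
  exists (J : Type) (le : J -> J -> Prop) (F : J -> M -> Prop),
  [/\ mod_family le F,
      forall j j', le j j' -> exists (Q : lmodType R) (r : M -> Q -> Prop),
        subquot (F j) (F j') r /\ pd n Q
    & forall j (x : nat -> M), exists j',
        [/\ le j j', forall i, F j' (x i) & cg_over (F j) (F j')]].

(** M is a retract of a free module through [i] and [e]. The members come from the sets S of basis
    elements whose span is stable under the idempotent [i \o e]; the quotient of two of them is then
    a retract of the free module on the difference of the sets. *)
Lemma hill_projective M : projective M -> hill 0 M.
Proof.
move=> pM; have [T [e se]] := free_cover M; set E := DS T R^o in e se.
have [i ei] := pM _ _ e [the {linear M -> M} of idfun] se.
pose J := {S : T -> Prop | forall t, S t -> supp S (i (e (basis t)))}.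
pose le (S S' : J) := forall t, sval S t -> sval S' t.
pose F (S : J) (x : M) := exists2 w, supp (sval S) w & e w = x.
have Fsub S : submod (F S) by apply: submod_im (supp_submod _ _).
have ie (S : J) w : supp (sval S) w -> supp (sval S) (i (e w)).
  apply: (@supp_span _ (sval S) (fun w => supp (sval S) (i (e w)))); last exact: (svalP S).
  exact: (submod_preim [the {linear E -> E} of i \o e] (supp_submod _ _)).
have Fi (S : J) x : F S x -> supp (sval S) (i x) by case=> w hw <-; apply: ie.
exists J, le, F; split.
- split=> //.
  + by move=> S t.
  + by move=> S1 S2 S3 h1 h2 t /h1 /h2.
  + by move=> S S' h _ x [w hw <-]; exists w => //; apply: supp_sub hw.
  + move=> A tot; pose S t := exists2 a : J, A a & sval a t.
    have hS t : S t -> supp S (i (e (basis t))).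
      move=> [a Aa at_]; apply: (@supp_sub _ _ _ (sval a)); last exact: (svalP a).
      by move=> t' at'; exists a.
    exists (exist _ S hS); split=> [a Aa t at_ | _ x [w hw <-]]; first by exists a.
    have [||->|[a Aa ha]] := @supp_chain J T _ le A (fun a t => sval a t) w tot.
    * by move=> a b t ab; apply: ab.
    * exact: hw.
    * by left; rewrite linear0.
    * by right; exists a => //; exists w.
- move=> S S' SS'.
  have FF x : F S x -> F S' x by move=> [w hw <-]; exists w => //; apply: supp_sub hw.
  have [Q [r hr]] := subquot_exists (Fsub S) (Fsub S') FF.
  have [QF [rF hrF]] := subquot_exists (supp_submod R^o (sval S)) (supp_submod R^o (sval S'))
    (fun w => supp_sub SS').
  exists Q, r; split=> //.
  have pQF : projective QF by apply: subquot_supp_projective hrF; apply: projective_ring.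
  have [lr hdom sr h0 hf] := hr; have [lrF hdomF srF h0F hfF] := hrF.
  have [|||iq hiq] := @lin_of_rel _ Q QF (fun q u => exists x, r x q /\ rF (i x) u).
  + apply: (linrel_comp (linrel_inv lr)).
    split=> [|a x y x' y' h h']; first by rewrite linear0; apply: linrel0.
    by rewrite linearP; apply: (lrF.2).
  + move=> q; have [x hx] := sr q; have /Fi/hdomF [u hu] := subquot_dom hr hx.
    by exists u, x.
  + by move=> u [x [/h0/Fi/h0F h1 h2]]; apply: (subquot_fun hrF h2).
  have [|||eq heq] := @lin_of_rel _ QF Q (fun u q => exists w, rF w u /\ r (e w) q).
  + apply: (linrel_comp (linrel_inv lrF)).
    split=> [|a x y x' y' h h']; first by rewrite linear0; apply: linrel0.
    by rewrite linearP; apply: (lr.2).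
  + move=> u; have [w hw] := srF u.
    have /hdom [q hq] : F S' (e w) by exists w => //; apply: subquot_dom hrF hw.
    by exists q, w.
  + move=> q [w [/h0F hw h2]]; apply: (subquot_fun hr h2); apply/h0; by exists w.
  apply: (projective_retract (i := iq) (e := eq) pQF) => q.
  have /hiq [x [hx hu]] := erefl (iq q).
  by apply/heq; exists (i x); split=> //; rewrite ei.
(* The idempotent sends each basis element to a finite combination, so closing under it from the
   supports of the [i (x j)] adds countably many labels. *)
- move=> S x; pose step (s : seq T) := flatten [seq suppl (i (e (basis t))) | t <- s].
  pose l k j := iter k step (suppl (i (x j))).
  pose S' t := sval S t \/ exists k j, t \in l k j.
  have hS' t : S' t -> supp S' (i (e (basis t))).
    move=> [St|[k [j tl]]].
      by apply: (@supp_sub _ _ _ (sval S)); [move=> ? ?; left | apply: (svalP S)].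
    apply: supp_sub (supplP (w := i (e (basis t)))) => t' ht'.
    right; exists k.+1, j; apply/flattenP; exists (suppl (i (e (basis t)))) => //.
    by apply/mapP; exists t.
  exists (exist _ S' hS'); split=> [t St | j | ]; first by left.
    exists (i (x j)); last by rewrite ei.
    by apply: supp_sub (supplP (w := i (x j))) => t ht; right; exists 0%N, j.
  apply: (@cg_over_family _ _ _ _ (nat * nat)%type
    (fun p => [seq e (basis t) | t <- l p.1 p.2])).
  + by exists 0; [apply: submod0 (supp_submod _ _) | rewrite linear0].
  + move=> [k j] y /mapP [t tl ->]; exists (basis t) => //.
    by apply: supp_inj; right; exists k, j.
  + move=> N sN FN gN y [w hw <-].
    apply: (@supp_span T S' (fun w => N (e w)) w (submod_preim e sN)) => // t.
    case=> [St | [k [j tl]]]; first by apply: FN; exists (basis t) => //; apply: supp_inj.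
    by apply: (gN (k, j)); apply/mapP; exists t.
Qed.

(** A member is a set S of labels with a member j of the family of K that is exactly the part of K
    inside the span of S. The image of that span in M then has syzygy [FK j], and [ses_subquot]
    bounds the dimension of the quotients. *)
Lemma hill_syzygy n (K : lmodType R) M (T : choiceType) (i : {linear K -> DS T R^o})
    (e : {linear DS T R^o -> M}) :
  left_noetherian R -> ses i e -> hill n K -> hill n.+1 M.
Proof.
move=> noeth hs [JK [leK [FK [[lerr letr lemono Fsub chain] FKpd FKext]]]].
have cFK : mod_family leK FK by split.
have FKsub j : submod (FK j) := Fsub j tt.
have FKmono j j' k : leK j j' -> FK j k -> FK j' k := fun h => lemono _ _ h tt k.
have [ii se hie] := hs; set E := DS T R^o in i e hs ii se hie.
pose J := {p : (T -> Prop) * JK | forall k, FK p.2 k <-> supp p.1 (i k)}.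
pose le (p q : J) := (forall t, (sval p).1 t -> (sval q).1 t) /\ leK (sval p).2 (sval q).2.
pose F (p : J) (x : M) := exists2 w, supp (sval p).1 w & e w = x.
have FsubM p : submod (F p) by apply: submod_im (supp_submod _ _).
exists J, le, F; split.
- split.
  + by move=> p; split.
  + move=> p q r [h1 h2] [h3 h4]; split; last exact: letr h2 h4.
    by move=> t /h1 /h3.
  + by move=> p q [h _] _ x [w hw <-]; exists w => //; apply: supp_sub hw.
  + by [].
  + move=> A tot; pose S t := exists2 a : J, A a & (sval a).1 t.
    have [_ _ [p Ap <-] [q Aq <-]|b [hb hF]] := chain (fun j => exists2 p, A p & (sval p).2 = j).
      by have [[_ ?]|[_ ?]] := tot p q Ap Aq; [left | right].
    have chS (w : E) : supp S w -> w = 0 \/ exists2 a : J, A a & supp (sval a).1 w.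
      move=> hw; apply: (@supp_chain J T _ le A (fun a t => (sval a).1 t) w tot _ hw).
      by move=> a b' t [h _]; apply: h.
    have hSb k : FK b k <-> supp S (i k).
      split=> [/(hF tt) [->|[_ [p Ap <-] /(svalP p)]] | /chS [i0|[p Ap /(svalP p) hp]]].
      * by rewrite linear0; apply: submod0 (supp_submod _ _).
      * by apply: supp_sub => t pt; exists p.
      * have k0 : k = 0 by apply: ii; rewrite i0 linear0.
        by rewrite k0; apply: submod0 (FKsub b).
      * by apply: FKmono hp; apply: hb; exists p.
    exists (exist (fun p => forall k, FK p.2 k <-> supp p.1 (i k)) (S, b) hSb).
    split=> [p Ap | _ x [w /chS [->|[p Ap hp]] <-]].
    * by split=> [t pt|] /=; [exists p | apply: hb; exists p].
    * by left; rewrite linear0.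
    * by right; exists p => //; exists w.
- move=> p q [pqS pqj].
  have FF x : F p x -> F q x by move=> [w hw <-]; exists w => //; apply: supp_sub hw.
  have [Q [r hr]] := subquot_exists (FsubM p) (FsubM q) FF.
  have [QF [rF hrF]] := subquot_exists (supp_submod R^o (sval p).1)
    (supp_submod R^o (sval q).1) (fun w => supp_sub pqS).
  have [QK [rK [hrK pK]]] := FKpd _ _ pqj.
  have hrK' : subquot (fun k => supp (sval p).1 (i k)) (fun k => supp (sval q).1 (i k)) rK.
    have [h1 h2 h3 h4 h5] := hrK; split=> // k; first by rewrite -(svalP q).
    by rewrite h4 (svalP p).
  have [iq [eq hq]] := ses_subquot hs (supp_submod _ (sval p).1) (supp_submod _ (sval q).1)
    (fun w => supp_sub pqS) (fun x => iff_refl _) (fun x => iff_refl _) hrK' hrF hr.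
  exists Q, r; split=> //; exists QK, QF, iq, eq; split=> //.
  by apply: subquot_supp_projective hrF; apply: projective_ring.
- move=> p x; pose S := (sval p).1; pose j := (sval p).2.
  have pP k : FK j k <-> supp S (i k) := svalP p k.
  pose big (U : T -> Prop) := exists s : nat -> seq T,
    forall t, U t <-> S t \/ exists l, t \in s l.
  pose St := {q : (T -> Prop) * JK |
    [/\ leK j q.2, forall k, FK q.2 k -> supp q.1 (i k) & big q.1]}.
  (* Back and forth between two inclusions: enlarge j until [FK j] contains the part of K over [U],
     which is countable by [cg_over_inter], then enlarge [U] by the supports of the new generators.
     In the limit both inclusions hold. *)
  have next (q : St) : exists q' : St,
      [/\ forall t, (sval q).1 t -> (sval q').1 t, leK (sval q).2 (sval q').2
        & forall k, supp (sval q).1 (i k) -> FK (sval q').2 k].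
    have [jq qS [s hs']] := svalP q; set U := (sval q).1 in qS hs' *; set jq' := (sval q).2 in jq qS *.
    have SU t : S t -> U t by move=> h; apply/hs'; left.
    have cg : cg_over (supp S : E -> Prop) (supp U).
      apply: (@cg_over_family _ _ _ _ nat (fun l => [seq basis t | t <- s l])).
      + exact: submod0 (supp_submod _ _).
      + by move=> l y /mapP [t ts ->]; apply: supp_inj; apply/hs'; right; exists l.
      + move=> N sN SN gN w hw; apply: (supp_span sN _ hw) => t /hs' [h|[l ts]].
          by apply: SN; apply: supp_inj.
        by apply: (gN l); apply/mapP; exists t.
    have [|g [gB hg]] := cg_over_inter noeth (supp_submod _ S) (supp_submod _ U)
      (submod_preim e (submod_eq0 M)) _ cg; first by move=> w; apply: supp_sub.
    pose y l := sval (cid ((hie _).1 (gB l).2)).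
    have hy l : i (y l) = g l by rewrite /y; case: cid.
    have [j' [jj' yj' [z [zj' hz]]]] := FKext jq' y.
    pose U' t := U t \/ exists l, t \in suppl (i (z l)).
    have UU' t : U t -> U' t by left.
    have hU' k : FK j' k -> supp U' (i k).
      apply: (hz (fun k => supp U' (i k)) (submod_preim i (supp_submod _ _))).
        by move=> k' /qS; apply: supp_sub.
      by move=> l; apply: supp_sub (supplP (w := i (z l))) => t ht; right; exists l.
    have bigU' : big U'.
      exists (fun l => if odd l then s l./2 else suppl (i (z l./2))) => t; split.
        case=> [/hs' [h|[l ts]]|[l ts]]; [by left | right | right].
          by exists l.*2.+1; rewrite /= odd_double /= uphalf_double.
        by exists l.*2; rewrite odd_double doubleK.
      case=> [h|[l]]; first by left; apply/hs'; left.
      by case: ifP => _ ts; [left; apply/hs'; right; exists l./2 | right; exists l./2].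
    exists (exist _ (U', j') (And3 (letr _ _ _ jq jj') hU' bigU')); split=> // k hk /=.
    have [y' Fy' /ii <-//] : exists2 y', FK j' y' & i y' = i k.
    apply: (hg (fun w => exists2 y', FK j' y' & i y' = w)).
    + apply: submod_im (FKsub j').
    + move=> w [Sw /hie [k' ek']]; exists k' => //.
      apply: (FKmono _ _ _ (letr _ _ _ jq jj')); apply/pP; by rewrite ek'.
    + by move=> l; exists (y l).
    + by split=> //; apply/hie; exists k.
  have [nx hnx] := choice next.
  pose w l := sval (cid (se (x l))); have ew l : e (w l) = x l by rewrite /w; case: cid.
  pose S0 t := S t \/ exists l, t \in suppl (w l).
  have q0P : [/\ leK j j, forall k, FK j k -> supp S0 (i k) & big S0].
    split=> //; first by move=> k /pP; apply: supp_sub => t; left.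
    by exists (fun l => suppl (w l)).
  pose q l : St := iter l nx (exist _ (S0, j) q0P).
  have qS l : [/\ forall t, (sval (q l)).1 t -> (sval (q l.+1)).1 t,
      leK (sval (q l)).2 (sval (q l.+1)).2
    & forall k, supp (sval (q l)).1 (i k) -> FK (sval (q l.+1)).2 k] := hnx (q l).
  have [b [hb hF]] := omega_ub cFK (f := fun l => (sval (q l)).2) (fun l => let: And3 _ h _ := qS l in h).
  pose U t := exists l, (sval (q l)).1 t.
  have Umono l m t : (l <= m)%N -> (sval (q l)).1 t -> (sval (q m)).1 t.
    move=> lm hl; elim: m lm => [|m IH]; first by rewrite leqn0 => /eqP <-.
    by rewrite leq_eqVlt => /orP [/eqP <- // | /IH]; have [h _ _] := qS m; apply: h.
  have Ufin (w' : E) : supp U w' -> exists l, supp (sval (q l)).1 w'.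
    move=> hw'; have [|||->|[l _ h]] := @supp_chain nat T _ (fun a b => is_true (a <= b)%N) (fun _ => True)
      (fun l t => (sval (q l)).1 t) w'.
    + by move=> a a' _ _; apply/orP/leq_total.
    + by move=> a a' t; apply: Umono.
    + by apply: supp_sub hw' => t [l h]; exists l.
    + by exists 0%N; apply: submod0 (supp_submod _ _).
    + by exists l.
  have hUb k : FK b k <-> supp U (i k).
    split=> [/(hF tt) [->|[l hl]] | /Ufin [l hl]].
    + by rewrite linear0; apply: submod0 (supp_submod _ _).
    + have [_ h _] := svalP (q l); apply: supp_sub (h _ hl) => t ht; by exists l.
    + have [_ _ h] := qS l; exact: FKmono (hb l.+1) (h _ hl).
  exists (exist _ (U, b) hUb); split.
  + split=> [t St_ | ] /=; first by exists 0%N; left.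
    exact: (hb 0%N).
  + move=> l; exists (w l) => //=; apply: supp_sub (supplP (w := w l)) => t ht.
    by exists 0%N; right; exists l.
  + pose s l := sval (cid (let: And3 _ _ h := svalP (q l) in h)).
    have hsl l t : (sval (q l)).1 t <-> S t \/ exists m, t \in s l m by rewrite /s; case: cid.
    apply: (@cg_over_family _ _ _ _ (nat * nat)%type
      (fun m => [seq e (basis t) | t <- s m.1 m.2])).
    * by exists 0; [apply: submod0 (supp_submod _ _) | rewrite linear0].
    * move=> [l m] y /mapP [t ts ->]; exists (basis t) => //; apply: supp_inj.
      by exists l; apply/hsl; right; exists m.
    * move=> N sN FN gN y [w' hw' <-].
      apply: (@supp_span T U (fun w => N (e w)) w' (submod_preim e sN)) => // t [l /hsl].
      case=> [ht|[m ts]]; first by apply: FN; exists (basis t) => //; apply: supp_inj.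
      by apply: (gN (l, m)); apply/mapP; exists t.
Qed.

Lemma hill_pd n M : left_noetherian R -> pd n M -> hill n M.
Proof.
move=> noeth; elim: n M => [|n IH] M pM; first exact: hill_projective.
have [T [e se]] := free_cover M; have [K [i hs]] := ker_exists se.
apply: (hill_syzygy noeth hs); apply: IH.
by apply: pd_syzygy hs _ pM; apply/projective_DS/projective_ring.
Qed.

End Hill.

(** * Resolutions and filtrations of complexes *)

Section Resolutions.

Variable R : pzRingType.
Implicit Types M N Q : lmodType R.

Lemma has_resolutionP (C : mod_class R) n M : (forall M N, miso M N -> C M -> C N) ->
  has_resolution C n M <-> res C n M.
Proof.
move=> hC; split; elim: n M => [|n IH] M.
- move=> [P [d [e [CP P0 se ed dd]]]]; apply: (hC _ _ _ (CP 0%N (leqnn _))).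
  exists e; split=> //; apply: lin_inj => x /ed [y <-].
  by rewrite (P0 1%N isT y) linear0.
- move=> [P [d [e [CP P0 se ed dd]]]]; have [K [i hs]] := ker_exists se.
  have [ii _ hie] := hs.
  exists K, (P 0%N), i, e; split=> //; first exact: CP.
  have [|e' he'] := @factor_inj _ _ _ _ i (d 0%N) ii.
    by move=> y; apply/hie/ed; exists y.
  apply: IH; exists (fun k => P k.+1), (fun k => d k.+1), e'; split=> //.
  + by move=> k kn; apply: CP.
  + by move=> k kn; apply: P0.
  + move=> k; have [|y hy] := (ed (i k)).1; first by apply/hie; exists k.
    by exists y; apply: ii; rewrite he'.
  + move=> x; rewrite -dd -he'; split=> [-> | h]; first by rewrite linear0.
    by apply: ii; rewrite h linear0.
- move=> CM; have [Z [z [zi hz]]] := sub_exists (submod_eq0 M).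
  have Z0 (x : Z) : x = 0 by apply: zi; rewrite linear0; apply/hz; exists x.
  exists (fun k => if k is 0%N then M else Z), (fun k => \0), [the {linear M -> M} of idfun].
  split=> [[|k] // | [|k] // | x | x | k x].
  + by exists x.
  + by rewrite /=; split=> [-> | [_ <-]//]; exists 0.
  + by split=> // _; exists 0; rewrite /= (Z0 x).
- move=> [K [P0 [i [e [[ii se hie] CP0 /IH [P [d [e' [CP Pn se' ed dd]]]]]]]]].
  pose P' k := if k is k'.+1 then P k' else P0.
  pose d' k : {linear P' k.+1 -> P' k} :=
    match k return {linear P' k.+1 -> P' k} with
    | 0%N => [the {linear P 0%N -> P0} of i \o e'] | k'.+1 => d k' end.
  exists P', d', e; split=> //.
  + by case=> [|k] //; apply: CP.
  + by case=> [|k] //; apply: Pn.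
  + move=> x; rewrite hie; split=> [[k <-] | [y <-]]; last by exists (e' y).
    by have [y <-] := se' k; exists y.
  + case=> [|k] x /=; last exact: dd.
    rewrite -ed; split=> [h | ->]; last by rewrite linear0.
    by apply: ii; rewrite h linear0.
Qed.

Lemma proj_dim_leP n M : proj_dim_le n M <-> pd n M.
Proof. exact: (has_resolutionP n M (@projective_iso R)). Qed.

Lemma countably_generated_im M N (e : {linear M -> N}) :
  surjective_fun e -> countably_generated M -> countably_generated N.
Proof.
move=> se [g hg]; exists (fun i => e (g i)) => y; have [x <-] := se y.
have [k [a ->]] := hg x; exists k, a; rewrite linear_sum.
by apply: eq_bigr => i _; rewrite linearZ.
Qed.

Lemma proj_dim_le_countableP n M : left_noetherian R ->
  proj_dim_le_countable n M <-> pd n M /\ countably_generated M.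
Proof.
move=> noeth; split=> [[P [d [e [CP P0 se ed dd]]]] | [pM cM]].
  split; last by apply: countably_generated_im se _; have [] := CP 0%N.
  by apply/proj_dim_leP; exists P, d, e; split=> // k /CP [].
apply/has_resolutionP; last exact: res_countable.
move=> M' N' MN [pM' cM']; split; first exact: projective_iso MN pM'.
by have [f [_ sf]] := MN; apply: countably_generated_im sf cM'.
Qed.

(** An instance of [filtered_pd] for 0, ker e, M; taking the minimum with 2 identifies all indices
    from 2 on with the top member. *)
Lemma pd_extension n (K : lmodType R) M N (i : {linear K -> M}) (e : {linear M -> N}) :
  ses i e -> pd n K -> pd n N -> pd n M.
Proof.
move=> [ii se hie] pK pN.
pose F (j : nat) (x : M) :=
  match j with 0%N => x = 0 | 1%N => e x = 0 | _ => True end.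
pose le j k := is_true (minn j 2 <= minn k 2)%N.
have Fsub j : submod (F j).
  case: j => [|[|j]]; [exact: submod_eq0 | exact: submod_preim (submod_eq0 N) | exact: submodT].
apply: (@filtered_pd _ n nat le M F).
  split=> //.
  - by move=> j; rewrite /le.
  - by move=> j k l; apply: leq_trans.
  - by case=> [|[|j]] [|[|k]] //= _ _ x // ->; rewrite linear0.
  - move=> A _; have [[a Aa a2]|h2] := pselect (exists2 a, A a & (2 <= a)%N).
      exists 2; split=> [b _|_ x _]; first by rewrite /le geq_minr.
      by right; exists a => //; case: a a2 {Aa} => [|[|a]].
    have [A1|n1] := pselect (A 1%N).
      exists 1%N; split=> [[|[|b]] Ab //|_ x hx]; last by right; exists 1%N.
      by case: h2; exists b.+2.
    exists 0%N; split=> [[|[|b]] Ab //|_ x hx]; last by left.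
    by case: h2; exists b.+2.
case=> [|[|j]] [x nx]; last by case: nx.
- exists 1%N, K, (fun x k => i k = x); split=> //; split.
  + exact: linrel_inv (linrel_fun i).
  + exact: hie.
  + by move=> k; exists (i k).
  + by move=> y; rewrite linear0; split=> [<-|->].
  + by move=> k h; apply: ii; rewrite h linear0.
- exists 2, N, (fun x y => e x = y); split=> //; split=> //.
  + exact: linrel_fun.
  + by move=> y; split=> // _; exists (e y).
  + by move=> y; rewrite linear0.
Qed.

End Resolutions.

(** * From Hill families in each degree to filtrations of complexes *)

Section ComplexFiltration.

Variable R : pzRingType.
Implicit Types X Y Z Q : chain_complex R.

(** [hill] as a type of data, so that a family can be fixed in every degree simultaneously. *)
Record hill_data n (M : lmodType R) := HillData {
  hill_J : Type;
  hill_le : hill_J -> hill_J -> Prop;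
  hill_F : hill_J -> M -> Prop;
  hill_family : mod_family hill_le hill_F;
  hill_pd_step : forall j j', hill_le j j' -> exists (Q : lmodType R) (r : M -> Q -> Prop),
    subquot (hill_F j) (hill_F j') r /\ pd n Q;
  hill_ext : forall j (x : nat -> M), exists j',
    [/\ hill_le j j', forall i, hill_F j' (x i) & cg_over (hill_F j) (hill_F j')] }.

Lemma hill_choose n (M : lmodType R) : hill n M -> inhabited (hill_data n M).
Proof. by case=> J [le [F [h1 h2 h3]]]; split; exists J le F. Qed.

(** Members choose one Hill member per degree, compatibly with d. To enlarge one, insert a missing
    element in its degree and then repeatedly absorb the boundaries of the countably many new
    generators. The union over the steps is stable under d and again lies in the Hill family of each
    degree. *)
Lemma complex_filtration n X : left_noetherian R -> (forall m, pd n (X m)) ->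
  exists (J : Type) (le : J -> J -> Prop) (F : J -> forall m, X m -> Prop),
  [/\ cont_family le F, forall j, subcx (F j)
    & forall j, (exists m x, ~ F j m x) -> exists j', [/\ le j j', ~ le j' j
      & forall m, (exists (Q : lmodType R) (r : X m -> Q -> Prop),
          subquot (F j m) (F j' m) r /\ pd n Q) /\ cg_over (F j m) (F j' m)]].
Proof.
move=> noeth pX.
have D m : hill_data n (X m).
  by apply: (@inhabited_witness (hill_data n (X m))); exact/hill_choose/hill_pd.
pose Jm m := hill_J (D m); pose lem m := @hill_le _ _ (D m); pose Fm m := @hill_F _ _ (D m).
have fam m : mod_family (@lem m) (@Fm m) := hill_family (D m).
have ref m j : @lem m j j by have [h _ _ _ _] := fam m; apply: h.
have tra m j k l : @lem m j k -> lem m k l -> lem m j l.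
  by have [_ h _ _ _] := fam m; apply: h.
have mon m j k x : @lem m j k -> Fm m j x -> Fm m k x.
  by have [_ _ h _ _] := fam m => jk; apply: (h _ _ jk tt).
have sub m j : submod (@Fm m j) by have [_ _ _ h _] := fam m; apply: (h j tt).
pose dok (j : forall m, Jm m) := forall m x, Fm m (j m) x -> Fm (m - 1) (j (m - 1)) (chain_d X m x).
pose J := {j : forall m, Jm m | dok j}.
pose le (j k : J) := forall m, lem m (sval j m) (sval k m).
pose F (j : J) m := Fm m (sval j m).
exists J, le, F; split.
- split=> //.
  + by move=> j m.
  + by move=> j k l h1 h2 m; apply: tra (h1 m) (h2 m).
  + by move=> j k h m x; apply: mon.
  + by move=> j m; apply: sub.
  + move=> A tot.
    have ub m : exists b, (forall a : J, A a -> lem m (sval a m) b) /\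
        forall x, Fm m b x -> x = 0 \/ exists2 a : J, A a & F a m x.
      have [_ _ _ _ chain] := fam m.
      have [_ _ [a Aa <-] [b Ab <-]|b [hb hF]] := chain (fun j => exists2 a : J, A a & sval a m = j).
        by have [h|h] := tot a b Aa Ab; [left | right]; apply: h.
      exists b; split=> [a Aa|x Fx]; first by apply: hb; exists a.
      have [->|[_ [a Aa <-] hx]] := hF tt x Fx; first by left.
      by right; exists a.
    pose b m := sval (cid (ub m)); have hb m := svalP (cid (ub m)); rewrite -/(b _) in hb.
    have bok : dok b.
      move=> m x /(hb m).2 [->|[a Aa ha]]; first by rewrite linear0; apply: submod0.
      by apply: mon ((hb _).1 a Aa) _; apply: (svalP a).
    exists (exist _ b bok); split=> [a Aa m | m x /(hb m).2 //]; exact: (hb m).1.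
- by move=> j; split=> [m | m x]; [apply: sub | apply: (svalP j)].
- move=> j [m0 [x0 nx0]].
  pose St := {k : forall m, Jm m | forall m, lem m (sval j m) (k m) /\ cg_over (F j m) (Fm m (k m))}.
  have grow (k : St) (x : forall m, nat -> X m) : exists k' : St,
      forall m, lem m (sval k m) (sval k' m) /\ forall i, Fm m (sval k' m) (x m i).
    have ex m := hill_ext (sval k m) (x m).
    pose k' m := sval (cid (ex m)).
    have hk' m : [/\ lem m (sval k m) (k' m), forall i, Fm m (k' m) (x m i)
        & cg_over (Fm m (sval k m)) (Fm m (k' m))] := svalP (cid (ex m)).
    have ok m : lem m (sval j m) (k' m) /\ cg_over (F j m) (Fm m (k' m)).
      have [h1 _ h3] := hk' m; have [h4 h5] := svalP k m; split; first exact: tra h4 h1.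
      by apply: cg_over_trans h5 h3 => // y; apply: mon.
    by exists (exist _ k' ok) => m; have [] := hk' m.
  have next (k : St) : exists k' : St, forall m, lem m (sval k m) (sval k' m) /\
      forall x, Fm m (sval k m) x -> Fm (m - 1) (sval k' (m - 1)) (chain_d X m x).
    pose g m := sval (cid (svalP k m).2).
    have hg m := svalP (cid (svalP k m).2); rewrite -/(g _) in hg.
    (* What degree m has to absorb are the boundaries of the generators of degree m + 1. *)
    have [k' hk'] := grow k (fun m i => d_above (g (m + 1) i)).
    exists k' => m; split; first by have [] := hk' m.
    have [h1 h2] := hg m; apply: (h2 (fun x => Fm (m - 1) (sval k' (m - 1)) (chain_d X m x))).
    + exact: submod_preim.
    + move=> x Fx; have [h3 _] := svalP k (m - 1); have [h4 _] := hk' (m - 1).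
      exact: mon (tra _ _ _ _ h3 h4) (svalP j m x Fx).
    + by move=> i; rewrite -(d_aboveE (fun m => g m i)); apply: (hk' _).2.
  have k0P m : lem m (sval j m) (sval j m) /\ cg_over (F j m) (Fm m (sval j m)).
    by split=> //; apply: cg_over_refl; exact: (submod0 (sub m (sval j m))).
  pose z m : X m := if m0 =P m is ReflectT e then eq_rect m0 (fun k => X k : Type) x0 m e else 0.
  have [k1 hk1] := grow (exist _ (sval j) k0P) (fun m _ => z m).
  have x0k1 : Fm m0 (sval k1 m0) x0.
    have [_ /(_ 0%N)] := hk1 m0; rewrite /z; case: eqP => // e.
    by rewrite (eq_irrelevance e erefl).
  have [nx hnx] := choice next.
  pose q l : St := iter l nx k1.
  have qS l m : lem m (sval (q l) m) (sval (q l.+1) m) /\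
      forall x, Fm m (sval (q l) m) x -> Fm (m - 1) (sval (q l.+1) (m - 1)) (chain_d X m x) :=
    hnx (q l) m.
  have ub m := omega_ub (fam m) (f := fun l => sval (q l) m) (fun l => (qS l m).1).
  pose b m := sval (cid (ub m)).
  have hb m : (forall l, lem m (sval (q l) m) (b m)) /\
    forall x, Fm m (b m) x -> x = 0 \/ exists l, Fm m (sval (q l) m) x.
    have [h1 h2] := svalP (cid (ub m)); split=> // x; exact: (h2 tt).
  have bok : dok b.
    move=> m x /(hb m).2 [->|[l hl]]; first by rewrite linear0; apply: submod0.
    by apply: mon ((hb _).1 l.+1) _; apply: (qS l m).2.
  have jb m : lem m (sval j m) (b m) by apply: tra (svalP (q 0%N) m).1 ((hb m).1 0%N).
  exists (exist _ b bok); split=> //.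
    move=> h; apply: nx0; apply: (mon _ _ _ _ (h m0)) => /=.
    exact: mon ((hb m0).1 0%N) x0k1.
  move=> m; split; first exact: hill_pd_step (jb m).
  apply: (@cg_over_union _ _ _ _ (fun l => Fm m (sval (q l) m))).
  + exact: sub.
  + by move=> l x; apply: mon; apply: (hb m).1.
  + exact: (hb m).2.
  + by move=> l; apply: (svalP (q l) m).2.
Qed.

End ComplexFiltration.

(** * The cotorsion pair *)

Section CotorsionPair.

Variables (R : pzRingType) (n : nat).
Hypothesis noeth : left_noetherian R.
Implicit Types X Y Z Q : chain_complex R.

Notation A := (dw (@proj_dim_le R n)).
Notation S := (dw (@proj_dim_le_countable R n)).

Lemma dwP X : A X <-> forall m, pd n (X m).
Proof. by split=> h m; apply/proj_dim_leP. Qed.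

Lemma dw_countable_sub X : S X -> A X.
Proof. by move=> h; apply/dwP => m; have [] := (proj_dim_le_countableP n _ noeth).1 (h m). Qed.

Lemma subcx_ker X Y (f : chain_map X Y) : subcx (fun m x => f m x = 0).
Proof.
split=> [m | m x fx]; first exact: submod_preim (submod_eq0 _).
by rewrite chain_funP fx linear0.
Qed.

Lemma eklof_dw Y X : right_orth S Y -> A X -> Ext1_eq0 X Y.
Proof.
move=> hY /dwP pX; have [J [le [F [cF Fcx step]]]] := complex_filtration noeth pX.
apply: (eklof cF Fcx) => j /step [j' [jj' nj'j hj']].
have [_ _ mono _ _] := cF.
have [Q [r hr]] := subquot_cx_exists (Fcx j) (Fcx j') (fun m x => mono _ _ jj' m x).
exists j', Q, r; split=> //; apply: hY => m; apply/(proj_dim_le_countableP _ _ noeth).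
have [[Q' [r' [hr' pQ']]] cg] := hj' m; have [hrm _] := hr; split.
  by apply: pd_iso pQ'; apply: subquot_iso hr' (hrm m).
by apply/countably_generatedP; apply: cg_over_quot (hrm m) cg.
Qed.

(** Lift a presentation [f] of X by P to [u] into the middle of the extension. On K = ker f it takes
    values in Y, which defines [phi]. If [psi] extends [phi] to P, then [u] minus [psi] kills K, and
    its image is a complement of Y. *)
Lemma right_orth_of_extension Y :
  (forall (K : int -> disk_obj R nat -> Prop) (phi : forall m, disk_obj R nat -> Y m),
    relators n K ->
    (forall m a k k', K m k -> K m k' -> phi m (a *: k + k') = a *: phi m k + phi m k') ->
    (forall m k, K m k -> phi (m - 1) (disk_d R nat k) = chain_d Y m (phi m k)) ->
    exists psi : chain_map (disk R nat) Y, forall m k, K m k -> psi m k = phi m k) ->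
  right_orth S Y.
Proof.
move=> hY X SX E; have ex : short_exact (ext_in E) (ext_out E) := ext_exact E.
have cX m : countably_generated (X m).
  by have [] := (proj_dim_le_countableP n _ noeth).1 (SX m).
have [f sf] := disk_cover_countable cX.
have so m : surjective_fun (ext_out E m) by have [] := ex m.
have [u hu] := disk_lift f so.
have io m y : ext_out E m (ext_in E m y) = 0.
  by have [_ _ h] := ex m; apply/h; exists y.
pose K m (w : disk R nat m) := f m w = 0.
have relK : relators n K.
  split=> [|m]; first exact: subcx_ker.
  exists (X m), (fun x y => f m x = y); split; last exact: ((dwP X).1 (dw_countable_sub SX) m).
  split=> //; first exact: linrel_fun.
  - by move=> x; split=> // _; exists (f m x).
  - exact: sf.
  - by move=> q; rewrite linear0.
have phiex m k : exists y, K m k -> ext_in E m y = u m k.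
  have [Kk|nK] := pselect (K m k); last by exists 0.
  have [_ _ h] := ex m; have [|y hy] := (h (u m k)).1; first by rewrite hu.
  by exists y.
pose phi m k := sval (cid (phiex m k)).
have hphi m k : K m k -> ext_in E m (phi m k) = u m k := svalP (cid (phiex m k)).
have [Kcx _] := relK; have [Ksub Kd] := Kcx.
have inj m : injective (ext_in E m) by have [] := ex m.
have [||psi hpsi] := hY K phi relK.
- move=> m a k k' Kk Kk'; apply: (inj m).
  have h := (Ksub m).2 a k k' Kk Kk'.
  by rewrite hphi // !linearP /= !hphi.
- move=> m k Kk; apply: (inj (m - 1)); rewrite hphi; last exact: (Kd m).
  by rewrite chain_funP hphi // -chain_funP.
pose L m e := exists w, e = u m w - ext_in E m (psi m w).
apply: (@split_of_complement _ _ _ E L).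
- split=> [m|m e [w ->]].
    split=> [|a _ _ [w ->] [w' ->]]; first by exists 0; rewrite !linear0 ?addr0.
    by exists (a *: w + w'); rewrite !linearP /=; zmod.
  by exists (chain_d (disk R nat) m w); rewrite linearB -!chain_funP.
- move=> m e [w ->]; rewrite linearB io subr0 hu => Kw.
  by rewrite hpsi // hphi // subrr.
- move=> m x; have [w <-] := sf m x; exists (u m w - ext_in E m (psi m w)); first by exists w.
  by rewrite linearB io subr0 hu.
Qed.

Lemma special_preenvelope Z : exists Y X (i : chain_map Z Y) (p : chain_map Y X),
  [/\ A X, right_orth A Y & short_exact i p].
Proof.
have [B [C [i [p [ex pC hB]]]]] := small_object Z n.
exists B, C, i, p; split=> //; first exact/dwP.
by move=> X AX; apply: eklof_dw AX; apply: right_orth_of_extension.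
Qed.

(* Salce's trick: push out a presentation of [Z] by a complex of projective
   modules along a special preenvelope of its kernel. *)
Lemma special_precover Z : exists Y X (i : chain_map Y X) (p : chain_map X Z),
  [/\ A X, right_orth A Y & short_exact i p].
Proof.
have [T [f sf]] := disk_cover Z; set D := disk R T in f sf.
have [K [k [rk kd]]] := subquot_cx_exists (X := D) (A := fun m x => x = 0)
  (conj (fun m => submod_eq0 _) (fun m x (h : x = 0) => etrans (congr1 _ h) (linear0 _)))
  (subcx_ker f) (fun m x (h : x = 0) => etrans (congr1 _ h) (linear0 _)).
have [B [C [i [p [AC hB ex]]]]] := special_preenvelope K.
(* The antidiagonal copy of K, so the quotient Q is the pushout of B and D along K. Its quotient by
   B is Z, and its quotient by D is C. *)
pose N m (x : dsum B D m) := exists2 q, i m q = x.1 & k m (- x.2) q.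
have sN : subcx N.
  split=> m.
    have [lr _ _ _ _] := rk m; split=> [|a x y [q h1 h2] [q' h3 h4]].
      by exists 0; rewrite ?linear0 //= ?oppr0; apply: linrel0.
    exists (a *: q + q'); first by rewrite linearP h1 h3.
    have -> : - (a *: x + y).2 = a *: (- x.2) + (- y.2) by rewrite /=; zmod.
    exact: lr.2.
  move=> x [q h1 h2]; exists (chain_d K m q); first by rewrite chain_funP h1.
  by have := kd _ _ _ h2; rewrite linearN.
have [Q [r [hr dr]]] := subquot_cx_exists sN
  (conj (fun m => submodT (dsum B D m)) (fun m x _ => I)) (fun m x _ => I).
have inB m : linear (fun b : B m => (b, 0) : dsum B D m).
  by move=> a x y; congr pair; rewrite /= scaler0 addr0.
have fN m (x : dsum B D m) : N m x -> f m x.2 = 0.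
  move=> [q _ /(subquot_dom (rk m))]; rewrite linearN => /eqP.
  by rewrite oppr_eq0 => /eqP.
have [||||a ha] := @chain_of_rel R B Q (fun m b q => r m (b, 0) q).
- move=> m; have [lr _ _ _ _] := hr m; split=> [|c x y x' y' h h']; first exact: (linrel0 lr).
  by rewrite inB; apply: lr.2.
- by move=> m b; have [_ hd _ _ _] := hr m; apply/hd.
- by move=> m q; have [_ _ _ _] := hr m; apply.
- by move=> m b q /dr; rewrite /= /dsum_dfun /= linear0.
have [||||c hc] := @chain_of_rel R Q Z (fun m q z => exists x, r m x q /\ f m x.2 = z).
- move=> m; have [lr _ _ _ _] := hr m; split=> [|s q z q' z' [x [h1 h2]] [x' [h3 h4]]].
    by exists 0; rewrite linear0; split=> //; apply: linrel0.
  by exists (s *: x + x'); split; [apply: lr.2 | rewrite linearP /= h2 h4].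
- by move=> m q; have [_ _ sr _ _] := hr m; have [x hx] := sr q; exists (f m x.2), x.
- by move=> m z [x [h <-]]; apply: fN; have [_ _ _ h0 _] := hr m; apply/h0.
- move=> m q z [x [h <-]]; exists (chain_d (dsum B D) m x); split; first exact: dr.
  by rewrite -chain_funP.
have [||||g hg] := @chain_of_rel R Q C (fun m q z => exists x, r m x q /\ p m x.1 = z).
- move=> m; have [lr _ _ _ _] := hr m; split=> [|s q z q' z' [x [h1 h2]] [x' [h3 h4]]].
    by exists 0; rewrite linear0; split=> //; apply: linrel0.
  by exists (s *: x + x'); split; [apply: lr.2 | rewrite linearP /= h2 h4].
- by move=> m q; have [_ _ sr _ _] := hr m; have [x hx] := sr q; exists (p m x.1), x.
- move=> m z [x [h <-]]; have [_ _ _ h0 _] := hr m; have [_ _ hp] := ex m.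
  by have /h0 [q hq _] := h; apply/hp; exists q.
- move=> m q z [x [h <-]]; exists (chain_d (dsum B D) m x); split; first exact: dr.
  by rewrite -chain_funP.
exists B, Q, a, c; split=> //.
(* In each degree Q is an extension of [C m] by the projective module [D m]. *)
- apply/dwP => m; have [lr hd sr h0 hf] := hr m; have [ii sp hip] := ex m.
  have [lk hdk srk h0k hfk] := rk m.
  have inD : linear (fun x : D m => (0, x) : dsum B D m).
    by move=> s x y; congr pair; rewrite /= scaler0 addr0.
  have [|||j hj] := @lin_of_rel _ (D m) (Q m) (fun x q => r m (0, x) q).
  + split=> [|s x q x' q' h h']; first exact: (linrel0 lr).
    by rewrite inD; apply: lr.2.
  + by move=> x; apply/hd.
  + exact: hf.
  apply: (@pd_extension _ n _ _ _ j (g m)); last exact: (dwP C).1 AC m.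
    split.
    * apply: lin_inj => x /hj /h0 [q /= iq]; have -> : q = 0 by apply: ii; rewrite iq linear0.
      by move=> /h0k /eqP; rewrite oppr_eq0 => /eqP.
    * move=> z; have [b <-] := sp z; have [q hq] := (hd (b, 0)).1 I.
      by exists q; apply/hg; exists (b, 0).
    * move=> q; split=> [/hg [x [hx /hip [y hy]]] | [x /hj hx]]; last first.
        by apply/hg; exists (0, x); rewrite linear0.
      have [d hdy] := srk y; exists (x.2 + d); apply/hj.
      apply: (subquot_shift (hr m) hx); exists (- y); first by rewrite linearN hy /= sub0r.
      rewrite /=; have -> : - (x.2 + d - x.2) = - d by zmod.
      by rewrite -[- d]sub0r -[- y]sub0r; apply: linrelB => //; apply: linrel0.
  exact/projective_pd/projective_disk.
- move=> m; have [lr hd sr h0 hf] := hr m; have [ii sp hip] := ex m.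
  have [lk hdk srk h0k hfk] := rk m; split.
  + apply: lin_inj => b /ha /h0 [q /= <-]; rewrite oppr0 => /hfk ->.
    exact: linear0.
  + move=> z; have [x <-] := sf m z; have [q hq] := (hd (0, x)).1 I.
    by exists q; apply/hc; exists (0, x).
  + move=> q; split=> [/hc [x [hx fx]] | [b /ha hb]]; last first.
      by apply/hc; exists (b, 0); rewrite linear0.
    have [y hy] : exists y, k m x.2 y by apply/hdk.
    exists (x.1 + i m y); apply/ha; apply: (subquot_shift (hr m) hx).
    exists y; first by rewrite /=; zmod.
    by rewrite /= sub0r opprK.
Qed.

(** The special precover of X splits, its kernel being in the right-hand class, so X is a degreewise
    retract of a complex in [A]. *)
Lemma dw_left_orth X : left_orth (right_orth A) X -> A X.
Proof.
move=> hX; have [Y [W [i [p [/dwP AW hY ex]]]]] := special_precover X.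
have [phi [phi1 phi2]] := hX _ hY (Extension ex); rewrite /= in phi phi1 phi2.
apply/dwP => m; have [ii sp hip] := ex m.
have [|||s hs] := @lin_of_rel _ (X m) (W m) (fun x w => (phi m w).1 = 0 /\ p m w = x).
- split=> [|a x y x' y' [h1 h2] [h3 h4]]; first by rewrite !linear0.
  by rewrite !linearP /= h1 h2 h3 h4 scaler0 addr0.
- move=> x; have [w hw] := sp x; exists (w - i m (phi m w).1).
  rewrite !linearB /= phi1 /= subrr hw; split=> //.
  have -> : p m (i m (phi m w).1) = 0 by apply/hip; exists (phi m w).1.
  by rewrite subr0.
- move=> w [h1 /hip [y hy]]; move: h1; rewrite -hy phi1 /= => ->; exact: linear0.
apply: (pd_retract (i := s) (e := p m) (AW m)) => x.
by have [] := (hs x (s x)).2 erefl.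
Qed.

(** Every complex in [S] is a quotient of the one complex [disk R nat], whose subcomplexes serve as
    labels. *)
Lemma essentially_small_dw_countable : essentially_small S.
Proof.
pose P := disk R nat.
pose Lab := {K : int -> disk_obj R nat -> Prop | @subcx R P K}.
have F (K : Lab) : {Q : chain_complex R |
    exists r : forall m, P m -> Q m -> Prop, @subquot_cx R P (sval K) (fun _ _ => True) Q r}.
  apply: cid; apply: (subquot_cx_exists (svalP K)) => //; split=> // m; exact: submodT.
exists Lab, (fun K => sval (F K)) => X SX.
have cX m : countably_generated (X m).
  by have [] := (proj_dim_le_countableP n _ noeth).1 (SX m).
have [f sf] := disk_cover_countable cX.
exists (exist _ (fun m w => f m w = 0) (subcx_ker f)).
case: (F _) => Q [r [hr dr]] /=; rewrite /= in r hr dr.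
have [||||g hg] := @chain_of_rel R X Q (fun m x q => exists w, f m w = x /\ r m w q).
- move=> m; have [lr _ _ _ _] := hr m.
  exact: linrel_comp (linrel_inv (linrel_fun (f m))) lr.
- move=> m x; have [w hw] := sf m x; have [_ hd _ _ _] := hr m.
  by have [q hq] := (hd w).1 I; exists q, w.
- move=> m q [w [fw hw]]; have [_ _ _ h0 _] := hr m.
  by apply: (subquot_fun (hr m) hw); apply/h0.
- by move=> m x q [w [<- /dr h]]; exists (chain_d P m w); rewrite chain_funP.
have [||||g' hg'] := @chain_of_rel R Q X (fun m q x => exists w, r m w q /\ f m w = x).
- move=> m; have [lr _ _ _ _] := hr m.
  exact: linrel_comp (linrel_inv lr) (linrel_fun (f m)).
- move=> m q; have [_ _ sr _ _] := hr m; have [w hw] := sr q; by exists (f m w), w.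
- by move=> m x [w [hw <-]]; have [_ _ _ h0 _] := hr m; apply/h0.
- by move=> m q x [w [/dr h <-]]; exists (chain_d P m w); rewrite chain_funP.
exists g, g'; split=> [m x | m q].
  by have [w [fw hw]] := (hg m x _).2 erefl; apply/hg'; exists w.
by have [w [hw fw]] := (hg' m q _).2 erefl; apply/hg; exists w.
Qed.

End CotorsionPair.

Theorem mainTheorem3 (R : pzRingType) (hR : noetherian R)
    (n : nat) (hn : (0 < n)%N) :
  let A : cplx_class R := dw (@proj_dim_le R n) in
  let B : cplx_class R := right_orth A in
  [/\ cotorsion_pair A B,
      complete_pair A B
    & cogenerated_by A B (dw (@proj_dim_le_countable R n))].
Proof.
have [noeth _] := hR => A B; split.
- split=> // X; split; last exact: dw_left_orth.
  by move=> AX Y; apply.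
- by move=> Z; split; [exact: special_precover | exact: special_preenvelope].
- split.
  + by move=> X; apply: dw_countable_sub.
  + exact: essentially_small_dw_countable.
  + move=> Y; split=> [BY X /(dw_countable_sub noeth) | SY X]; first exact: BY.
    exact: eklof_dw.
Qed.
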